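(* Let $\alpha\in(0,n)$, $0<s<\frac{n}{\alpha}$, and $q\in[1,s)$. There exists a constant $B>0$ such that $$\int_{\mathbb{R}^n}(I_\alpha|f|)^q\,d\mathrm{cap}_{\alpha,s}\le B\,\|f\|^q_{\dot{KV}_q}$$ for all $f\in\dot{KV}_q$.
   Context: Here $n\ge1$ is an integer. For $0<\alpha<n$ the Riesz potential is $I_\alpha f(x)=\gamma(n,\alpha)\int_{\mathbb{R}^n}|x-y|^{\alpha-n}f(y)\,dy$, with $\gamma(n,\alpha)=\Gamma(\frac{n-\alpha}{2})/[\pi^{n/2}2^\alpha\Gamma(\frac{\alpha}{2})]$. The Riesz capacity of $E\subset\mathbb{R}^n$ is $\mathrm{cap}_{\alpha,s}(E)=\inf\{\|f\|_{L^s(\mathbb{R}^n)}^s: f\ge0,\ I_\alpha f\ge1\text{ on }E\}$. ''q.e.'' means except on a set of zero $\mathrm{cap}_{\alpha,s}$-capacity. For a q.e. defined $g$ with values in $[0,\infty]$, $\int_{\mathbb{R}^n}g\,d\mathrm{cap}_{\alpha,s}=\int_0^\infty\mathrm{cap}_{\alpha,s}(\{g>t\})\,dt$, and $\|u\|_{L^q(\mathrm{cap}_{\alpha,s})}=(\int|u|^q\,d\mathrm{cap}_{\alpha,s})^{1/q}$. A weight is a nonnegative locally integrable function on $\mathbb{R}^n$. For $1\le q<s$, $\dot{\widetilde{O}}^{\alpha,s}_q$ is the space of measurable functions $g$ on $\mathbb{R}^n$ with finite quasi-norm $\|g\|_{\dot{\widetilde{O}}^{\alpha,s}_q}=\inf_w(\int_{\{g\ne0\}}|g|^sw^{q-s}\,dx)^{1/s}$,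 the infimum being over all q.e. defined weights $w$ with $\|w\|_{L^q(\mathrm{cap}_{\alpha,s})}\le1$. The Kalton-Verbitsky space $\dot{KV}_q=\dot{KV}_q^{\alpha,s}$ is the set of Lebesgue measurable functions $f$ on $\mathbb{R}^n$ with $\|f\|_{\dot{KV}_q}<+\infty$, where $$\|f\|_{\dot{KV}_q}=\inf\Big\{\Big(\int_{\mathbb{R}^n}h^s(I_\alpha h)^{q-s}\,dx\Big)^{1/q}: h\in\dot{\widetilde{O}}^{\alpha,s}_q,\ h\ge|f|\text{ a.e.}\Big\}.$$ Convention: $h^s(I_\alpha h)^{q-s}$ is taken to be $0$ where $h=0$. *)

(* Defs.v *)
From HB Require Import structures.
From mathcomp Require Import all_boot all_order all_algebra.
From mathcomp Require Import all_classical all_reals all_analysis.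
From mathcomp Require Import measurable_realfun.
Set Implicit Arguments.
Unset Strict Implicit.
Unset Printing Implicit Defensive.
Import Order.TTheory GRing.Theory Num.Theory.
Import numFieldNormedType.Exports.
Local Open Scope classical_set_scope.
Local Open Scope ring_scope.

(* n-dimensional Lebesgue measure: on Borel sets it is the n-fold product of
   the 1-dimensional one (the unit mass on the one-point space when n = 0).
   The measurable sets of [Rn R n] below are those of its Caratheodory
   completion, that is, all Lebesgue measurable sets. *)

Section borel_step.
Context {R : realType} (n : nat).
Local Notation RM := (measurableTypeR R).
Variable m : {sigma_finite_measure set (n.-tuple RM) -> \bar R}.

Definition cons_pair (p : RM * n.-tuple RM) : n.+1.-tuple RM :=
  [tuple of p.1 :: p.2].

Definition borel_step : set (n.+1.-tuple RM) -> \bar R :=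
  pushforward (@lebesgue_measure R \x m)%E cons_pair.

Lemma measurable_cons_pair : measurable_fun [set: _] cons_pair.
Proof. exact: (measurable_cons measurable_fst measurable_snd). Qed.

Let borel_step0 : borel_step set0 = 0%E.
Proof. by rewrite /borel_step /pushforward preimage_set0 measure0. Qed.

Let borel_step_ge0 A : (0 <= borel_step A)%E.
Proof. by rewrite /borel_step /pushforward measure_ge0. Qed.

Let borel_step_sigma_additive : semi_sigma_additive borel_step.
Proof.
move=> F mF tF mUF; rewrite /borel_step /pushforward preimage_bigcup.
have mpre A : measurable A -> measurable (cons_pair @^-1` A).
  by move=> mA; rewrite -[X in measurable X]setTI; exact: measurable_cons_pair.
apply: measure_semi_sigma_additive.
- by move=> k; exact: mpre.
- apply/trivIsetP => /= i j _ _ ij; rewrite -preimage_setI.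
  by move/trivIsetP : tF => /(_ _ _ _ _ ij) ->//; rewrite preimage_set0.
- by rewrite -preimage_bigcup; exact: mpre.
Qed.

HB.instance Definition _ := isMeasure.Build _ _ _ borel_step
  borel_step0 borel_step_ge0 borel_step_sigma_additive.

Let borel_step_sigma_finite : sigma_finite setT borel_step.
Proof.
pose uncons (t : n.+1.-tuple RM) : RM * n.-tuple RM :=
  (thead t, [tuple of behead t]).
have consK : cancel cons_pair uncons.
  case=> a t; rewrite /uncons /cons_pair /=; congr pair; exact/val_inj.
have munc : measurable_fun [set: _] uncons.
  apply: measurable_fun_pair; first exact: measurable_tnth.
  exact: measurable_behead.
have /sigma_finiteP[F [TF ndF Foo]] := sigma_finiteT (@lebesgue_measure R).
have /sigma_finiteP[G [TG ndG Goo]] := sigma_finiteT m.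
exists (fun k => uncons @^-1` (F k `*` G k)).
  apply/esym/seteqP; split=> // t _.
  have [i _ Fi] : (\bigcup_k F k) (uncons t).1 by rewrite -TF.
  have [j _ Gj] : (\bigcup_k G k) (uncons t).2 by rewrite -TG.
  exists (maxn i j) => //; split.
    by apply: (subsetPset _ _ (ndF _ _ (leq_maxl i j))).
  by apply: (subsetPset _ _ (ndG _ _ (leq_maxr i j))).
move=> k; have [mF Fk] := Foo k; have [mG Gk] := Goo k; split.
  by rewrite -[X in measurable X]setTI; apply: munc => //; exact: measurableX.
rewrite /borel_step /pushforward -comp_preimage.
rewrite (_ : uncons \o cons_pair = id) ?preimage_id; last exact/funext.
by rewrite product_measure1E// lte_mul_pinfty// ge0_fin_numE.
Qed.

HB.instance Definition _ :=
  @Measure_isSigmaFinite.Build _ _ _ borel_step borel_step_sigma_finite.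

End borel_step.

Fixpoint borel_lebesgue (R : realType) (n : nat) :
    {sigma_finite_measure set (n.-tuple (measurableTypeR R)) -> \bar R} :=
  match n with
  | 0 => @dirac _ _ [tuple] R
  | k.+1 => borel_step (borel_lebesgue R k)
  end.

Definition Rn (R : realType) (n : nat) :=
  caratheodory_type (mu_ext (borel_lebesgue R n)).
HB.instance Definition _ (R : realType) (n : nat) := Measurable.on (Rn R n).

Definition leb (R : realType) (n : nat) : set (Rn R n) -> \bar R :=
  @completed_measure_extension _ _ _ (borel_lebesgue R n).
HB.instance Definition _ (R : realType) (n : nat) := Measure.on (@leb R n).
HB.instance Definition _ (R : realType) (n : nat) :=
  @Measure_isSigmaFinite.Build _ _ _ (@leb R n)
    (completed_measure_extension_sigma_finite
      (sigma_finiteT (borel_lebesgue R n))).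

Definition eucl_dist (R : realType) (n : nat) (x y : Rn R n) : R :=
  Num.sqrt (\sum_(i < n) ((tnth x i : R) - (tnth y i : R)) ^+ 2).

Definition Gamma (R : realType) (x : R) : R :=
  (\int[@lebesgue_measure R]_(t in `]0%R, +oo[) (t `^ (x - 1) * expR (- t)))%R.

Section capacity.
Local Open Scope ereal_scope.
Context {R : realType} (n : nat) (alpha s q : R).
Local Notation leb := (@leb R n).
Implicit Types (f g h w : Rn R n -> \bar R) (E : set (Rn R n)).

(* The library's [poweR] has 0 `^ a = 0 and +oo `^ a = +oo also when a < 0;
   here 0 `^- a = +oo and +oo `^- a = 0, as usual. *)
Definition npoweR (x : \bar R) (a : R) : \bar R := (x `^ a)^-1.
Local Notation "x `^- a" := (npoweR x a) (at level 11) : ereal_scope.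

Definition gamma_na : R :=
  (Gamma ((n%:R - alpha) / 2) /
   (pi `^ (n%:R / 2) * 2 `^ alpha * Gamma (alpha / 2)))%R.

Definition Riesz f (x : Rn R n) : \bar R :=
  gamma_na%:E * \int[leb]_y ((eucl_dist x y)%:E `^- (n%:R - alpha)%R * f y).

Definition cap E : \bar R :=
  ereal_inf [set 'N[leb]_(s%:E)[f] `^ s | f in
    [set f : Rn R n -> \bar R | [/\ measurable_fun setT f, forall x, 0 <= f x &
                 forall x, E x -> 1 <= Riesz f x]]].

Definition qe (P : Rn R n -> Prop) : Prop := cap [set x | ~ P x] = 0.

Definition cap_integral g : \bar R :=
  \int[@lebesgue_measure R]_(t in `]0%R, +oo[) cap [set x | t%:E < g x].

Definition cap_norm g : \bar R :=
  (cap_integral (fun x => `|g x| `^ q)) `^ q^-1.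

(* Integrability on closed balls is local integrability, since every compact
   set lies in such a ball.
   A q.e. defined function is represented by a total function whose values on
   a set of zero capacity are irrelevant; hence [qe] instead of [forall x]. *)
Definition qe_weight w : Prop :=
  [/\ qe (fun x => 0 <= w x), measurable_fun setT w &
      forall (c : Rn R n) (r : R),
        leb.-integrable [set x | (eucl_dist c x <= r)%R] w].

Definition Onorm g : \bar R :=
  ereal_inf [set (\int[leb]_(x in [set x | g x != 0])
                   (`|g x| `^ s * w x `^- (s - q)%R)) `^ s^-1 | w in
    [set w : Rn R n -> \bar R | qe_weight w /\ cap_norm w <= 1]].

Definition Ospace : set (Rn R n -> \bar R) :=
  [set g : Rn R n -> \bar R | measurable_fun setT g /\ Onorm g < +oo].

Definition KVnorm f : \bar R :=
  ereal_inf [set (\int[leb]_x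
      (if h x == 0 then 0 else h x `^ s * Riesz h x `^- (s - q)%R)) `^ q^-1 | h in
    [set h : Rn R n -> \bar R | Ospace h /\ {ae leb, forall x, `|f x| <= h x}]].

Definition KVspace : set (Rn R n -> \bar R) :=
  [set f : Rn R n -> \bar R | measurable_fun setT f /\ KVnorm f < +oo].

End capacity.

(* Main.v *)
(** Write g = n - alpha and U for the potential of h with kernel rho^(-g), rho
    being the sup-norm distance, which is comparable to the Euclidean one. Select
    the maximal dyadic cubes Q containing a point z with
    \int max(side Q, rho(z, y))^(-g) h(y) dy > 1, and replace h by its average on
    each of them. The new function has potential at least 6^(-g) on {U > 1},
    and, for 1 < p < n/g, Hölder's inequality with \int_Q U^p <= C |Q| bounds its
    L^s norm by
      C (\int_{U <= 1} h^s + \int_{U >= 2^(-g)} h^s U^(-p(s-1))).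
    This bounds the capacity of {U > 1}. Applying it to h / t^(1/q) and integrating
    in t yields \int U^q dcap <= C \int h^s U^(q-s), since s - q < p(s-1).
    Membership in the space O only serves to make the selected cubes bounded: the
    capacity dominates the measure of density max(1, |x|)^(-g-g/(s-1)), against
    which w^q is therefore integrable, and Hölder's inequality then gives
    \int h(y) max(1, |y|)^(-g) dy < oo. *)

Require Import Defs.
From mathcomp Require Import all_boot all_order all_algebra.
From mathcomp Require Import all_classical all_reals all_analysis.
From mathcomp Require Import measurable_realfun.
From mathcomp Require Import zify ring lra.
Set Implicit Arguments.
Unset Strict Implicit.
Unset Printing Implicit Defensive.
Import Order.TTheory GRing.Theory Num.Theory.
Import numFieldNormedType.Exports.
Local Open Scope classical_set_scope.
Local Open Scope ring_scope.

(** The obvious test function for {U^q > t} is h / t^(1/q) itself, but its norm gives the integral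
    of t^(-s/q), which diverges at t = 0 because s > q. A gain is needed where U is large compared
    with t^(1/q); averaging over the stopping cubes produces it, in the form of the factor
    U^(-p(s-1)). Both bounds on p are used: p < n/g makes rho^(-gp) locally integrable, so that the
    mean of U^p over a stopping cube is bounded; p > 1 gives p(s-1) > s - q even when q = 1, so that
    small t become integrable. Maximality of a cube Q of side l acts through its parent: the kernel
    truncated at l has potential at most 2^g on Q, and balls of radius l centred in Q have mass at
    most (2l)^g. Averaging preserves the potential because a kernel truncated at a well chosen scale
    is nearly constant on every cube. The condition alpha s < n reads g + g/(s-1) > n: the density
    max(1, |x|)^(-g-g/(s-1)) is integrable. All estimates are proved on an abstract measure space
    with a distance, balls of measure at most A r^N and nested cells; R^n with dyadic cubes is
    substituted at the end. *)

Section npoweR_theory.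
Context {R : realType}.
Local Open Scope ereal_scope.
Implicit Types (x y : \bar R) (r a b : R).

(** * Negative powers of extended reals *)

Lemma npoweR_ge0 x a : 0 <= npoweR x a.
Proof. by rewrite /npoweR inve_ge0 poweR_ge0. Qed.

Lemma npoweR_EFin r a : (0 < r)%R -> npoweR r%:E a = (r `^ (- a))%:E.
Proof.
move=> r0; rewrite /npoweR poweR_EFin inver powRN ifF//.
by apply/negbTE; rewrite gt_eqF// powR_gt0.
Qed.

Lemma npoweR0 a : a != 0%R -> npoweR 0 a = +oo :> \bar R.
Proof. by move=> a0; rewrite /npoweR poweR0r// inve0. Qed.

Lemma npoweRy a : a != 0%R -> npoweR +oo a = 0 :> \bar R.
Proof. by move=> a0; rewrite /npoweR poweRyr// invey. Qed.

Lemma npoweR_le x y a : (0 < a)%R -> 0 <= x -> x <= y -> npoweR y a <= npoweR x a.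
Proof.
move=> a0 x0 xy; rewrite /npoweR inve_ple ?inE ?inve_ge0 ?poweR_ge0//.
rewrite inveK; apply: gt0_ler_poweR => //; first exact: ltW.
- by rewrite in_itv/= x0 leey.
- by rewrite in_itv/= leey (le_trans x0 xy).
Qed.

Lemma npoweRM r x a : (0 < r)%R -> (0 < a)%R -> 0 <= x ->
  npoweR (r%:E * x) a = (r `^ (- a))%:E * npoweR x a.
Proof.
move=> r0 a0; have an0 : a != 0%R by rewrite gt_eqF.
case: x => [x| |]//.
  rewrite lee_fin le_eqVlt => /predU1P[<-|x0].
    by rewrite mule0 !npoweR0// gt0_muley// lte_fin powR_gt0.
  by rewrite -EFinM !npoweR_EFin// ?mulr_gt0// powRM ?ltW.
by rewrite gt0_muley// !npoweRy// mule0.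
Qed.

Lemma measurable_npoweR a : measurable_fun [set: \bar R] (fun x => npoweR x a).
Proof.
(* The inverse on [0, +oo], spelled out by cases so that measurability reduces to that of a real
   power; the value of [poweR] is never negative. *)
pose f (x : \bar R) := if x == 0 then +oo else if x == +oo then 0
  else ((fine x) `^ (-1))%:E.
rewrite (_ : (fun x => _) = f \o (fun x => x `^ a)).
  apply: measurableT_comp; last exact: measurable_poweR.
  apply: measurable_fun_ifT => //.
    exact: measurable_fun_eqe.
  apply: measurable_fun_ifT => //.
    exact: measurable_fun_eqe.
  apply/measurable_EFinP.
  apply: (@measurableT_comp _ _ _ _ _ _ (fun x : R => x `^ (-1))%R _ fine).
    exact: measurable_powR.
  exact: fine_measurable.
apply/funext => x /=; rewrite /npoweR /f.
have := poweR_ge0 x a; case: (x `^ a) => [r| |]//.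
rewrite lee_fin eqe inver => r0; case: eqP => //= _.
by rewrite powR_inv1.
Qed.

Lemma measurable_fun_poweR d (T : measurableType d) (D : set T) (f : T -> \bar R) a :
  measurable_fun D f -> measurable_fun D (fun t => f t `^ a).
Proof.
by move=> mf; have := measurableT_comp (measurable_poweR a) mf.
Qed.

Lemma measurable_fun_npoweR d (T : measurableType d) (D : set T) (f : T -> \bar R) a :
  measurable_fun D f -> measurable_fun D (fun t => npoweR (f t) a).
Proof.
by move=> mf; have := measurableT_comp (measurable_npoweR a) mf.
Qed.

End npoweR_theory.

(** * Real powers *)

Section powR_tools.
Context {R : realType}.
Implicit Types x y a b r : R.

Lemma powRN_le x y b : 0 < x -> x <= y -> 0 <= b -> y `^ (- b) <= x `^ (- b).
Proof.
move=> x0 xy b0; rewrite !powRN lef_pV2 ?posrE ?powR_gt0 ?(lt_le_trans x0 xy)//.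
by rewrite ge0_ler_powR// nnegrE ltW// (lt_le_trans x0 xy).
Qed.

(** A factor c between distances costs c^e between kernels; most of the comparisons of kernels below
    come from this. *)
Lemma powRN_cmp (c a b e : R) : 0 < c -> 0 < a -> 0 <= e ->
  a <= c * b -> b `^ (- e) <= c `^ e * a `^ (- e).
Proof.
move=> c0 a0 e0 acb.
have acb' : a / c <= b by rewrite ler_pdivrMr// mulrC.
apply: le_trans (powRN_le (divr_gt0 a0 c0) acb' e0) _.
rewrite powRM ?invr_ge0 ?(ltW a0) ?(ltW c0)// -powR_inv1 ?(ltW c0)//.
by rewrite -powRrM mulrNN mul1r mulrC.
Qed.

Lemma powR_lt1 x a : 1 < x -> a < 0 -> x `^ a < 1.
Proof.
move=> x1 a0; rewrite /powR gt_eqF ?(lt_trans ltr01 x1)//.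
by rewrite expR_lt1 nmulr_rlt0// ln_gt0.
Qed.

Lemma powR_shell x r b : 0 < r -> r / 2 <= x -> x <= r ->
  x `^ (- b) <= 2 `^ `|b| * r `^ (- b).
Proof.
move=> r0 rx xr; have r20 : 0 < r / 2 by rewrite divr_gt0.
have x0 : 0 < x by exact: lt_le_trans rx.
have [b0|b0] := leP 0 b.
  rewrite ger0_norm// (le_trans (powRN_le r20 rx b0))//.
  rewrite powRM ?invr_ge0 ?(ltW r0)// mulrC -powR_inv1// -powRrM.
  by rewrite mulrNN mul1r.
rewrite (@le_trans _ _ (r `^ (- b)))//.
  by rewrite ge0_ler_powR ?nnegrE ?oppr_ge0// ltW.
by rewrite ler_peMl ?powR_ge0// -[leLHS](powRr0 2) ler_powR// ler1n.
Qed.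

Lemma powRX x a k : 0 <= x -> (x ^+ k) `^ a = (x `^ a) ^+ k.
Proof.
move=> x0; rewrite -(powR_mulrn k x0) -powRrM mulrC powRrM.
by rewrite powR_mulrn ?powR_ge0.
Qed.

End powR_tools.

Lemma measurable_levels d (T : measurableType d) (R : realType) (rho : T -> R) r :
  measurable_fun setT rho ->
  [/\ measurable [set y | rho y <= r], measurable [set y | rho y < r],
      measurable [set y | r <= rho y] & measurable [set y | r < rho y]].
Proof.
move=> mrho; have mI (i : interval R) : measurable [set y | rho y \in i].
  by rewrite -[X in measurable X]setTI; exact: (mrho measurableT _ (measurable_itv i)).
split.
- by have := mI `]-oo, r]; congr measurable; apply/seteqP; split=> y; rewrite /= in_itv.
- by have := mI `]-oo, r[; congr measurable; apply/seteqP; split=> y; rewrite /= in_itv.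
- by have := mI `[r, +oo[; congr measurable; apply/seteqP; split=> y; rewrite /= in_itv/= andbT.
- by have := mI `]r, +oo[; congr measurable; apply/seteqP; split=> y; rewrite /= in_itv/= andbT.
Qed.

Lemma measurable_comp_fst d1 d2 d3 (T1 : measurableType d1)
  (T2 : measurableType d2) (T3 : measurableType d3) (f : T1 -> T3) :
  measurable_fun setT f -> measurable_fun setT (fun p : T1 * T2 => f p.1).
Proof. by move=> mf; exact: (measurableT_comp mf measurable_fst). Qed.

Lemma measurable_comp_snd d1 d2 d3 (T1 : measurableType d1)
  (T2 : measurableType d2) (T3 : measurableType d3) (f : T2 -> T3) :
  measurable_fun setT f -> measurable_fun setT (fun p : T1 * T2 => f p.2).
Proof. by move=> mf; exact: (measurableT_comp mf measurable_snd). Qed.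

(** * Jensen's inequality and integrals of radial powers *)

Section integral_tools.
Context d (T : measurableType d) (R : realType).
Variable mu : {measure set T -> \bar R}.
Local Open Scope ereal_scope.

(** Measurability is not asked for: the integral of a nonnegative function is a supremum over the
    simple functions below it. This allows comparison of integrals in t of capacities of superlevel
    sets. *)
Lemma le_integral_nonneg (D : set T) (f g : T -> \bar R) :
  (forall x, D x -> 0 <= f x) -> (forall x, D x -> f x <= g x) ->
  \int[mu]_(x in D) f x <= \int[mu]_(x in D) g x.
Proof.
move=> f0 fg; have g0 x : D x -> 0 <= g x.
  by move=> Dx; exact: le_trans (f0 x Dx) (fg x Dx).
rewrite !ge0_integralE//; apply: ereal_sup_le => _ [k /= kf <-].
exists k => // x; apply: (le_trans (kf x)).
by apply: lee_restrict.
Qed.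

(** Young's inequality for g and l^(s-1). Equivalently, the convex function x^s lies above its
    tangent at l. *)
Lemma young_tangent (l g s : R) : (1 < s)%R -> (0 <= l)%R -> (0 <= g)%R ->
  (s * l `^ (s - 1) * g <= g `^ s + (s - 1) * l `^ s)%R.
Proof.
move=> s1 l0 g0.
have s0 : (0 < s)%R by exact: lt_trans s1.
have s10 : (0 < s - 1)%R by rewrite subr_gt0.
have := @conjugate_powR _ g (l `^ (s - 1))%R s (s / (s - 1))%R g0 (powR_ge0 _ _)
  s0 (divr_gt0 s0 s10).
rewrite -powRrM (_ : (s - 1) * (s / (s - 1)) = s)%R; last by field; rewrite gt_eqF.
have -> : (s^-1 + (s / (s - 1))^-1 = 1)%R by field; rewrite !gt_eqF.
move=> /(_ erefl); rewrite -(ler_pM2l s0).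
rewrite (_ : s * (_ + _) = g `^ s + (s - 1) * l `^ s)%R; last first.
  by field; rewrite !gt_eqF.
by apply: le_trans; rewrite mulrA mulrAC.
Qed.

(** The best tangent is the one at the mean l = I / W. *)
Lemma tangent_powR (I W G s : R) : (1 < s)%R -> (0 <= I)%R -> (0 < W)%R ->
  (forall l, (0 <= l)%R ->
    (s * l `^ (s - 1) * I <= G + (s - 1) * l `^ s * W)%R) ->
  (I `^ s <= W `^ (s - 1) * G)%R.
Proof.
move=> s1 I0 W0 tangent.
have s0 : (0 < s)%R by exact: lt_trans s1.
have s10 : (0 < s - 1)%R by rewrite subr_gt0.
have l0 : (0 <= I / W)%R by rewrite divr_ge0// ltW.
have IE : I = (I / W * W)%R by rewrite divfK// gt_eqF.
have := tangent _ l0; rewrite {2}IE.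
move: (I / W)%R IE l0 => l -> l0; rewrite powRM ?(ltW W0)//.
rewrite -(mulr_powRB1 l0 s0) -(mulr_powRB1 (ltW W0) s0) => H.
have {}H : (l * l `^ (s - 1) * W <= G)%R by lra.
rewrite [leLHS](_ : _ = W `^ (s - 1) * (l * l `^ (s - 1) * W))%R; last by ring.
by rewrite ler_wpM2l// powR_ge0.
Qed.

(** Jensen's inequality for the measure w dmu; every use of Hölder's inequality below is an
    instance. The tangent inequality at g(x) is integrated against w and the tangent is then
    optimised. Zero or infinite integrals are separated beforehand. *)
Lemma jensen_powR (D : set T) (w g : T -> \bar R) (s : R) : (1 < s)%R ->
  measurable D -> measurable_fun D w -> measurable_fun D g ->
  (forall x, D x -> 0 <= w x) -> (forall x, D x -> 0 <= g x) ->
  (\int[mu]_(x in D) (w x * g x)) `^ s <=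
  (\int[mu]_(x in D) w x) `^ (s - 1) * \int[mu]_(x in D) (w x * g x `^ s).
Proof.
move=> s1 mD mw mg w0 g0.
have s0 : (0 < s)%R by exact: lt_trans s1.
have sn0 : s != 0%R by rewrite gt_eqF.
have s10 : (0 < s - 1)%R by rewrite subr_gt0.
have mgs : measurable_fun D (fun x => g x `^ s).
  exact: measurable_fun_poweR.
have mwg : measurable_fun D (fun x => w x * g x) by exact: emeasurable_funM.
have mwgs : measurable_fun D (fun x => w x * g x `^ s) by exact: emeasurable_funM.
have wg0 x : D x -> 0 <= w x * g x by move=> Dx; rewrite mule_ge0 ?w0 ?g0.
have wgs0 x : D x -> 0 <= w x * g x `^ s.
  by move=> Dx; rewrite mule_ge0 ?w0 ?poweR_ge0.
set I := \int[mu]_(x in D) (w x * g x).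
set W := \int[mu]_(x in D) w x.
set G := \int[mu]_(x in D) (w x * g x `^ s).
have I0 : 0 <= I by exact: integral_ge0.
have W0 : 0 <= W by exact: integral_ge0.
have G0 : 0 <= G by exact: integral_ge0.
have [Ie|In0] := eqVneq I 0.
  by rewrite Ie poweR0r// mule_ge0// poweR_ge0.
have ae0 (f : T -> \bar R) : measurable_fun D f -> (forall x, D x -> 0 <= f x) ->
    (\int[mu]_(x in D) f x = 0) -> (forall x, D x -> f x = 0 -> w x * g x = 0) ->
    I = 0.
  move=> mf f0 f_0 fwg.
  have : ae_eq mu D f (cst 0).
    apply/ae_eq_integral_abs => //.
    by rewrite -[RHS]f_0; apply: eq_integral => x; rewrite inE => Dx; rewrite gee0_abs ?f0.
  move=> H; rewrite /I (ae_eq_integral (cst 0))//; first exact: integral0.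
  by apply: filterS H => x H Dx; rewrite (fwg x Dx (H Dx)).
have Wn0 : W != 0.
  apply/eqP => We; move/eqP: In0; apply; apply: (ae0 w) => // x _ ->.
  by rewrite mul0e.
have Gn0 : G != 0.
  apply/eqP => Ge; move/eqP: In0; apply.
  apply: (ae0 (fun x => w x * g x `^ s)) => // x Dx /eqP.
  rewrite mule_eq0 => /orP[/eqP->|]; first by rewrite mul0e.
  by rewrite poweR_eq0 ?g0// => /andP[/eqP-> _]; rewrite mule0.
have Wgt0 : 0 < W by rewrite lt0e Wn0.
have Ggt0 : 0 < G by rewrite lt0e Gn0.
have [Wy|Wny] := eqVneq W +oo.
  by rewrite Wy poweRyr ?gt_eqF// gt0_mulye// leey.
have [Gy|Gny] := eqVneq G +oo.
  by rewrite Gy gt0_muley ?poweR_gt0// leey.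
have tangent (l : R) : (0 <= l)%R ->
    (s * l `^ (s - 1))%:E * I <= G + ((s - 1) * l `^ s)%:E * W.
  move=> l0; rewrite -!ge0_integralZl_EFin//; last 2 first.
  - by rewrite mulr_ge0 ?powR_ge0 ?ltW.
  - by rewrite mulr_ge0 ?powR_ge0 ?ltW.
  rewrite -ge0_integralD//; last 2 first.
  - by move=> x Dx; rewrite mule_ge0 ?w0// lee_fin mulr_ge0 ?powR_ge0 ?ltW.
  - exact: measurable_funeM.
  apply: le_integral_nonneg => x Dx.
    by rewrite mule_ge0 ?wg0// lee_fin mulr_ge0 ?powR_ge0 ?ltW.
  rewrite (muleC _ (w x)) muleCA -ge0_muleDr ?w0 ?poweR_ge0//; last first.
    by rewrite lee_fin mulr_ge0 ?powR_ge0 ?ltW.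
  apply: lee_wpmul2l; first exact: w0.
  have := g0 x Dx; case: (g x) => [r| |]//.
    by rewrite lee_fin => r0; rewrite /= -EFinD lee_fin young_tangent.
  by move=> _; rewrite poweRyr// addye// leey.
have Wfin : W \is a fin_num by rewrite ge0_fin_numE// ltey.
have Gfin : G \is a fin_num by rewrite ge0_fin_numE// ltey.
(* The tangent at l = 1 bounds s I by G + (s - 1) W. *)
have Ifin : I \is a fin_num.
  have := tangent 1%R ler01; rewrite !powR1 !mulr1.
  rewrite ge0_fin_numE//; case: (I) I0 => [r| |]// _; first by rewrite ltry.
  by rewrite gt0_muley ?lte_fin// -(fineK Wfin) -(fineK Gfin).
move: tangent; rewrite -(fineK Wfin) -(fineK Gfin) -(fineK Ifin).
clear ae0 In0 Wn0 Gn0 Ggt0 Wny Gny.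
have : (0 < fine W)%R by rewrite fine_gt0// Wgt0 ltey_eq Wfin.
have : (0 <= fine I)%R by rewrite fine_ge0.
move=> I0' W0' H; rewrite !poweR_EFin -EFinM lee_fin.
exact: tangent_powR.
Qed.


(** On the shell of radius r = e t^k the integrand is comparable to r^(-b) and the measure is at
    most A r^N, so the shells form a geometric series of ratio t^(N-b). The value t = 1/2 serves
    balls, t = 2 their complements. *)
Lemma integral_annuli (rho : T -> R) (A N b e t : R) (F : (set T)^nat) :
  measurable_fun setT rho -> (0 <= A)%R -> (0 < e)%R -> (0 < t)%R ->
  (forall r, (0 < r)%R -> mu [set y | (rho y <= r)%R] <= (A * r `^ N)%:E) ->
  (t `^ (N - b) < 1)%R ->
  (forall k, measurable (F k)) -> trivIset setT F ->
  (forall k y, F k y -> (e * t ^+ k / 2 <= rho y <= e * t ^+ k)%R) ->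
  \int[mu]_(y in \bigcup_k F k) npoweR (rho y)%:E b <=
  (2 `^ `|b| * A / (1 - t `^ (N - b)) * e `^ (N - b))%:E.
Proof.
move=> mrho A0 e0 t0 vol t1 mF tF Frho.
have mK D : measurable_fun D (fun y => npoweR (rho y)%:E b).
  by apply: measurable_fun_npoweR; apply/measurable_EFinP; exact: measurable_funTS.
rewrite ge0_integral_bigcup//; last by move=> x _; exact: npoweR_ge0.
set z := (t `^ (N - b))%R in t1 *.
set c := (2 `^ `|b| * A * e `^ (N - b))%R.
have c0 : (0 <= c)%R by rewrite !mulr_ge0 ?powR_ge0.
have z0 : (0 <= z)%R by exact: powR_ge0.
apply: (@le_trans _ _ (\sum_(k <oo) (geometric c z k)%:E)).
  apply: lee_nneseries => [k _ _|k _].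
    by apply: integral_ge0 => y _; exact: npoweR_ge0.
  set r := (e * t ^+ k)%R.
  have r0 : (0 < r)%R by rewrite mulr_gt0// exprn_gt0.
  apply: (@le_trans _ _ (\int[mu]_(y in F k) cst (2 `^ `|b| * r `^ (- b))%:E y)).
    apply: le_integral_nonneg => y Fy; first exact: npoweR_ge0.
    have /andP[ry yr] := Frho k y Fy.
    have y0 : (0 < rho y)%R by apply: lt_le_trans ry; rewrite divr_gt0.
    by rewrite npoweR_EFin// lee_fin powR_shell.
  rewrite integral_cst//.
  apply: (@le_trans _ _ ((2 `^ `|b| * r `^ (- b))%:E * (A * r `^ N)%:E)).
    apply: lee_wpmul2l; first by rewrite lee_fin mulr_ge0 ?powR_ge0.
    apply: le_trans (vol _ r0); apply: le_measure; rewrite ?inE//.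
      by have [] := measurable_levels r mrho.
    by move=> y /Frho /andP[].
  rewrite -EFinM lee_fin /= /c /z -powRX ?(ltW t0)//.
  rewrite [leRHS](_ : _ = 2 `^ `|b| * A * r `^ (N - b))%R; last first.
    by rewrite /r [in RHS]powRM ?exprn_ge0 ?ltW// mulrA.
  rewrite powRD ?(gt_eqF r0) ?implybT//.
  by rewrite le_eqVlt; apply/orP; left; apply/eqP; ring.
rewrite (_ : \sum_(k <oo) _ = (c / (1 - z))%:E).
  rewrite lee_fin /c le_eqVlt; apply/orP; left; apply/eqP; ring.
apply/cvg_lim => //; rewrite (_ : (fun _ => _) = EFin \o series (geometric c z)).
  by apply: cvg_EFin; [exact: nearW|apply: cvg_geometric_series; rewrite ger0_norm].
by apply/funext => k; rewrite /= sumEFin.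
Qed.

(* Dyadic shells give a geometric series of ratio 2^(-|N - b|). *)
Definition radialC (A N b : R) : R := (2 `^ `|b| * A / (1 - 2 `^ (- `|N - b|)))%R.

Lemma radialC_ge0 A N b : (0 <= A)%R -> (0 <= radialC A N b)%R.
Proof.
move=> A0; rewrite divr_ge0 ?mulr_ge0 ?powR_ge0// subr_ge0.
by rewrite -[leRHS](powRr0 2) ler_powR ?ler1n// oppr_le0.
Qed.

(** The volume bound is taken at small radii. The singular kernel is infinite on this set, and its
    being null lets shells of positive radius exhaust a ball. *)
Lemma measure_level0 (rho : T -> R) (A N : R) :
  measurable_fun setT rho -> (0 <= A)%R ->
  (forall r, (0 < r)%R -> mu [set y | (rho y <= r)%R] <= (A * r `^ N)%:E) ->
  (0 < N)%R -> mu [set y | (rho y <= 0)%R] = 0.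
Proof.
move=> mrho A0 vol N0.
apply/eqP; rewrite eq_le measure_ge0 andbT; apply/lee_addgt0Pr => e e0.
rewrite add0e.
(* Chosen so that (A + 1) q^N = e; the 1 covers A = 0. *)
pose q := ((e / (A + 1)) `^ N^-1)%R.
have A1 : (0 < A + 1)%R by rewrite ltr_wpDl.
have q0 : (0 < q)%R by apply: powR_gt0; exact: divr_gt0.
apply: (@le_trans _ _ (mu [set y | (rho y <= q)%R])).
  apply: le_measure; rewrite ?inE; [by have [] := measurable_levels 0%R mrho|
    by have [] := measurable_levels q mrho|].
  by move=> y /= /le_trans; apply; exact: ltW.
apply: le_trans (vol _ q0) _; rewrite lee_fin -powRrM mulVf ?gt_eqF//.
rewrite powRr1; last by rewrite divr_ge0// ltW.
rewrite mulrCA -[leRHS]mulr1 ler_wpM2l ?(ltW e0)// ler_pdivrMr// mul1r.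
by rewrite lerDl.
Qed.

Lemma integral_radial_near (rho : T -> R) (A N b r : R) :
  measurable_fun setT rho -> (forall y, 0 <= rho y)%R -> (0 <= A)%R -> (0 < r)%R ->
  (forall r, (0 < r)%R -> mu [set y | (rho y <= r)%R] <= (A * r `^ N)%:E) ->
  (0 < N)%R -> (b < N)%R ->
  \int[mu]_(y in [set y | (rho y <= r)%R]) npoweR (rho y)%:E b <=
  (radialC A N b * r `^ (N - b))%:E.
Proof.
move=> mrho rho0 A0 r0 vol N0 bN.
pose t : R := 2^-1%R.
have t0 : (0 < t)%R by rewrite invr_gt0.
have t1 : (t < 1)%R by rewrite invf_lt1// ltr1n.
pose F k := [set y | (r * t ^+ k.+1 < rho y <= r * t ^+ k)%R].
have tanti i j : (i <= j)%N -> (r * t ^+ j <= r * t ^+ i)%R.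
  by move=> ij; rewrite ler_pM2l// ler_wiXn2l ?ltW.
have mF k : measurable (F k).
  rewrite (_ : F k = [set y | (r * t ^+ k.+1 < rho y)%R] `&`
    [set y | (rho y <= r * t ^+ k)%R]); last first.
    by apply/seteqP; split=> y; rewrite /F/=; [move/andP|move=> [-> ->]].
  by apply: measurableI; [have [] := measurable_levels (r * t ^+ k.+1)%R mrho|
    have [] := measurable_levels (r * t ^+ k)%R mrho].
have tF : trivIset setT F.
  apply/trivIsetP; suff H i j : (i < j)%N -> F i `&` F j = set0.
    by move=> i j _ _; rewrite neq_ltn => /orP[|/H]//; [exact: H|rewrite setIC].
  move=> ij; apply/seteqP; split=> // y [/andP[a _] /andP[_ c]].
  by have := lt_le_trans a (le_trans c (tanti _ _ ij)); rewrite ltxx.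
have vol0 := measure_level0 mrho A0 vol N0.
have mD : measurable [set y | (rho y <= r)%R] by have [] := measurable_levels r mrho.
have mK D : measurable_fun D (fun y => npoweR (rho y)%:E b).
  by apply: measurable_fun_npoweR; apply/measurable_EFinP; exact: measurable_funTS.
rewrite (@ge0_negligible_integral _ _ _ _ _ [set y | (rho y <= 0)%R])//; last 2 first.
- by have [] := measurable_levels 0%R mrho.
- by move=> y _; exact: npoweR_ge0.
rewrite (_ : _ `\` _ = \bigcup_k F k); last first.
  apply/seteqP; split=> y /=.
    move=> [yr /negP]; rewrite -ltNge => y0.
    have : exists k, (r * t ^+ k < rho y)%R.
      have : geometric r t @ \oo --> 0%R.
        by apply: cvg_geometric; rewrite ger0_norm ?ltW.
      move=> /cvgrPdist_lt /(_ _ y0) [k _ /(_ k (leqnn k))] /=.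
      rewrite sub0r normrN ger0_norm ?mulr_ge0 ?exprn_ge0 ?ltW// => H.
      by exists k.
    (* The least index with r t^k < rho(y) is not 0, since rho(y) <= r; its predecessor is the
       number of the shell containing y. *)
    move=> /ex_minnP[[|k] rk kmin].
      by move: rk; rewrite expr0 mulr1 ltNge yr.
    exists k => //; rewrite /F/= rk/= leNgt; apply/negP => /kmin.
    by rewrite ltnn.
  move=> [k _ /andP[kr rk]]; split.
    by rewrite (le_trans rk)// -{2}(mulr1 r) -(expr0 t) tanti.
  by apply/negP; rewrite -ltNge (le_lt_trans _ kr)// mulr_ge0 ?exprn_ge0 ?ltW.
have tN : (t `^ (N - b) = 2 `^ (- `|N - b|))%R.
  by rewrite /t -powR_inv1// -powRrM mulN1r ger0_norm// subr_ge0 ltW.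
rewrite /radialC -tN; apply: (integral_annuli (F := F)) => //.
  rewrite tN powR_lt1 ?ltr1n//.
  by rewrite oppr_lt0 normr_gt0 subr_eq0 gt_eqF.
move=> k y /andP[/ltW + ->]; rewrite andbT; apply: le_trans.
by rewrite exprSr mulrA.
Qed.

Lemma integral_radial_far (rho : T -> R) (A N b r : R) :
  measurable_fun setT rho -> (0 <= A)%R -> (0 < r)%R ->
  (forall r, (0 < r)%R -> mu [set y | (rho y <= r)%R] <= (A * r `^ N)%:E) ->
  (N < b)%R ->
  \int[mu]_(y in [set y | (r <= rho y)%R]) npoweR (rho y)%:E b <=
  (radialC A N b * r `^ (N - b))%:E.
Proof.
move=> mrho A0 r0 vol bN.
pose t : R := 2%R.
have t0 : (0 < t)%R by [].
have t1 : (1 < t)%R by rewrite ltr1n.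
pose F k := [set y | (r * t ^+ k <= rho y < r * t ^+ k.+1)%R].
have tanti i j : (i <= j)%N -> (r * t ^+ i <= r * t ^+ j)%R.
  by move=> ij; rewrite ler_pM2l// ler_weXn2l ?ltW.
have mF k : measurable (F k).
  rewrite (_ : F k = [set y | (r * t ^+ k <= rho y)%R] `&`
    [set y | (rho y < r * t ^+ k.+1)%R]); last first.
    by apply/seteqP; split=> y; rewrite /F/=; [move/andP|move=> [-> ->]].
  by apply: measurableI; [have [] := measurable_levels (r * t ^+ k)%R mrho|
    have [] := measurable_levels (r * t ^+ k.+1)%R mrho].
have tF : trivIset setT F.
  apply/trivIsetP; suff H i j : (i < j)%N -> F i `&` F j = set0.
    by move=> i j _ _; rewrite neq_ltn => /orP[|/H]//; [exact: H|rewrite setIC].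
  move=> ij; apply/seteqP; split=> // y [/andP[_ a] /andP[c _]].
  by have := lt_le_trans a (le_trans (tanti _ _ ij) c); rewrite ltxx.
rewrite (_ : [set y | _] = \bigcup_k F k); last first.
  apply/seteqP; split=> y /=.
    move=> ry.
    have : exists k, (rho y < r * t ^+ k)%R.
      exists (Num.truncn (rho y / r)).+1.
      rewrite mulrC -ltr_pdivrMr// (lt_trans (truncnS_gt _))//.
      by rewrite /t -natrX ltr_nat ltn_expl.
    move=> /ex_minnP[[|k] rk kmin].
      by move: rk; rewrite expr0 mulr1 ltNge ry.
    exists k => //; rewrite /F/= rk/= andbT leNgt; apply/negP => /kmin.
    by rewrite ltnn.
  move=> [k _ /andP[rk _]].
  by rewrite (le_trans _ rk)// -{1}(mulr1 r) -(expr0 t) tanti.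
have tN : (t `^ (N - b) = 2 `^ (- `|N - b|))%R.
  by rewrite ler0_norm ?opprK// subr_le0 ltW.
have tN1 : (t `^ (N - b) < 1)%R.
  rewrite tN powR_lt1 ?ltr1n//.
  by rewrite oppr_lt0 normr_gt0 subr_eq0 lt_eqF.
(* The shells are indexed by their inner radius r 2^k, whereas [integral_annuli] expects the outer
   one, so it is applied with e = 2r; the resulting factor 2^(N-b) < 1 is dropped. *)
apply: (@le_trans _ _ (radialC A N b * (r * t) `^ (N - b))%:E).
  rewrite /radialC -tN; apply: (integral_annuli (F := F)) => //.
    exact: mulr_gt0.
  move=> k y /andP[kr /ltW rk].
  rewrite (_ : r * t * t ^+ k = r * t ^+ k.+1)%R; last by rewrite exprS; ring.
  by rewrite rk andbT exprSr mulrA mulfK// gt_eqF.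
rewrite lee_fin ler_wpM2l ?radialC_ge0// powRM ?(ltW r0) ?(ltW t0)//.
by rewrite ger_pMr ?powR_gt0// ltW.
Qed.

End integral_tools.

(** * Layer-cake formula *)

Section layer_cake.
Context d (T : measurableType d) (R : realType).
Variable mu : {sigma_finite_measure set T -> \bar R}.
Local Notation lambda := (@lebesgue_measure R).
Local Open Scope ereal_scope.

Lemma integral_if (d' : measure_display) (T' : measurableType d')
  (nu : {measure set T' -> \bar R}) (b : T' -> bool) (f : T' -> \bar R) :
  \int[nu]_x (if b x then f x else 0) = \int[nu]_(x in [set x | b x]) f x.
Proof.
rewrite [RHS]integral_mkcond; apply: eq_integral => x _.
rewrite patchE; case: ifPn => bx; first by rewrite mem_set.
by rewrite memNset//; exact/negP.
Qed.

Lemma integral_under_graph (W c : \bar R) : 0 <= W ->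
  \int[lambda]_t (if (0 < t)%R && (t%:E < W) then c else 0) = c * W.
Proof.
move=> W0; rewrite (integral_if lambda (fun t => (0 < t)%R && (t%:E < W)) (cst c)).
case: W W0 => [w| |]// w0.
  rewrite (_ : [set t | _] = `]0%R, w[%classic).
    rewrite integral_cst//; congr (_ * _).
    have := lebesgue_measure_itv `]0%R, w[; rewrite /= lte_fin => ->.
    case: ltP => [_|w1]; first by rewrite oppr0 adde0.
    by congr EFin; apply/eqP; rewrite eq_le w1 -lee_fin w0.
  by apply/seteqP; split=> t; rewrite /= in_itv/= lte_fin.
rewrite (_ : [set t | _] = `]0%R, +oo[%classic).
  rewrite integral_cst//; congr (_ * _).
  by have := @lebesgue_measure_itv R `]0%R, +oo[; rewrite /= ltry oppr0 adde0 => ->.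
by apply/seteqP; split=> t; rewrite /= in_itv/= ltry.
Qed.

(** Tonelli's theorem on the region under the graph of W. With it, a lower bound of the capacity by
    the measure of density m passes to capacitary integrals. *)
Lemma layer_cake (m W : T -> \bar R) : measurable_fun setT m ->
  measurable_fun setT W -> (forall x, 0 <= m x) -> (forall x, 0 <= W x) ->
  \int[mu]_x (m x * W x) =
  \int[lambda]_(t in `]0%R, +oo[) \int[mu]_(x in [set x | t%:E < W x]) m x.
Proof.
move=> mm mW m0 W0.
pose F (p : T * R) := if (0 < p.2)%R && (p.2%:E < W p.1) then m p.1 else 0.
have F0 p : 0 <= F p by rewrite /F; case: ifP.
have mF : measurable_fun setT F.
  apply: measurable_fun_ifT => //; last exact: measurable_comp_fst.
  apply: measurable_and.
    by apply: measurable_fun_ltr => //; exact: measurable_snd.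
  apply: measurable_fun_lte; last exact: measurable_comp_fst.
  by apply/measurable_EFinP; exact: measurable_snd.
transitivity (\int[mu]_x \int[lambda]_t F (x, t)).
  by apply: eq_integral => x _; rewrite /F/= integral_under_graph.
rewrite (fubini_tonelli (m1 := mu) (m2 := lambda) F)//.
rewrite [RHS]integral_mkcond; apply: eq_integral => t _.
rewrite patchE; case: ifPn => [|]; rewrite ?inE ?notin_setE /= in_itv/= andbT.
  move=> t0; rewrite /F /= t0 /=.
  exact: (integral_if mu (fun x => t%:E < W x) m).
move/negP/negbTE => t0; rewrite integral0_eq// => x _.
by rewrite /F/= t0.
Qed.
End layer_cake.

(** Supplies the maximal scales: that of a stopping cube, and that of the truncation used to
    estimate the potential of the averaged function. *)
Lemma int_max (P : int -> Prop) (j : int) (k : nat) :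
  P j -> (forall i, k%:Z <= i -> ~ P i) ->
  exists2 i, P i & forall i', i < i' -> ~ P i'.
Proof.
move=> Pj Pk.
suff H m i : k%:Z - i <= m%:Z -> P i -> exists2 i, P i & forall i', i < i' -> ~ P i'.
  by apply: (H `|k%:Z - j|%N _ _ Pj); lia.
elim: m i => [|m IH] i im hi; first by exfalso; apply: (Pk i) => //; lia.
have [[i' ii' hi']|ni] := pselect (exists2 i', i < i' & P i').
  by apply: (IH i') => //; lia.
by exists i => // i' ii' hi'; apply: ni; exists i'.
Qed.

(** * Potentials with truncated kernels *)

Section kernel.
Context d (T : measurableType d) (R : realType).
Variable mu : {sigma_finite_measure set T -> \bar R}.
Variables (rho : T -> T -> R) (A N g : R).
Hypothesis rho_ge0 : forall x y, 0 <= rho x y.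
Hypothesis rhoC : forall x y, rho x y = rho y x.
Hypothesis rho_tri : forall x y z, rho x z <= rho x y + rho y z.
Hypothesis mrho : measurable_fun setT (fun p : T * T => rho p.1 p.2).
Hypothesis A0 : 0 <= A.
Hypothesis vol : forall x r, 0 < r ->
  (mu [set y | (rho x y <= r)%R] <= (A * r `^ N)%:E)%E.
Hypothesis g0 : 0 < g.
Hypothesis gN : g < N.
Local Open Scope ereal_scope.

Definition kernel x y : \bar R := npoweR (rho x y)%:E g.

(** The kernel frozen below the scale r. It is finite, and moving x by a multiple of r changes it by
    a bounded factor. Around a fixed centre and with r = 1 it also serves as a weight, for which b
    may be negative. *)
Definition tkernel b r x y : R := (Num.max r (rho x y) `^ (- b))%R.

Definition potential (h : T -> \bar R) x := \int[mu]_y (kernel x y * h y).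

Definition tpotential r (h : T -> \bar R) x :=
  \int[mu]_y ((tkernel g r x y)%:E * h y).

Arguments tkernel (b r)%_ring_scope x y.
Arguments tpotential r%_ring_scope h x.

Lemma kernel_ge0 x y : 0 <= kernel x y. Proof. exact: npoweR_ge0. Qed.

Lemma kernelC x y : kernel x y = kernel y x.
Proof. by rewrite /kernel rhoC. Qed.

Lemma tkernel_ge0 b r x y : (0 <= tkernel b r x y)%R. Proof. exact: powR_ge0. Qed.

Lemma measurable_rho x : measurable_fun setT (rho x).
Proof. exact: (measurableT_comp mrho (pair1_measurable x)). Qed.

Lemma measurable_ball_rho x r : measurable [set y | (rho x y <= r)%R].
Proof. by have [] := measurable_levels r (measurable_rho x). Qed.

Lemma measurable_kernel2 : measurable_fun setT (fun p : T * T => kernel p.1 p.2).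
Proof. by apply: measurable_fun_npoweR; apply/measurable_EFinP. Qed.

Lemma measurable_kernel x D : measurable_fun D (kernel x).
Proof.
apply: measurable_funTS; apply: measurable_fun_npoweR.
by apply/measurable_EFinP; exact: measurable_rho.
Qed.

Lemma measurable_tkernel b r x D : measurable_fun D (tkernel b r x).
Proof.
apply: measurable_funTS; rewrite /tkernel.
apply: (measurableT_comp (measurable_powR _)).
by apply: measurable_maxr => //; exact: measurable_rho.
Qed.

Lemma measurable_tkernelE b r x D : measurable_fun D (fun y => (tkernel b r x y)%:E).
Proof. by apply/measurable_EFinP; exact: measurable_tkernel. Qed.

Lemma kernelE x y : (0 < rho x y)%R -> kernel x y = (rho x y `^ (- g))%:E.
Proof. exact: npoweR_EFin. Qed.

Lemma kernel_lower c a x y : (0 < c)%R -> (0 < a)%R -> (rho x y <= c * a)%R ->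
  (a `^ (- g))%:E <= (c `^ g)%:E * kernel x y.
Proof.
move=> c0 a0 xy.
have [r0|] := ltP 0%R (rho x y).
  by rewrite kernelE// -EFinM lee_fin powRN_cmp// ltW.
move=> r0; have -> : kernel x y = +oo.
  rewrite /kernel (_ : rho x y = 0%R) ?npoweR0 ?gt_eqF//.
  by apply/eqP; rewrite eq_le r0 rho_ge0.
by rewrite gt0_muley ?leey// lte_fin powR_gt0.
Qed.

Lemma max_gt0 r x y : (0 < r)%R -> (0 < Num.max r (rho x y))%R.
Proof. by move=> r0; rewrite lt_max r0. Qed.

Lemma tkernel_le_kernel r x y : (0 < r)%R -> (tkernel g r x y)%:E <= kernel x y.
Proof.
move=> r0; rewrite /tkernel.
have := @kernel_lower 1%R _ x y ltr01 (max_gt0 x y r0).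
by rewrite powR1 mul1e; apply; rewrite mul1r le_max lexx orbT.
Qed.

Lemma tkernel_far r x y : (r <= rho x y)%R -> tkernel g r x y = (rho x y `^ (- g))%R.
Proof. by move=> /max_idPr; rewrite /tkernel => ->. Qed.

Lemma measurable_kernelM h D x : measurable_fun setT h ->
  measurable_fun D (fun y => kernel x y * h y).
Proof.
move=> mh; apply: emeasurable_funM; first exact: measurable_kernel.
exact: measurable_funTS.
Qed.

Lemma measurable_tkernelM b r h D x : measurable_fun setT h ->
  measurable_fun D (fun y => (tkernel b r x y)%:E * h y).
Proof.
move=> mh; apply: emeasurable_funM; first exact: measurable_tkernelE.
exact: measurable_funTS.
Qed.

Lemma measurable_potential h : measurable_fun setT h -> (forall y, 0 <= h y) ->
  measurable_fun setT (potential h).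
Proof.
move=> mh h0.
apply: (measurable_fun_fubini_tonelli_F (m2 := mu) (fun p => kernel p.1 p.2 * h p.2)).
  apply: emeasurable_funM; first exact: measurable_kernel2.
  exact: (measurableT_comp mh measurable_snd).
by move=> p; rewrite mule_ge0 ?kernel_ge0.
Qed.

Lemma potential_ge0 h x : (forall y, 0 <= h y) -> 0 <= potential h x.
Proof. by move=> h0; apply: integral_ge0 => y _; rewrite mule_ge0 ?kernel_ge0. Qed.

Lemma tpotential_ge0 r h x : (forall y, 0 <= h y) -> 0 <= tpotential r h x.
Proof.
by move=> h0; apply: integral_ge0 => y _; rewrite mule_ge0 ?lee_fin ?tkernel_ge0.
Qed.

(** The common source of all comparisons of truncated potentials: doubling the scale, enlarging it,
    moving the point, changing both at once. *)
Lemma tpotential_cmp (c r r' : R) x z h :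
  measurable_fun setT h -> (forall y, 0 <= h y) -> (0 < c)%R -> (0 < r')%R ->
  (forall y, (Num.max r' (rho z y) <= c * Num.max r (rho x y))%R) ->
  tpotential r h x <= (c `^ g)%:E * tpotential r' h z.
Proof.
move=> mh h0 c0 r'0 H.
rewrite -ge0_integralZl_EFin ?powR_ge0//; last 2 first.
- by move=> y _; rewrite mule_ge0 ?lee_fin ?tkernel_ge0.
- exact: measurable_tkernelM.
apply: le_integral_nonneg => y _; first by rewrite mule_ge0 ?lee_fin ?tkernel_ge0.
rewrite muleA lee_wpmul2r// -EFinM lee_fin.
by apply: powRN_cmp => //; [exact: max_gt0|exact: ltW].
Qed.

Lemma tpotential_le r h x : (0 < r)%R -> (forall y, 0 <= h y) ->
  tpotential r h x <= potential h x.
Proof.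
move=> r0 h0; apply: le_integral_nonneg => y _.
  by rewrite mule_ge0 ?lee_fin ?tkernel_ge0.
by rewrite lee_wpmul2r// tkernel_le_kernel.
Qed.

Lemma tpotential_double r h x : (0 < r)%R ->
  measurable_fun setT h -> (forall y, 0 <= h y) ->
  tpotential r h x <= (2 `^ g)%:E * tpotential (2 * r)%R h x.
Proof.
move=> r0 mh h0; apply: tpotential_cmp => //; first by rewrite mulr_gt0.
move=> y; rewrite ge_max maxr_pMr// !le_max lexx /=.
by apply/orP; right; rewrite ler_peMl// ler1n.
Qed.

Lemma tpotential_near (c r : R) h x z : (0 < r)%R -> (0 <= c)%R ->
  measurable_fun setT h -> (forall y, 0 <= h y) -> (rho x z <= c * r)%R ->
  tpotential r h x <= ((c + 1) `^ g)%:E * tpotential r h z.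
Proof.
move=> r0 c0 mh h0 xz; have c1 : (0 < c + 1)%R by rewrite ltr_wpDl.
apply: tpotential_cmp => // y.
rewrite ge_max; apply/andP; split.
  rewrite -[leLHS]mul1r ler_pM ?(ltW r0)// ?lerDr// le_max lexx//.
rewrite (le_trans (rho_tri z x y))// mulrDl mul1r lerD//.
  by rewrite rhoC (le_trans xz)// ler_wpM2l// le_max lexx.
by rewrite le_max lexx orbT.
Qed.

Lemma tpotential_decr (r r' : R) h x : (0 < r)%R -> (r <= r')%R ->
  measurable_fun setT h -> (forall y, 0 <= h y) ->
  tpotential r' h x <= tpotential r h x.
Proof.
move=> r0 rr' mh h0; rewrite -[leRHS]mul1e (_ : 1 = (1 `^ g)%:E); last by rewrite powR1.
apply: tpotential_cmp => // y; rewrite mul1r.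
by rewrite ge_max !le_max rr' lexx orbT.
Qed.

Lemma tpotential_lty_all o r h x : (0 < r)%R ->
  measurable_fun setT h -> (forall y, 0 <= h y) ->
  tpotential 1 h o < +oo -> tpotential r h x < +oo.
Proof.
move=> r0 mh h0 fin.
(* With m = max(r, rho(x, y)) one has 1 <= m / r, and rho(o, y) <= rho(o, x) + rho(x, y) <= (rho(o,
   x) / r) m + m. *)
pose c := (r^-1 + rho o x / r + 1)%R.
have ro : (0 <= rho o x / r)%R by rewrite divr_ge0 ?rho_ge0// ltW.
have ri : (0 < r^-1)%R by rewrite invr_gt0.
have c0 : (0 < c)%R by rewrite /c; lra.
apply: (@le_lt_trans _ _ ((c `^ g)%:E * tpotential 1 h o)); last first.
  rewrite -(@fineK _ (tpotential 1 h o)) ?ltry//.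
  by rewrite ge0_fin_numE// tpotential_ge0.
apply: tpotential_cmp => // y.
have M : (r <= Num.max r (rho x y))%R by rewrite le_max lexx.
have M' : (rho x y <= Num.max r (rho x y))%R by rewrite le_max lexx orbT.
move: (Num.max r (rho x y)) M M' => m M M'.
have m0 : (0 < m)%R by exact: lt_le_trans M.
have E1 : (1 <= r^-1 * m)%R by rewrite mulrC ler_pdivlMr// mul1r.
have E2 : (rho o x <= rho o x / r * m)%R.
  by rewrite -mulrA ler_peMr.
have := rho_tri o x y => tri.
have E3 : (0 <= r^-1 * m)%R by rewrite mulr_ge0 // ltW.
have E4 : (0 <= rho o x / r * m)%R by rewrite mulr_ge0 // ltW.
rewrite /c !mulrDl mul1r ge_max; apply/andP; split; lra.
Qed.

(** Monotone convergence along the sets {rho(x, y) >= 2^(-k)}: on them the truncated kernel equals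
    the singular one, and they exhaust the space up to a null set. *)
Lemma potential_gt_tpotential h x c : measurable_fun setT h -> (forall y, 0 <= h y) ->
  c < potential h x -> exists k : nat, c < tpotential (2^-1 ^+ k)%R h x.
Proof.
move=> mh h0 ch; apply: contrapT => /forallNP H.
have t0 k : (0 < 2^-1 ^+ k :> R)%R by rewrite exprn_gt0// invr_gt0.
pose F k := [set y | (2^-1 ^+ k <= rho x y)%R].
have mF k : measurable (F k).
  by have [] := measurable_levels (2^-1 ^+ k)%R (measurable_rho x).
have ndF : nondecreasing_seq F.
  move=> i j ij; apply/subsetPset => y; apply: le_trans.
  by rewrite ler_wiXn2l ?invr_ge0// invf_le1 ?ler1n.
have := @ge0_nondecreasing_set_cvg_integral _ _ _ F (fun y => kernel x y * h y) mu
  ndF mF (fun i => @measurable_kernelM h (F i) x mh)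
  (fun i y _ => mule_ge0 (kernel_ge0 x y) (h0 y)).
have -> : \int[mu]_(y in \bigcup_i F i) (kernel x y * h y) = potential h x.
  rewrite /potential [RHS](@ge0_negligible_integral _ _ _ _ _ [set y | (rho x y <= 0)%R])//.
  - congr integral; apply/seteqP; split=> y /=.
      move=> [k _ ky]; split=> //; apply/negP; rewrite -ltNge.
      exact: lt_le_trans ky.
    move=> [_ /negP]; rewrite -ltNge => y0.
    have : geometric 1 2^-1 @ \oo --> (0%R : R).
      by apply: cvg_geometric; rewrite ger0_norm ?invr_ge0// invf_lt1 ?ltr1n.
    move=> /cvgrPdist_lt /(_ _ y0) [k _ /(_ k (leqnn k))] /=.
    rewrite sub0r normrN mul1r ger0_norm ?(ltW (t0 k))// => Hk.
    by exists k => //; exact: ltW.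
  - by apply: measurable_ball_rho.
  - exact: measurable_kernelM.
  - by move=> y _; rewrite mule_ge0 ?kernel_ge0.
  - exact: (measure_level0 (measurable_rho x) A0 (vol x) (lt_trans g0 gN)).
move=> cvgF; move: ch; rewrite ltNge => /negP; apply.
rewrite -(cvg_lim _ cvgF)//; apply: lime_le.
  by apply/cvg_ex; exists (potential h x).
apply: nearW => k; rewrite leNgt; apply/negP => ck; apply: (H k).
apply: lt_le_trans ck _.
apply: (@le_trans _ _ (\int[mu]_(y in F k) ((tkernel g (2^-1 ^+ k)%R x y)%:E * h y))).
  apply: le_integral_nonneg => y Fy; first by rewrite mule_ge0 ?kernel_ge0.
  by rewrite tkernel_far// -kernelE//; exact: lt_le_trans Fy.
apply: ge0_subset_integral => //; first exact: measurable_tkernelM.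
by move=> y _; rewrite mule_ge0 ?lee_fin ?tkernel_ge0.
Qed.

(** Dominated convergence with the integrand at scale 1 as majorant. Its integrability also makes h
    finite almost everywhere, hence the integrand tend to 0 pointwise. *)
Lemma tpotential_cvg0 h x e : measurable_fun setT h -> (forall y, 0 <= h y) ->
  tpotential 1 h x < +oo -> 0 < e -> exists k : nat, tpotential (2 ^+ k)%R h x < e.
Proof.
move=> mh h0 fin e0.
have p2 k : (1 <= 2 ^+ k :> R)%R by rewrite exprn_ege1// ler1n.
have p0 k : (0 < 2 ^+ k :> R)%R by exact: lt_le_trans (p2 k).
have int : mu.-integrable setT (fun y => (tkernel g 1 x y)%:E * h y).
  apply/integrableP; split; first exact: measurable_tkernelM.
  under eq_integral do rewrite gee0_abs ?mule_ge0 ?lee_fin ?tkernel_ge0//.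
  exact: fin.
have hfin : {ae mu, forall y, setT y -> h y \is a fin_num}.
  apply: filterS (integrable_ae measurableT int) => y H _; have := H I.
  have := h0 y; case: (h y) => [//| |//] _.
  by rewrite gt0_muley// lte_fin powR_gt0// max_gt0.
have tk_le k y : (tkernel g (2 ^+ k)%R x y <= (2 `^ (- g)) ^+ k)%R.
  rewrite -powRX//; apply: powRN_le; [exact: p0| |exact: ltW].
  by rewrite le_max lexx.
have z1 : (2 `^ (- g) < 1 :> R)%R.
  by rewrite powR_lt1 ?ltr1n// oppr_lt0.
have mc : measurable_fun setT (cst 0 : T -> \bar R) by exact: measurable_cst.
have [||_ _ cv] := @dominated_convergence _ _ _ mu setT measurableT
  (fun k y => (tkernel g (2 ^+ k)%R x y)%:E * h y) (cst 0)
  (fun y => (tkernel g 1 x y)%:E * h y)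
  (fun k => @measurable_tkernelM g (2 ^+ k)%R h setT x mh) mc _ int _.
- apply: filterS hfin => y /(_ I) fy _.
  have := h0 y; rewrite -(fineK fy) lee_fin => fy0.
  apply: (@squeeze_cvge _ _ _ _ (cst 0) _
    (EFin \o geometric (fine (h y)) (2 `^ (- g))%R)).
  + apply: nearW => k; rewrite /= mule_ge0 ?lee_fin ?tkernel_ge0//=.
    by rewrite mulrC ler_wpM2l.
  + exact: cvg_cst.
  + apply: cvg_EFin; first exact: nearW.
    by apply: cvg_geometric; rewrite ger0_norm ?powR_ge0.
- apply: nearW => y k _.
  rewrite gee0_abs ?mule_ge0 ?lee_fin ?tkernel_ge0// lee_wpmul2r// lee_fin.
  apply: powRN_le; [exact: max_gt0| |exact: ltW].
  by rewrite ge_max !le_max p2 lexx orbT.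
move: cv; rewrite integral0 => /(_ _ (open_ereal_lt' e0))[k _ /(_ k (leqnn k)) Hk].
by exists k.
Qed.

Lemma integral_cover2 (D1 D2 : set T) (f : T -> \bar R) :
  measurable D1 -> measurable D2 -> (forall y, D1 y \/ D2 y) ->
  measurable_fun setT f -> (forall y, 0 <= f y) ->
  \int[mu]_y f y <= \int[mu]_(y in D1) f y + \int[mu]_(y in D2) f y.
Proof.
move=> mD1 mD2 D12 mf f0; rewrite -(setUv D1) ge0_integral_setU//.
- apply: leeD => //; apply: ge0_subset_integral => //.
  + exact: measurableC.
  + exact: measurable_funTS.
  + by move=> y; have [] := D12 y.
- exact: measurableC.
- by rewrite setUv.
- by apply/disj_setPS; rewrite setICr.
Qed.

Lemma tkernel_le1 b x y : (0 <= b)%R -> (tkernel b 1 x y <= 1)%R.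
Proof.
move=> b0; rewrite -[leRHS](powRr0 (Num.max 1%R (rho x y))) ler_powR ?oppr_le0//.
by rewrite le_max lexx.
Qed.

Lemma tkernelM a b r x y : (0 < r)%R ->
  (tkernel a r x y * tkernel b r x y = tkernel (a + b) r x y)%R.
Proof.
move=> r0; rewrite /tkernel opprD powRD//.
by apply/implyP => _; rewrite gt_eqF// max_gt0.
Qed.

Lemma tkernel0 r x y : tkernel 0 r x y = 1%R.
Proof. by rewrite /tkernel oppr0 powRr0. Qed.

Lemma tkernel_powR a b r x y : (tkernel a r x y `^ b = tkernel (a * b) r x y)%R.
Proof. by rewrite /tkernel -powRrM mulNr. Qed.

Definition tkernel_const b : R := (A + radialC A N b)%R.

Lemma tkernel_const_ge0 b : (0 <= tkernel_const b)%R.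
Proof. by rewrite addr_ge0 ?radialC_ge0. Qed.

Lemma integral_tkernel b x : (N < b)%R ->
  \int[mu]_y (tkernel b 1 x y)%:E <= (tkernel_const b)%:E.
Proof.
move=> Nb; have b0 : (0 < b)%R := lt_trans (lt_trans g0 gN) Nb.
have mD2 : measurable [set y | (1 <= rho x y)%R].
  by have [] := measurable_levels 1%R (measurable_rho x).
have cov := @integral_cover2 _ _ (fun y => (tkernel b 1 x y)%:E)
  (measurable_ball_rho x 1%R) mD2.
apply: (le_trans (cov _ _ _)) => {cov}.
- move=> y /=; have [/ltW|] := ltP (rho x y) 1%R; [by left|by right].
- exact: measurable_tkernelE.
- by move=> y; rewrite lee_fin tkernel_ge0.
rewrite EFinD; apply: leeD.
  apply: (@le_trans _ _ (\int[mu]_(y in [set y | (rho x y <= 1)%R]) cst 1 y)).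
    apply: le_integral_nonneg => y _; rewrite lee_fin ?tkernel_ge0//.
    by rewrite tkernel_le1// ltW.
  rewrite integral_cst ?mul1e; last exact: measurable_ball_rho.
  by apply: le_trans (vol _ ltr01) _; rewrite powR1 mulr1.
have := @integral_radial_far _ _ _ mu (rho x) A N b 1%R (measurable_rho x) A0 ltr01
  (vol x) Nb; rewrite powR1 mulr1; apply: le_trans.
apply: le_integral_nonneg => y /= y1; first by rewrite lee_fin tkernel_ge0.
rewrite npoweR_EFin; last exact: lt_le_trans y1.
by rewrite /tkernel; move/max_idPr : y1 => ->.
Qed.

(** * Local integrability of h *)

Section global_estimate.
Variables (o : T) (s : R).
Hypothesis s1 : (1 < s)%R.
Hypothesis Ns : (N * (s - 1) < g * s)%R.

(** The exponent making b (s - 1) = g, so that the powers of the distance cancel in the Schur test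
    and in Hölder's inequality. The hypothesis [Ns] says exactly that g + b > N. *)
Let b := (g / (s - 1))%R.
Let s10 : (0 < s - 1)%R. Proof. by rewrite subr_gt0. Qed.
Let b0 : (0 < b)%R. Proof. by rewrite divr_gt0. Qed.
Let bE : (b * (s - 1) = g)%R. Proof. by rewrite /b divfK// gt_eqF. Qed.
Let Ngb : (N < g + b)%R.
Proof.
rewrite -(ltr_pM2r s10) mulrDl bE; apply: (lt_le_trans Ns).
by rewrite mulrBr mulr1 subrK.
Qed.

Let M := (radialC A N g + 2 * tkernel_const (g + b))%R.
Let M0 : (0 <= M)%R.
Proof. by rewrite addr_ge0 ?radialC_ge0// mulr_ge0// tkernel_const_ge0. Qed.

(** Both truncated distances are replaced by the smaller of the two, which yields the full exponent
    g + b at x or at o. *)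
Lemma kernel_tkernel_le x y : (1 <= rho x y)%R ->
  kernel x y * (tkernel b 1 o y)%:E <=
  (tkernel (g + b) 1 x y)%:E + (tkernel (g + b) 1 o y)%:E.
Proof.
move=> xy; rewrite kernelE ?(lt_le_trans _ xy)// -(tkernel_far xy).
rewrite -EFinM -EFinD lee_fin -(tkernelM g b x y)// -(tkernelM g b o y)//.
have [H|/ltW H] := leP (Num.max 1%R (rho x y))%R (Num.max 1%R (rho o y))%R.
  rewrite -[leLHS]addr0 lerD ?mulr_ge0 ?tkernel_ge0//.
  by rewrite ler_wpM2l ?tkernel_ge0// powRN_le ?(ltW b0)// max_gt0.
rewrite -[leLHS]add0r lerD ?mulr_ge0 ?tkernel_ge0//.
by rewrite ler_wpM2r ?tkernel_ge0// powRN_le ?(ltW g0)// max_gt0.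
Qed.

Lemma integral_kernel_tkernel x :
  \int[mu]_y (kernel x y * (tkernel b 1 o y)%:E) <= M%:E.
Proof.
have mf D : measurable_fun D (fun y => kernel x y * (tkernel b 1 o y)%:E).
  apply: emeasurable_funM; first exact: measurable_kernel.
  exact: measurable_tkernelE.
have f0 y : 0 <= kernel x y * (tkernel b 1 o y)%:E.
  by rewrite mule_ge0 ?kernel_ge0 ?lee_fin ?tkernel_ge0.
have mD2 : measurable [set y | (1 <= rho x y)%R].
  by have [] := measurable_levels 1%R (measurable_rho x).
have cov := @integral_cover2 _ _ (fun y => kernel x y * (tkernel b 1 o y)%:E)
  (measurable_ball_rho x 1%R) mD2.
apply: (le_trans (cov _ (mf setT) f0)) => {cov}.
  move=> y /=; have [/ltW|] := ltP (rho x y) 1%R; [by left|by right].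
rewrite /M EFinD; apply: leeD.
  have := @integral_radial_near _ _ _ mu (rho x) A N g 1%R (measurable_rho x)
   (rho_ge0 x) A0 ltr01 (vol x) (lt_trans g0 gN) gN; rewrite powR1 mulr1; apply: le_trans.
  apply: le_integral_nonneg => y _ //.
  rewrite -[leRHS]mule1 lee_wpmul2l ?kernel_ge0// lee_fin tkernel_le1//.
  exact: ltW.
apply: (@le_trans _ _ (\int[mu]_y ((tkernel (g + b) 1 x y)%:E +
   (tkernel (g + b) 1 o y)%:E))).
  apply: (@le_trans _ _ (\int[mu]_(y in [set y | (1 <= rho x y)%R])
      ((tkernel (g + b) 1 x y)%:E + (tkernel (g + b) 1 o y)%:E))).
    by apply: le_integral_nonneg => y y1 //; exact: kernel_tkernel_le.
  apply: ge0_subset_integral => //.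
    by apply: emeasurable_funD; exact: measurable_tkernelE.
  by move=> y _; rewrite adde_ge0 ?lee_fin ?tkernel_ge0.
rewrite ge0_integralD//; first last.
- exact: measurable_tkernelE.
- by move=> y _; rewrite lee_fin tkernel_ge0.
- exact: measurable_tkernelE.
- by move=> y _; rewrite lee_fin tkernel_ge0.
by rewrite (_ : 2 = 1 + 1)%R// mulrDl mul1r EFinD leeD ?integral_tkernel.
Qed.

(** By the triangle inequality, the larger of rho(x, y) and max(1, rho(o, x)) is at least half of
    max(1, rho(o, y)). The factor belonging to it is bounded by the kernel at y, the other one by
    the sum on the right. *)
Lemma quasimetric_kernel x y :
  kernel x y * (tkernel g 1 o x)%:E <=
  (2 `^ g * tkernel g 1 o y)%:E * (kernel x y + (tkernel g 1 o x)%:E).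
Proof.
set a := Num.max 1%R (rho o x); set c := Num.max 1%R (rho o y).
have a0 : (0 < a)%R by exact: max_gt0.
have c0 : (0 < c)%R by exact: max_gt0.
have cle : (c <= a + rho x y)%R.
  rewrite /c ge_max; apply/andP; split.
    by rewrite (@le_trans _ _ a)// ?lerDl// le_max lexx.
  by rewrite (le_trans (rho_tri o x y))// lerD2r le_max lexx orbT.
have [H|/ltW H] := leP (rho x y) a.
  have : (tkernel g 1 o x <= 2 `^ g * tkernel g 1 o y)%R.
    by apply: (@powRN_cmp _ 2%R c a g) => //; [exact: ltW|lra].
  move=> H1; rewrite muleC (@le_trans _ _ ((2 `^ g * tkernel g 1 o y)%:E * kernel x y))//.
    by rewrite lee_wpmul2r ?kernel_ge0.
  rewrite lee_wpmul2l ?lee_fin ?mulr_ge0 ?powR_ge0//.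
  by rewrite leeDl// lee_fin tkernel_ge0.
have r0 : (0 < rho x y)%R by exact: lt_le_trans H.
rewrite kernelE//.
have H1 : (rho x y `^ (- g) <= 2 `^ g * tkernel g 1 o y)%R.
  by apply: (@powRN_cmp _ 2%R c (rho x y) g) => //; [exact: ltW|lra].
rewrite -EFinD -!EFinM lee_fin ler_pM ?powR_ge0 ?tkernel_ge0//.
by rewrite lerDr powR_ge0.
Qed.

Let Cm := (2 `^ g * (M + tkernel_const (g + b)))%R.

(** The dual condition of the Schur test. The decay of order g in y is needed to cancel the growth
    of order b (s - 1) = g that Jensen's inequality leaves on f^s. *)
Lemma integral_kernel_dual y :
  \int[mu]_x (kernel x y * (tkernel (g + b) 1 o x)%:E) <=
  (Cm * tkernel g 1 o y)%:E.
Proof.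
have c0 : (0 <= 2 `^ g * tkernel g 1 o y)%R by rewrite mulr_ge0 ?powR_ge0.
apply: (@le_trans _ _ (\int[mu]_x ((2 `^ g * tkernel g 1 o y)%:E *
   (kernel y x * (tkernel b 1 o x)%:E + (tkernel (g + b) 1 o x)%:E)))).
  apply: le_integral_nonneg => x _.
    by rewrite mule_ge0 ?kernel_ge0 ?lee_fin ?tkernel_ge0.
  rewrite -(tkernelM g b o x)// EFinM muleA.
  apply: (le_trans (lee_wpmul2r _ (quasimetric_kernel x y))).
    by rewrite lee_fin tkernel_ge0.
  rewrite -muleA lee_wpmul2l ?lee_fin// ge0_muleDl ?kernel_ge0 ?lee_fin ?tkernel_ge0//.
  by rewrite kernelC.
have mK : measurable_fun setT (fun x => kernel y x * (tkernel b 1 o x)%:E).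
  apply: emeasurable_funM; first exact: measurable_kernel.
  exact: measurable_tkernelE.
have K0 x : 0 <= kernel y x * (tkernel b 1 o x)%:E.
  by rewrite mule_ge0 ?kernel_ge0 ?lee_fin ?tkernel_ge0.
rewrite ge0_integralZl_EFin//; last 2 first.
- by move=> x _; rewrite adde_ge0 ?lee_fin ?tkernel_ge0.
- by apply: emeasurable_funD => //; exact: measurable_tkernelE.
rewrite /Cm mulrAC [leRHS]EFinM; apply: lee_wpmul2l; first by rewrite lee_fin.
rewrite ge0_integralD//; first last.
- exact: measurable_tkernelE.
- by move=> x _; rewrite lee_fin tkernel_ge0.
by rewrite EFinD leeD ?integral_kernel_tkernel ?integral_tkernel.
Qed.

Let C4 := (M `^ (s - 1) * Cm)%R.

(* Schur's test with the weight [tkernel b 1 o]. *)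
Lemma potential_strong_type (f : T -> \bar R) :
  measurable_fun setT f -> (forall y, 0 <= f y) ->
  \int[mu]_x ((tkernel (g + b) 1 o x)%:E * potential f x `^ s) <=
  C4%:E * \int[mu]_y (f y `^ s).
Proof.
move=> mf f0.
have mfs D : measurable_fun D (fun y => f y `^ s).
  by apply: measurable_funTS; exact: measurable_fun_poweR.
have pw x : potential f x `^ s <= (M `^ (s - 1))%:E *
   \int[mu]_y (kernel x y * ((tkernel (- g) 1 o y)%:E * f y `^ s)).
  rewrite /potential.
  have mw : measurable_fun setT (fun y => kernel x y * (tkernel b 1 o y)%:E).
    apply: emeasurable_funM; first exact: measurable_kernel.
    exact: measurable_tkernelE.
  have w0 y : 0 <= kernel x y * (tkernel b 1 o y)%:E.
    by rewrite mule_ge0 ?kernel_ge0 ?lee_fin ?tkernel_ge0.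
  have mg : measurable_fun setT (fun y => (tkernel (- b) 1 o y)%:E * f y).
    exact: measurable_tkernelM.
  have g'0 y : 0 <= (tkernel (- b) 1 o y)%:E * f y.
    by rewrite mule_ge0 ?lee_fin ?tkernel_ge0.
  have := jensen_powR mu s1 measurableT mw mg (fun y _ => w0 y) (fun y _ => g'0 y).
  under eq_integral => y _.
    rewrite -muleA (muleA (tkernel b 1 o y)%:E) -EFinM tkernelM// subrr tkernel0 mul1e.
    over.
  move=> /le_trans; apply.
  under [X in _ * X <= _]eq_integral => y _.
    rewrite poweRM ?lee_fin ?tkernel_ge0// poweR_EFin tkernel_powR.
    rewrite -muleA (muleA (tkernel b 1 o y)%:E) -EFinM tkernelM//.
    rewrite (_ : b + - b * s = - g)%R; last by rewrite -bE; ring.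
    over.
  apply: lee_wpmul2r.
    apply: integral_ge0 => y _; rewrite mule_ge0 ?kernel_ge0// mule_ge0 ?poweR_ge0//.
    by rewrite lee_fin tkernel_ge0.
  rewrite -poweR_EFin; apply: gt0_ler_poweR; first exact: ltW.
  - by rewrite in_itv/= leey andbT integral_ge0.
  - by rewrite in_itv/= leey andbT lee_fin.
  - exact: integral_kernel_tkernel.
pose F (p : T * T) := (tkernel (g + b) 1 o p.1)%:E *
  (kernel p.1 p.2 * ((tkernel (- g) 1 o p.2)%:E * f p.2 `^ s)).
have F0 p : 0 <= F p.
  rewrite mule_ge0 ?lee_fin ?tkernel_ge0// mule_ge0 ?kernel_ge0// mule_ge0 ?poweR_ge0//.
  by rewrite lee_fin tkernel_ge0.
have mF : measurable_fun setT F.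
  apply: emeasurable_funM.
    apply: (@measurable_comp_fst _ _ _ _ _ _ (fun x => (tkernel (g + b) 1 o x)%:E)).
    exact: measurable_tkernelE.
  apply: emeasurable_funM; first exact: measurable_kernel2.
  apply: (@measurable_comp_snd _ _ _ _ _ _
    (fun y => (tkernel (- g) 1 o y)%:E * f y `^ s)).
  by apply: emeasurable_funM => //; exact: measurable_tkernelE.
apply: (@le_trans _ _ ((M `^ (s - 1))%:E * \int[mu]_x \int[mu]_y F (x, y))).
  rewrite -ge0_integralZl_EFin ?powR_ge0//; last 2 first.
  - by move=> x _; exact: integral_ge0.
  - exact: (measurable_fun_fubini_tonelli_F (m2 := mu) F).
  apply: le_integral_nonneg => x _.
    by rewrite mule_ge0 ?lee_fin ?tkernel_ge0// poweR_ge0.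
  rewrite /F /= ge0_integralZl_EFin ?tkernel_ge0//; last 2 first.
  - move=> y _; rewrite mule_ge0 ?kernel_ge0// mule_ge0 ?poweR_ge0//.
    by rewrite lee_fin tkernel_ge0.
  - apply: emeasurable_funM; first exact: measurable_kernel.
    by apply: emeasurable_funM => //; exact: measurable_tkernelE.
  by rewrite muleCA lee_wpmul2l ?lee_fin ?tkernel_ge0.
rewrite /C4 EFinM -muleA lee_wpmul2l ?lee_fin ?powR_ge0//.
rewrite fubini_tonelli// -ge0_integralZl_EFin//; last 2 first.
- by move=> y _; exact: poweR_ge0.
- by rewrite mulr_ge0 ?powR_ge0// addr_ge0// tkernel_const_ge0.
apply: le_integral_nonneg => y _; first exact: integral_ge0.
rewrite /F /=.
under eq_integral => x _ do rewrite muleA (muleC _ (kernel x y)).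
rewrite ge0_integralZr//; last 3 first.
- apply: emeasurable_funM; last exact: measurable_tkernelE.
  by under eq_fun do rewrite kernelC; exact: measurable_kernel.
- by move=> x _; rewrite mule_ge0 ?kernel_ge0 ?lee_fin ?tkernel_ge0.
- by rewrite mule_ge0 ?poweR_ge0// lee_fin tkernel_ge0.
apply: (le_trans (lee_wpmul2r _ (integral_kernel_dual y))).
  by rewrite mule_ge0 ?poweR_ge0// lee_fin tkernel_ge0.
by rewrite EFinM -muleA (muleA (tkernel g 1 o y)%:E) -EFinM tkernelM// subrr tkernel0 mul1e.
Qed.

(** Chebyshev's inequality; taking the infimum over f will bound the capacity of E from below by a
    measure. *)
Lemma potential_weak_type (f : T -> \bar R) (E : set T) :
  measurable_fun setT f -> (forall y, 0 <= f y) -> measurable E ->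
  (forall x, E x -> 1 <= potential f x) ->
  \int[mu]_(x in E) (tkernel (g + b) 1 o x)%:E <= C4%:E * \int[mu]_y (f y `^ s).
Proof.
move=> mf f0 mE Ef; apply: le_trans (potential_strong_type mf f0).
have mF : measurable_fun setT
    (fun x => (tkernel (g + b) 1 o x)%:E * potential f x `^ s).
  apply: emeasurable_funM; first exact: measurable_tkernelE.
  by apply: measurable_fun_poweR; exact: measurable_potential.
apply: (@le_trans _ _ (\int[mu]_(x in E)
    ((tkernel (g + b) 1 o x)%:E * potential f x `^ s))).
  apply: le_integral_nonneg => x Ex; first by rewrite lee_fin tkernel_ge0.
  rewrite -[leLHS]mule1 lee_wpmul2l ?lee_fin ?tkernel_ge0//.
  rewrite -(poweR1r s); apply: gt0_ler_poweR; rewrite ?in_itv/= ?leey ?andbT//.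
  - exact: ltW (lt_trans ltr01 s1).
  - exact: potential_ge0.
  - exact: Ef.
apply: ge0_subset_integral => //.
by move=> x _; rewrite mule_ge0 ?lee_fin ?tkernel_ge0// poweR_ge0.
Qed.

Lemma tpotential_lty (q : R) (w h : T -> \bar R) :
  (1 <= q)%R -> (q < s)%R ->
  measurable_fun setT h -> (forall y, 0 <= h y) ->
  measurable_fun setT w -> {ae mu, forall y, 0 <= w y} ->
  \int[mu]_x ((tkernel (g + b) 1 o x)%:E * `|w x| `^ q) < +oo ->
  \int[mu]_(x in [set x | h x != 0]) (h x `^ s * npoweR (w x) (s - q)) < +oo ->
  tpotential 1 h o < +oo.
Proof.
move=> q1 qs mh h0 mw w0 wfin Hfin.
have sq0 : (0 < s - q)%R by rewrite subr_gt0.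
have q0 : (0 < q)%R by exact: lt_le_trans q1.
have s0 : (0 < s)%R by exact: lt_trans s1.
(* Fixed by th (s - 1) = s - q. Since th <= 1 <= q, w^th <= 1 + w^q, which is integrable against the
   density m. *)
pose th := ((s - q) / (s - 1))%R.
have th0 : (0 < th)%R by rewrite divr_gt0.
have thq : (th <= q)%R.
  by rewrite (le_trans _ q1)// ler_pdivrMr// mul1r lerD2l lerN2.
pose m x := tkernel (g + b) 1 o x.
have mm D : measurable_fun D (fun x => (m x)%:E) by exact: measurable_tkernelE.
have m0 x : (0 < m x)%R by rewrite powR_gt0// max_gt0.
have mD1 : measurable [set x | h x != 0].
  by have := emeasurable_neq measurableT mh 0; rewrite setTI.
have mwq : measurable_fun setT (fun x => (m x)%:E * `|w x| `^ q).
  apply: emeasurable_funM => //; apply: measurable_fun_poweR.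
  exact: measurableT_comp.
have mwq0 x : 0 <= (m x)%:E * `|w x| `^ q.
  by rewrite mule_ge0 ?lee_fin ?(ltW (m0 x))// poweR_ge0.
have mH D : measurable_fun D (fun x => h x `^ s * npoweR (w x) (s - q)).
  apply: measurable_funTS; apply: emeasurable_funM; first exact: measurable_fun_poweR.
  exact: measurable_fun_npoweR.
have H0 x : 0 <= h x `^ s * npoweR (w x) (s - q).
  by rewrite mule_ge0 ?poweR_ge0 ?npoweR_ge0.
have aew : {ae mu, forall x, w x < +oo}.
  have int : mu.-integrable setT (fun x => (m x)%:E * `|w x| `^ q).
    apply/integrableP; split=> //; under eq_integral do rewrite gee0_abs//.
    exact: wfin.
  apply: filterS (integrable_ae measurableT int) => x H; have := H I.
  case: (w x) => [r _| |]//; first by rewrite ltry.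
  by rewrite poweRyr ?gt_eqF// gt0_muley ?lte_fin.
have aeh : {ae mu, forall x, h x != 0 -> 0 < w x}.
  have int : mu.-integrable [set x | h x != 0]
      (fun x => h x `^ s * npoweR (w x) (s - q)).
    apply/integrableP; split=> //; under eq_integral do rewrite gee0_abs//.
    exact: Hfin.
  apply: filterS2 w0 (integrable_ae mD1 int) => x wx0 H hx.
  rewrite lt0e wx0 andbT; apply/eqP => wx; have := H hx.
  by rewrite wx npoweR0 ?gt_eqF// gt0_muley// poweR_gt0// lt0e hx h0.
(* Outside [D] the function h vanishes almost everywhere: w is finite almost everywhere, and w = 0
   with h > 0 would make the integrand of [Hfin] infinite. *)
pose D := [set x | 0 < w x /\ w x < +oo].
have mD : measurable D.
  rewrite (_ : D = (setT `&` [set x | 0 < w x]) `&` (setT `&` [set x | w x < +oo])).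
    apply: measurableI; first exact: emeasurable_fun_o_infty.
    exact: emeasurable_fun_infty_o.
  by rewrite !setTI.
have tE : tpotential 1 h o = \int[mu]_(y in D) ((tkernel g 1 o y)%:E * h y).
  rewrite [RHS]integral_mkcond; apply: ge0_ae_eq_integral => //.
  - exact: measurable_tkernelM.
  - by apply/(measurable_restrictT _ mD).1; exact: measurable_tkernelM.
  - by move=> y _; rewrite mule_ge0 ?lee_fin ?tkernel_ge0.
  - move=> y _; apply: erestrict_ge0 => {}y _.
    by rewrite mule_ge0 ?lee_fin ?tkernel_ge0.
  - apply: filterS2 aew aeh => y wy hy _; rewrite patchE.
    case: ifPn => //; rewrite notin_setE /D /= => nD.
    have [->|hn0] := eqVneq (h y) 0; first by rewrite mule0.
    by exfalso; apply: nD; split=> //; exact: hy.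
(* Weight and function for Jensen's inequality: on [D], om G is the integrand of the truncated
   potential and om G^s = h^s w^(q-s), the powers of the distance cancelling by b (s - 1) = g. *)
pose om x := (m x)%:E * w x `^ th.
pose G x := (tkernel (g - (g + b)) 1 o x)%:E * (h x * npoweR (w x) th).
have mom : measurable_fun D om.
  by apply: measurable_funTS; apply: emeasurable_funM => //; exact: measurable_fun_poweR.
have mG : measurable_fun D G.
  apply: measurable_funTS; apply: emeasurable_funM; first exact: measurable_tkernelE.
  by apply: emeasurable_funM => //; exact: measurable_fun_npoweR.
have om0 x : 0 <= om x by rewrite mule_ge0 ?lee_fin ?(ltW (m0 x))// poweR_ge0.
have G0 x : 0 <= G x.
  by rewrite mule_ge0 ?lee_fin ?tkernel_ge0// mule_ge0 ?npoweR_ge0.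
have omG x : D x -> om x * G x = (tkernel g 1 o x)%:E * h x.
  move=> [wx0 wxy]; rewrite /om /G /m.
  have := wx0; have := wxy; case: (w x) => [r _|//|//]; rewrite lte_fin => r0.
  rewrite npoweR_EFin// poweR_EFin (muleC (h x)) !muleA -!EFinM; congr (_%:E * _).
  rewrite [LHS](_ : _ = (tkernel (g + b) 1 o x * tkernel (g - (g + b)) 1 o x) *
    (r `^ th * r `^ (- th)))%R; last by ring.
  rewrite tkernelM// -powRD ?subrr ?powRr0 ?mulr1; last first.
    by apply/implyP => _; rewrite gt_eqF.
  by congr tkernel; ring.
have omGs x : D x -> om x * G x `^ s = h x `^ s * npoweR (w x) (s - q).
  move=> [wx0 wxy]; rewrite /om /G /m.
  have := wx0; have := wxy; case: (w x) => [r _|//|//]; rewrite lte_fin => r0.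
  rewrite !npoweR_EFin// poweRM ?lee_fin ?tkernel_ge0//; last first.
    by rewrite mule_ge0// lee_fin powR_ge0.
  rewrite poweRM ?lee_fin ?powR_ge0// !poweR_EFin tkernel_powR.
  rewrite (muleC (h x `^ s)) (muleC (h x `^ s)) !muleA -!EFinM; congr (_%:E * _).
  rewrite -powRrM.
  rewrite [LHS](_ : _ = (tkernel (g + b) 1 o x * tkernel ((g - (g + b)) * s) 1 o x) *
    (r `^ th * r `^ (- th * s)))%R; last by ring.
  rewrite tkernelM// -powRD; last by apply/implyP => _; rewrite gt_eqF.
  rewrite (_ : g + b + _ = 0)%R; last by rewrite -bE; ring.
  rewrite tkernel0 mul1r; congr (_ `^ _)%R; rewrite /th; field.
  by rewrite gt_eqF.
have := jensen_powR mu s1 mD mom mG (fun x _ => om0 x) (fun x _ => G0 x).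
rewrite (eq_integral (fun x => (tkernel g 1 o x)%:E * h x)); last first.
  by move=> x; rewrite inE => Dx; exact: omG.
rewrite -tE [X in _ <= _ * X](eq_integral (fun x => h x `^ s * npoweR (w x) (s - q)));
  last by move=> x; rewrite inE => Dx; exact: omGs.
have fin1 : \int[mu]_(x in D) om x < +oo.
  apply: (@le_lt_trans _ _ (\int[mu]_x ((m x)%:E + (m x)%:E * `|w x| `^ q))).
    apply: (@le_trans _ _ (\int[mu]_(x in D) ((m x)%:E + (m x)%:E * `|w x| `^ q))).
      apply: le_integral_nonneg => x // [wx0 wxy].
      rewrite /om -[X in _ <= X + _]mule1 -ge0_muleDr ?poweR_ge0//.
      apply: lee_wpmul2l; first by rewrite lee_fin ltW.
      have := wx0; have := wxy; case: (w x) => [r _|//|//]; rewrite lte_fin => r0.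
      have -> : `|r%:E| = r%:E by rewrite gee0_abs// lee_fin ltW.
      rewrite !poweR_EFin -EFinD lee_fin.
      have [r1|r1] := leP r 1%R.
        rewrite (@le_trans _ _ 1%R) ?lerDl ?powR_ge0//.
        rewrite [leRHS](_ : _ = 1 `^ th)%R; last by rewrite powR1.
        by rewrite ge0_ler_powR ?nnegrE ?(ltW th0) ?(ltW r0).
      by rewrite (@le_trans _ _ (r `^ q)%R) ?lerDr// ler_powR// ltW.
    apply: ge0_subset_integral => //; first by apply: emeasurable_funD.
    by move=> x _; rewrite adde_ge0// lee_fin ltW.
  rewrite ge0_integralD//; last by move=> x _; rewrite lee_fin ltW.
  rewrite lte_add_pinfty//; apply: le_lt_trans (integral_tkernel o Ngb) _.
  exact: ltry.
have fin2 : \int[mu]_(x in D) (h x `^ s * npoweR (w x) (s - q)) < +oo.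
  apply: le_lt_trans Hfin.
  have -> : \int[mu]_(x in D) (h x `^ s * npoweR (w x) (s - q)) =
            \int[mu]_(x in D `&` [set x | h x != 0]) (h x `^ s * npoweR (w x) (s - q)).
    rewrite [RHS]integral_mkcondr; apply: eq_integral => x _; rewrite patchE.
    case: ifPn => //; rewrite notin_setE /= => /negP; rewrite negbK => /eqP ->.
    by rewrite poweR0r ?gt_eqF// mul0e.
  apply: ge0_subset_integral => //; exact: measurableI.
move=> /le_lt_trans H.
have {}H : tpotential 1 h o `^ s < +oo.
  apply: H; apply: lte_mul_pinfty.
  - exact: poweR_ge0.
  - by rewrite ge0_fin_numE ?poweR_ge0// poweR_lty.
  - exact: fin2.
by rewrite ltey; apply: contraTneq H => ->; rewrite poweRyr ?gt_eqF// ltxx.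
Qed.

End global_estimate.

(** * Stopping cubes and the capacitary test function *)

Section dyadic.
Variables (I : countType) (code : int -> T -> I).
Hypothesis mcell : forall j c, measurable [set y | code j y = c].
Hypothesis cell_vol : forall j x,
  mu [set y | code j y = code j x] = ((2 ^ j) `^ N)%:E.
Hypothesis code_dist : forall j x y, code j x = code j y -> (rho x y <= 2 ^ j)%R.
Hypothesis code_succ : forall j x y, code j x = code j y ->
  code (j + 1)%R x = code (j + 1)%R y.

Variable h : T -> \bar R.
Hypothesis mh : measurable_fun setT h.
Hypothesis h0 : forall y, 0 <= h y.
Hypothesis h_fin : forall x, tpotential 1 h x < +oo.

Let l0 (j : int) : (0 < 2 ^ j :> R)%R. Proof. exact: exprz_gt0. Qed.

Definition heavy (j : int) x := exists2 z, code j z = code j x &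
  1 < tpotential (2 ^ j) h z.

Definition selected (j : int) x := heavy j x /\ forall i, (j < i)%R -> ~ heavy i x.

Lemma code_mono i j x y : (j <= i)%R -> code j x = code j y -> code i x = code i y.
Proof.
move=> ji xy; rewrite (_ : i = j + `|i - j|%N)%R; last by lia.
elim: `|i - j|%N => [|k IH]; first by rewrite addr0.
by rewrite -addn1 PoszD addrA; exact: code_succ.
Qed.

Lemma heavy_code i j x y : (j <= i)%R -> code j x = code j y -> heavy i x -> heavy i y.
Proof. by move=> ji xy [z zx Hz]; exists z => //; rewrite zx; exact: code_mono xy. Qed.

Lemma selected_code j x y : code j x = code j y -> selected j x -> selected j y.
Proof.
move=> xy [hx nx]; split; first exact: heavy_code (lexx j) xy hx.
move=> i ji hy; apply: (nx i ji); exact: heavy_code (ltW ji) (esym xy) hy.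
Qed.

Lemma selected_inj i j x : selected i x -> selected j x -> i = j.
Proof.
move=> [hi ni] [hj nj]; case: (ltgtP i j) => // ij.
  by have := ni j ij hj.
by have := nj i ij hi.
Qed.

(** Moving from z to x inside a cell at most doubles the truncated distances. This is the origin of
    the threshold 2^(-g) for U on stopping cubes. *)
Lemma heavy_lt j x : heavy j x -> 1 < (2 `^ g)%:E * tpotential (2 ^ j) h x.
Proof.
move=> [z zx Hz]; apply: lt_le_trans Hz _.
by apply: tpotential_near => //; rewrite mul1r; exact: code_dist.
Qed.

Lemma heavy_bounded x : exists k : nat, forall i : int, (k%:Z <= i)%R -> ~ heavy i x.
Proof.
have e0 : 0 < (2 `^ (- g))%:E :> \bar R by rewrite lte_fin powR_gt0.
have [k Hk] := tpotential_cvg0 mh h0 (h_fin x) e0.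
exists k => i ki /heavy_lt; apply/negP; rewrite -leNgt.
apply: (@le_trans _ _ ((2 `^ g)%:E * (2 `^ (- g))%:E)); last first.
  by rewrite -EFinM -powRD ?subrr ?powRr0// pnatr_eq0 implybT.
apply: lee_wpmul2l; first by rewrite lee_fin powR_ge0.
apply: le_trans (ltW Hk).
apply: tpotential_decr => //.
by rewrite exprnP ler_eXz2l ?ltr1n.
Qed.

Lemma heavy_selected j x : heavy j x -> exists i, selected i x.
Proof.
move=> hj; have [k Hk] := heavy_bounded x.
by have [i hi ni] := int_max hj Hk; exists i; split.
Qed.

(** If U(x) > 1, a truncation at some scale 2^(-k) already exceeds 1 at x, and the cell of that side
    around x is heavy. *)
Lemma potential_le1 x : ~ (exists j, selected j x) -> potential h x <= 1.
Proof.
move=> nx; rewrite leNgt; apply/negP => /(potential_gt_tpotential mh h0)[k Hk].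
have kE : (2 ^ (- k%:Z) = 2^-1 ^+ k :> R)%R by rewrite -exprnN exprVn.
by apply: nx; apply: (@heavy_selected (- k%:Z)%R); exists x; rewrite ?kE.
Qed.

(** Maximality applied to the parent cell, which contains x and is not heavy. *)
Lemma selected_tpotential j x : selected j x -> tpotential (2 * 2 ^ j) h x <= 1.
Proof.
move=> [_ /(_ (j + 1)%R)]; rewrite ltrDl ltr01 => /(_ isT) nh.
rewrite leNgt; apply/negP => H; apply: nh.
have jE : (2 ^ (j + 1) = 2 * 2 ^ j :> R)%R by rewrite exprzDr ?unitfE// expr1z mulrC.
by exists x; rewrite ?jE.
Qed.

Lemma selected_potential j x : selected j x -> 1 <= (2 `^ g)%:E * potential h x.
Proof.
move=> [/heavy_lt/ltW H _]; apply: (le_trans H).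
by apply: lee_wpmul2l; [rewrite lee_fin powR_ge0|exact: tpotential_le].
Qed.

(** The stopping cubes, numbered by the code of the pair of scale and cell so that sums over them
    are series; a number that codes no stopping cube gives the empty set. *)
Definition stop_cell (k : nat) := [set x | exists2 j, selected j x & pickle (j, code j x) = k].

Definition stop_set := \bigcup_k stop_cell k.

Lemma stop_cellE k x : stop_cell k x ->
  exists2 j, selected j x & stop_cell k = [set y | code j y = code j x].
Proof.
move=> [j sj jk]; exists j => //; apply/seteqP; split=> y /=.
  move=> [i si]; rewrite -jk => /(pcan_inj pickleK)[-> ->] //.
move=> yx; exists j; first exact: selected_code sj.
by rewrite yx.
Qed.

Lemma measurable_stop_cell k : measurable (stop_cell k).
Proof.
have [->|/set0P[x /stop_cellE[j _ ->]]] := eqVneq (stop_cell k) set0 => //.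
Qed.

Lemma trivIset_stop_cell : trivIset setT stop_cell.
Proof.
apply/trivIsetP => k1 k2 _ _ /eqP k12; apply/seteqP; split=> // x [[i si ik] [j sj jk]].
by apply: k12; rewrite -ik -jk (selected_inj si sj).
Qed.

Lemma measurable_stop_set : measurable stop_set.
Proof. by apply: bigcup_measurable => k _; exact: measurable_stop_cell. Qed.

Lemma integral_stop (f : T -> \bar R) : measurable_fun setT f ->
  (forall x, 0 <= f x) -> \int[mu]_x f x =
  \int[mu]_(x in ~` stop_set) f x + \sum_(k <oo) \int[mu]_(x in stop_cell k) f x.
Proof.
move=> mf f0; rewrite -ge0_integral_bigcup//; last 3 first.
- exact: measurable_stop_cell.
- exact: measurable_funTS.
- exact: trivIset_stop_cell.
rewrite -(setvU stop_set) ge0_integral_setU//.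
- exact: measurableC measurable_stop_set.
- exact: measurable_stop_set.
- by rewrite setvU.
- by apply/disj_setPS; rewrite setICl.
Qed.

(** * Norm and potential of the averaged function *)

Section test_function.
Variables (p s : R).
Hypotheses (p1 : (1 < p)%R) (gpN : (g * p < N)%R) (s1 : (1 < s)%R).

Let p0 : (0 < p)%R := lt_trans ltr01 p1.
Let s0 : (0 < s)%R := lt_trans ltr01 s1.
Let s10 : (0 < s - 1)%R. Proof. by rewrite subr_gt0. Qed.
Let N0 : (0 < N)%R := lt_trans g0 gN.
Let cell j x : set T := [set y | code j y = code j x].

(** On the ball the kernel truncated at r is the constant r^(-g). *)
Lemma integral_ball_le (x : T) (r : R) : (0 < r)%R ->
  \int[mu]_(y in [set y | (rho x y <= r)%R]) h y <=
  (r `^ g)%:E * tpotential r h x.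
Proof.
move=> r0; rewrite -ge0_integralZl_EFin ?powR_ge0//; last 2 first.
- by move=> y _; rewrite mule_ge0 ?lee_fin ?tkernel_ge0.
- exact: measurable_tkernelM.
apply: (@le_trans _ _ (\int[mu]_(y in [set y | (rho x y <= r)%R])
   ((r `^ g)%:E * ((tkernel g r x y)%:E * h y)))).
  apply: le_integral_nonneg => y // yr; rewrite muleA -EFinM.
  rewrite [X in _ <= X%:E * _](_ : _ = 1%R) ?mul1e//.
  rewrite /tkernel (max_idPl yr) -powRD ?subrr ?powRr0//.
  by apply/implyP => _; rewrite gt_eqF.
apply: ge0_subset_integral => //; first exact: measurable_ball_rho.
  by apply: emeasurable_funM => //; exact: measurable_tkernelM.
by move=> y _; rewrite mule_ge0 ?lee_fin ?powR_ge0// mule_ge0 ?lee_fin ?tkernel_ge0.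
Qed.

Let lpot r z := \int[mu]_(y in [set y | (rho z y <= r)%R]) (kernel z y * h y).

Let lpot_ge0 r z : 0 <= lpot r z.
Proof. by apply: integral_ge0 => y _; rewrite mule_ge0 ?kernel_ge0. Qed.

(** Separates a tail, bounded on a stopping cube by maximality, from a local part that is controlled
    only in the mean. *)
Lemma potential_split r z : (0 < r)%R ->
  potential h z <= tpotential r h z + lpot r z.
Proof.
move=> r0; have mD : measurable [set y | (r <= rho z y)%R].
  by have [] := measurable_levels r (measurable_rho z).
have cov := @integral_cover2 _ _ (fun y => kernel z y * h y) mD (measurable_ball_rho z r).
apply: (le_trans (cov _ (measurable_kernelM _ mh) _)).
- by move=> y /=; have [|/ltW] := leP r (rho z y); [left|right].
- by move=> y; rewrite mule_ge0 ?kernel_ge0.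
rewrite leeD2r//.
apply: (@le_trans _ _ (\int[mu]_(y in [set y | (r <= rho z y)%R])
   ((tkernel g r z y)%:E * h y))).
  apply: le_integral_nonneg => y /= ry; first by rewrite mule_ge0 ?kernel_ge0.
  by rewrite tkernel_far// -kernelE//; exact: lt_le_trans ry.
apply: ge0_subset_integral => //; first exact: measurable_tkernelM.
by move=> y _; rewrite mule_ge0 ?lee_fin ?tkernel_ge0.
Qed.

Lemma poweRD_le (x y : \bar R) : 0 <= x -> 0 <= y ->
  (x + y) `^ p <= (2 `^ p)%:E * (x `^ p + y `^ p).
Proof.
move=> x0 y0; wlog xy : x y x0 y0 / x <= y.
  move=> H; have [xy|/ltW yx] := leP x y; first exact: H.
  by rewrite addeC (addeC (x `^ p)); exact: H.
apply: (@le_trans _ _ ((2%:E * y) `^ p)).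
  apply: gt0_ler_poweR; rewrite ?in_itv/= ?leey ?andbT ?(ltW p0) ?adde_ge0//.
  - by rewrite mule_ge0// lee_fin.
  - by rewrite (_ : 2 = 1 + 1)%R// EFinD ge0_muleDl ?lee_fin// !mul1e leeD.
rewrite poweRM ?lee_fin// poweR_EFin; apply: lee_wpmul2l.
  by rewrite lee_fin powR_ge0.
by rewrite leeDr// poweR_ge0.
Qed.

Lemma kernel_poweR z y : kernel z y `^ p = npoweR (rho z y)%:E (g * p).
Proof.
rewrite /kernel; have [r0|] := ltP 0%R (rho z y).
  by rewrite !npoweR_EFin// poweR_EFin -powRrM mulNr.
move=> r0; rewrite (_ : rho z y = 0%R); last first.
  by apply/eqP; rewrite eq_le r0 rho_ge0.
by rewrite !npoweR0 ?mulf_neq0 ?gt_eqF// poweRyr// gt_eqF.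
Qed.

Let Cr := radialC A N (g * p).
Let Cr0 : (0 <= Cr)%R. Proof. exact: radialC_ge0. Qed.

Section one_cell.
Variables (j : int) (x0 : T).
Hypothesis sel : selected j x0.
Let l : R := (2 ^ j)%R.
Let lgt0 : (0 < l)%R := l0 j.
Let Q := cell j x0.
Let mQ : measurable Q := mcell j (code j x0).

Let sel_cell z : Q z -> selected j z.
Proof. by move=> Qz; exact: selected_code (esym Qz) sel. Qed.

Let tp2 z : Q z -> tpotential (2 * l) h z <= 1.
Proof. by move=> /sel_cell /selected_tpotential. Qed.

Let tp1 z : Q z -> tpotential l h z <= (2 `^ g)%:E.
Proof.
move=> Qz; apply: le_trans (tpotential_double z lgt0 mh h0) _.
by rewrite -[leRHS]mule1; apply: lee_wpmul2l; [rewrite lee_fin powR_ge0|exact: tp2].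
Qed.

Let ball1 z : Q z -> \int[mu]_(y in [set y | (rho z y <= l)%R]) h y <= ((2 * l) `^ g)%:E.
Proof.
move=> Qz; apply: le_trans (integral_ball_le z lgt0) _.
rewrite powRM// ?(ltW lgt0)// mulrC EFinM.
by apply: lee_wpmul2l; [rewrite lee_fin powR_ge0|exact: tp1].
Qed.

Let ball2 : \int[mu]_(y in [set y | (rho x0 y <= 2 * l)%R]) h y <= ((2 * l) `^ g)%:E.
Proof.
have l2 : (0 < 2 * l)%R by rewrite mulr_gt0.
apply: le_trans (integral_ball_le x0 l2) _.
rewrite -[leRHS]mule1; apply: lee_wpmul2l; first by rewrite lee_fin powR_ge0.
exact: tp2.
Qed.

(** Jensen's inequality for the measure h dmu on the ball, whose total mass is at most (2l)^g. *)
Let lpot_le z : Q z -> lpot l z `^ p <= ((2 * l) `^ g `^ (p - 1))%:E *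
  \int[mu]_(y in [set y | (rho z y <= l)%R]) (h y * kernel z y `^ p).
Proof.
move=> Qz.
have mk := @measurable_kernel z [set y | (rho z y <= l)%R].
have H := jensen_powR mu p1 (measurable_ball_rho z l) (measurable_funTS mh) mk
  (fun y _ => h0 y) (fun y _ => kernel_ge0 z y).
rewrite /lpot; under eq_integral do rewrite muleC.
apply: (le_trans H); apply: lee_wpmul2r.
  by apply: integral_ge0 => y _; rewrite mule_ge0 ?poweR_ge0.
rewrite -poweR_EFin; apply: gt0_ler_poweR.
- by rewrite subr_ge0 ltW.
- by rewrite in_itv/= leey andbT integral_ge0.
- by rewrite in_itv/= leey andbT lee_fin powR_ge0.
- exact: ball1.
Qed.

Let measurable_lpot : measurable_fun setT (lpot l).
Proof.
rewrite (_ : lpot l = (fun z => \int[mu]_y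
  (if (rho z y <= l)%R then kernel z y * h y else 0))); last first.
  by apply/funext => z; rewrite integral_if.
apply: (measurable_fun_fubini_tonelli_F (m2 := mu)
  (fun q => if (rho q.1 q.2 <= l)%R then kernel q.1 q.2 * h q.2 else 0)).
  apply: measurable_fun_ifT => //.
    by apply: measurable_fun_ler.
  by apply: emeasurable_funM; [exact: measurable_kernel2|exact: measurable_comp_snd].
by move=> q; case: ifP => // _; rewrite mule_ge0 ?kernel_ge0.
Qed.

(** Tonelli's theorem leaves the integral of rho(y, z)^(-gp) over z in a ball of radius l, at most
    Cr l^(N-gp) because g p < N. The remaining y lie within 2l of x0, where h has mass at most
    (2l)^g, and the powers of l combine to l^N. *)
Let integral_lpot :
  \int[mu]_(z in Q) (lpot l z `^ p) <= (2 `^ (g * p) * Cr * l `^ N)%:E.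
Proof.
pose F (q : T * T) := if (code j q.1 == code j x0) && (rho q.1 q.2 <= l)%R then
  h q.2 * kernel q.1 q.2 `^ p else 0.
have F0 q : 0 <= F q by rewrite /F; case: ifP => // _; rewrite mule_ge0 ?poweR_ge0.
have mF : measurable_fun setT F.
  apply: measurable_fun_ifT => //.
    apply: measurable_and; last exact: measurable_fun_ler.
    apply: (@measurable_comp_fst _ _ _ _ _ _ (fun z => code j z == code j x0)).
    apply: (@measurable_fun_bool _ _ _ _ true).
    rewrite setTI; have := mQ; congr measurable.
    by apply/seteqP; split=> z /=; [move=> /eqP|move=> /eqP].
  apply: emeasurable_funM; first exact: measurable_comp_snd.
  by apply: measurable_fun_poweR; exact: measurable_kernel2.
apply: (@le_trans _ _ (((2 * l) `^ g `^ (p - 1))%:E *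
    \int[mu]_z \int[mu]_y F (z, y))).
  rewrite -ge0_integralZl_EFin ?powR_ge0//; last 2 first.
  - by move=> z _; exact: integral_ge0.
  - exact: (measurable_fun_fubini_tonelli_F (m2 := mu) F).
  rewrite [leLHS]integral_mkcond; apply: le_integral_nonneg => z _.
    by apply: erestrict_ge0 => {}z _; exact: poweR_ge0.
  rewrite patchE; case: ifPn => [|_]; last first.
    by rewrite mule_ge0 ?lee_fin ?powR_ge0// integral_ge0.
  rewrite inE => Qz; apply: le_trans (lpot_le Qz) _.
  apply: lee_wpmul2l; first by rewrite lee_fin powR_ge0.
  by rewrite /F/= Qz eqxx/= integral_if.
rewrite fubini_tonelli//.
apply: (@le_trans _ _ (((2 * l) `^ g `^ (p - 1))%:E *
    ((Cr * l `^ (N - g * p))%:E * ((2 * l) `^ g)%:E))); last first.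
  rewrite -!EFinM lee_fin le_eqVlt; apply/orP; left; apply/eqP.
  have l20 : (0 < 2 * l)%R by rewrite mulr_gt0.
  have NE : (l `^ N = l `^ (N - g * p) * l `^ (g * p))%R.
    rewrite -powRD ?subrK//.
    by apply/implyP => _; rewrite gt_eqF.
  rewrite NE [RHS](_ : _ = Cr * l `^ (N - g * p) * ((2 * l) `^ (g * p)))%R; last first.
    by rewrite powRM// ?(ltW lgt0)//; ring.
  have -> : ((2 * l) `^ (g * p) = (2 * l) `^ g * (2 * l) `^ g `^ (p - 1))%R.
    rewrite -powRrM -powRD; last by apply/implyP => _; rewrite gt_eqF.
    by congr (_ `^ _)%R; ring.
  ring.
apply: lee_wpmul2l; first by rewrite lee_fin powR_ge0.
have Cl0 : (0 <= Cr * l `^ (N - g * p))%R by rewrite mulr_ge0 ?powR_ge0.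
apply: (@le_trans _ _ ((Cr * l `^ (N - g * p))%:E *
   \int[mu]_(y in [set y | (rho x0 y <= 2 * l)%R]) h y)); last first.
  by apply: lee_wpmul2l => //; rewrite lee_fin.
rewrite -ge0_integralZl_EFin//; last 2 first.
- exact: measurable_ball_rho.
- exact: measurable_funTS.
rewrite [leRHS]integral_mkcond; apply: le_integral_nonneg => y _.
  exact: integral_ge0.
rewrite patchE; case: ifPn => [_|]; last first.
  rewrite notin_setE /= => yfar; rewrite integral0_eq// => z _; rewrite /F/=.
  case: ifP => // /andP[/eqP Qz zy]; exfalso; apply: yfar.
  rewrite (le_trans (rho_tri x0 z y))// mulrDl mul1r lerD//.
  exact/code_dist/esym.
apply: (@le_trans _ _ (\int[mu]_(z in [set z | (rho y z <= l)%R])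
    (h y * npoweR (rho y z)%:E (g * p)))).
  rewrite -(integral_if mu (fun z => (rho y z <= l)%R)).
  apply: le_integral_nonneg => z _ //; rewrite /F /= kernel_poweR rhoC.
  case: (_ <= _)%R; rewrite ?andbF// andbT; case: ifP => // _.
  by rewrite mule_ge0 ?npoweR_ge0.
rewrite ge0_integralZl//; last 3 first.
- exact: measurable_ball_rho.
- apply: measurable_funTS; apply: measurable_fun_npoweR.
  by apply/measurable_EFinP; exact: measurable_rho.
- by move=> z _; exact: npoweR_ge0.
rewrite muleC; apply: lee_wpmul2r => //.
exact: (integral_radial_near (measurable_rho y) (rho_ge0 y) A0 lgt0 (vol y) N0 gpN).
Qed.

Let Cp := (2 `^ p * 2 `^ (g * p) * (1 + Cr))%R.

(** The tail of U is at most 2^g on Q and the local part is bounded in L^p. As |Q| = l^N, the mean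
    of U^p over Q is bounded independently of the cube, although U itself may be unbounded there. *)
Lemma integral_potential_cell :
  \int[mu]_(z in Q) (potential h z `^ p) <= (Cp * l `^ N)%:E.
Proof.
have mlp : measurable_fun Q (fun z => lpot l z `^ p).
  by apply: measurable_funTS; exact: measurable_fun_poweR.
apply: (@le_trans _ _ (\int[mu]_(z in Q) ((2 `^ p)%:E *
   (cst (2 `^ (g * p))%:E z + lpot l z `^ p)))).
  apply: le_integral_nonneg => z Qz; first exact: poweR_ge0.
  apply: (@le_trans _ _ ((tpotential l h z + lpot l z) `^ p)).
    apply: gt0_ler_poweR; rewrite ?in_itv/= ?leey ?andbT ?(ltW p0)//.
    - exact: potential_ge0.
    - by rewrite adde_ge0// tpotential_ge0.
    - exact: potential_split.
  apply: le_trans (poweRD_le (tpotential_ge0 _ _ h0) (lpot_ge0 _ _)) _.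
  apply: lee_wpmul2l; first by rewrite lee_fin powR_ge0.
  rewrite leeD2r//= powRrM -poweR_EFin.
  apply: gt0_ler_poweR; rewrite ?in_itv/= ?leey ?andbT ?(ltW p0)//.
  - exact: tpotential_ge0.
  - exact: tp1.
rewrite ge0_integralZl_EFin ?powR_ge0//; last 2 first.
- by move=> z _; rewrite adde_ge0 ?poweR_ge0// lee_fin powR_ge0.
- by apply: emeasurable_funD => //; exact: measurable_cst.
rewrite ge0_integralD//; last 2 first.
- by move=> z _; rewrite lee_fin powR_ge0.
- by move=> z _; exact: poweR_ge0.
have -> : \int[mu]_(x in Q) cst (2 `^ (g * p))%:E x = (2 `^ (g * p))%:E * (l `^ N)%:E.
  by rewrite integral_cst//; congr (_ * _); exact: cell_vol.
apply: (@le_trans _ _ ((2 `^ p)%:E * ((2 `^ (g * p))%:E * (l `^ N)%:E +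
   (2 `^ (g * p) * Cr * l `^ N)%:E))).
  apply: lee_wpmul2l; first by rewrite lee_fin powR_ge0.
  by rewrite leeD2l.
rewrite lee_fin /Cp le_eqVlt; apply/orP; left; apply/eqP; ring.
Qed.

(* Jensen's inequality for the measure U^p dmu and the function h U^(-p), where
   U is the potential of h. *)
Lemma holder_cell :
  (\int[mu]_(y in Q) h y) `^ s <= (Cp `^ (s - 1) * l `^ (N * (s - 1)))%:E *
  \int[mu]_(y in Q) (h y `^ s * npoweR (potential h y) (p * (s - 1))).
Proof.
have mU := measurable_potential mh h0.
(* On Q the potential is positive and almost everywhere finite; after discarding the points where it
   is infinite, U^p U^(-p) = 1. *)
pose D := Q `&` [set y | potential h y < +oo].
have mD : measurable D.
  apply: measurableI => //.
  by have := emeasurable_fun_infty_o measurableT mU +oo; rewrite setTI.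
have Upos z : Q z -> 0 < potential h z.
  move=> /sel_cell /selected_potential; rewrite lt0e potential_ge0// andbT => U1.
  by apply: contraTneq U1 => ->; rewrite mule0 -ltNge lte01.
have aeU : {ae mu, forall z, Q z -> potential h z < +oo}.
  have int : mu.-integrable Q (fun z => potential h z `^ p).
    apply/integrableP; split.
      by apply: measurable_funTS; exact: measurable_fun_poweR.
    under eq_integral do rewrite gee0_abs ?poweR_ge0//.
    exact: le_lt_trans integral_potential_cell (ltry _).
  apply: filterS (integrable_ae mQ int) => z H Qz; have := H Qz.
  rewrite ltey; apply: contraTneq => ->.
  by rewrite poweRyr// gt_eqF.
have restr (f : T -> \bar R) : measurable_fun setT f -> (forall y, 0 <= f y) ->
    \int[mu]_(y in Q) f y = \int[mu]_(y in D) f y.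
  move=> mf f0; rewrite [RHS]integral_mkcondr; apply: ge0_ae_eq_integral => //.
  - exact: measurable_funTS.
  - apply: measurable_funTS; apply/(measurable_restrictT _ _).1.
      by have := emeasurable_fun_infty_o measurableT mU +oo; rewrite setTI.
    exact: measurable_funTS.
  - by move=> y _; exact: erestrict_ge0.
  - by apply: filterS aeU => y H Qy; rewrite patchE mem_set//; exact: H.
have mUp : measurable_fun setT (fun y => potential h y `^ p).
  exact: measurable_fun_poweR.
have mG : measurable_fun setT (fun y => h y * npoweR (potential h y) p).
  by apply: emeasurable_funM => //; exact: measurable_fun_npoweR.
have G0 y : 0 <= h y * npoweR (potential h y) p by rewrite mule_ge0 ?npoweR_ge0.
have := jensen_powR mu s1 mD (measurable_funTS mUp) (measurable_funTS mG)
  (fun y _ => poweR_ge0 _ _) (fun y _ => G0 y).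
rewrite (eq_integral h); last first.
  move=> y; rewrite inE => -[/Upos Uy0 /= Uyy].
  move: Uy0 Uyy; case: (potential h y) => [u| |]//; rewrite lte_fin => u0 _.
  rewrite npoweR_EFin// poweR_EFin muleCA -EFinM -powRD ?subrr ?powRr0 ?mule1//.
  by apply/implyP => _; rewrite gt_eqF.
rewrite -restr// [X in _ <= _ * X](eq_integral (fun y => h y `^ s *
    npoweR (potential h y) (p * (s - 1)))); last first.
  move=> y; rewrite inE => -[/Upos Uy0 /= Uyy].
  move: Uy0 Uyy; case: (potential h y) => [u| |]//; rewrite lte_fin => u0 _.
  rewrite !npoweR_EFin// poweR_EFin poweRM ?lee_fin ?powR_ge0// poweR_EFin muleCA.
  rewrite -EFinM -powRrM -powRD; last by apply/implyP => _; rewrite gt_eqF.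
  by congr (_ * (_ `^ _)%:E); ring.
move=> H; apply: (le_trans H).
apply: (@le_trans _ _ ((Cp `^ (s - 1) * l `^ (N * (s - 1)))%:E *
  \int[mu]_(y in D) (h y `^ s * npoweR (potential h y) (p * (s - 1))))).
  apply: lee_wpmul2r.
    by apply: integral_ge0 => y _; rewrite mule_ge0 ?poweR_ge0 ?npoweR_ge0.
  have Cp0 : (0 <= Cp)%R by rewrite !mulr_ge0 ?powR_ge0// addr_ge0.
  rewrite powRrM -powRM ?powR_ge0// -poweR_EFin.
  apply: gt0_ler_poweR; first exact: ltW.
  - by rewrite in_itv/= leey andbT integral_ge0// => y _; exact: poweR_ge0.
  - by rewrite in_itv/= leey andbT lee_fin mulr_ge0 ?powR_ge0.
  - apply: le_trans integral_potential_cell.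
    apply: ge0_subset_integral => //.
    + exact: measurable_funTS.
    + by move=> y _; exact: poweR_ge0.
    + by move=> y [].
apply: lee_wpmul2l; first by rewrite lee_fin mulr_ge0 ?powR_ge0.
apply: ge0_subset_integral => //.
- apply: measurable_funTS; apply: emeasurable_funM; first exact: measurable_fun_poweR.
  exact: measurable_fun_npoweR.
- by move=> y _; rewrite mule_ge0 ?poweR_ge0 ?npoweR_ge0.
- by move=> y [].
Qed.

End one_cell.

Let C7 := ((2 `^ p * 2 `^ (g * p) * (1 + Cr)) `^ (s - 1))%R.

Let avg k : \bar R := (fine (mu (stop_cell k)))^-1%:E * \int[mu]_(y in stop_cell k) h y.

(* On [stop_set] exactly one [k] satisfies the predicate, so the default [0%N]
   is never used. *)
Definition stopped y : \bar R :=
  if y \in stop_set then avg (xget 0%N [set k | stop_cell k y]) else h y.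

Let avg_ge0 k : 0 <= avg k.
Proof.
by rewrite mule_ge0 ?integral_ge0// lee_fin invr_ge0 fine_ge0.
Qed.

Let stopped_ge0 y : 0 <= stopped y.
Proof. by rewrite /stopped; case: ifP. Qed.

Let stopped_cell k y : stop_cell k y -> stopped y = avg k.
Proof.
move=> ky; rewrite /stopped mem_set; last by exists k.
congr avg; case: xgetP => [k' _ k'y|/(_ k)//].
apply: contrapT => /eqP kk'.
have /trivIsetP/(_ k' k Logic.I Logic.I kk')/seteqP[H _] := trivIset_stop_cell.
by apply: (H y); split.
Qed.

Let stopped_out y : ~ stop_set y -> stopped y = h y.
Proof. by move=> ny; rewrite /stopped memNset. Qed.

Let measurable_stopped : measurable_fun setT stopped.
Proof.
rewrite -(setUv stop_set); apply/measurable_funU.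
- exact: measurable_stop_set.
- exact: measurableC measurable_stop_set.
split.
  apply/measurable_fun_bigcup => k; first exact: measurable_stop_cell.
  apply: (eq_measurable_fun (cst (avg k))) => [y|]; last exact: measurable_cst.
  by rewrite inE => /stopped_cell ->.
apply: (eq_measurable_fun h) => [y|]; last exact: measurable_funTS.
by rewrite inE => /stopped_out ->.
Qed.

Let avgE j x0 k : selected j x0 -> stop_cell k = cell j x0 ->
  avg k = ((2 ^ j) `^ (- N))%:E * \int[mu]_(y in cell j x0) h y.
Proof.
move=> sel kE; rewrite /avg kE; congr (_%:E * _).
by rewrite powRN; congr (_^-1)%R; rewrite [X in fine X](cell_vol j x0).
Qed.

Let integral_cst_cell j x0 c :
  \int[mu]_(y in [set y | code j y = code j x0]) cst c y = c * ((2 ^ j) `^ N)%:E.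
Proof. by rewrite integral_cst//; congr (_ * _); exact: cell_vol. Qed.

(** The power l^(N - N s) arising from |Q| times the s-th power of the average cancels the l^(N
    (s-1)) of [holder_cell], so the constant is the same for all cells. *)
Let integral_stopped_cell k :
  \int[mu]_(y in stop_cell k) (stopped y `^ s) <=
  C7%:E * \int[mu]_(y in stop_cell k) (h y `^ s * npoweR (potential h y) (p * (s - 1))).
Proof.
have [->|/set0P[x0 kx]] := eqVneq (stop_cell k) set0; first by rewrite !integral_set0 mule0.
have [j sel kE] := stop_cellE kx.
rewrite (eq_integral (cst (avg k `^ s))); last first.
  by move=> y; rewrite inE => /stopped_cell ->.
rewrite (avgE sel kE) kE integral_cst_cell.
rewrite poweRM ?lee_fin ?powR_ge0 ?integral_ge0// poweR_EFin -powRrM muleAC -EFinM.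
rewrite -powRD; last by apply/implyP => _; rewrite gt_eqF.
apply: (le_trans (lee_wpmul2l _ (holder_cell sel))); first by rewrite lee_fin powR_ge0.
rewrite muleA -EFinM mulrCA -(@powRD _ (2 ^ j)%R); last first.
  by apply/implyP => _; rewrite gt_eqF.
by rewrite (_ : - N * s + N + N * (s - 1) = 0)%R ?powRr0 ?mulr1//; ring.
Qed.

Let mhU : measurable_fun setT
  (fun y => h y `^ s * npoweR (potential h y) (p * (s - 1))).
Proof.
apply: emeasurable_funM; first exact: measurable_fun_poweR.
by apply: measurable_fun_npoweR; exact: measurable_potential.
Qed.

Let hU0 y : 0 <= h y `^ s * npoweR (potential h y) (p * (s - 1)).
Proof. by rewrite mule_ge0 ?poweR_ge0 ?npoweR_ge0. Qed.

(** The first set contains the complement of the stopping cubes, where h is unchanged; the second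
    contains the cubes. They may overlap. *)
Lemma integral_stopped : \int[mu]_y (stopped y `^ s) <=
  \int[mu]_(y in [set y | potential h y <= 1]) (h y `^ s) +
  C7%:E * \int[mu]_(y in [set y | 1 <= (2 `^ g)%:E * potential h y])
    (h y `^ s * npoweR (potential h y) (p * (s - 1))).
Proof.
have mU := measurable_potential mh h0.
have C70 : (0 <= C7)%R by exact: powR_ge0.
have mhs D : measurable_fun D (fun y => h y `^ s).
  by apply: measurable_funTS; exact: measurable_fun_poweR.
rewrite integral_stop; [|exact: measurable_fun_poweR|by move=> y; exact: poweR_ge0].
apply: leeD.
  rewrite (eq_integral (fun y => h y `^ s)); last first.
    by move=> y; rewrite inE => /stopped_out ->.
  apply: ge0_subset_integral => //.
  - exact: measurableC measurable_stop_set.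
  - by have := emeasurable_fun_infty_c measurableT mU 1; rewrite setTI.
  - by move=> y _; exact: poweR_ge0.
  - move=> y ny /=; apply: potential_le1 => -[j sj]; apply: ny.
    by exists (pickle (j, code j y)) => //; exists j.
apply: (@le_trans _ _ (\sum_(k <oo) C7%:E * \int[mu]_(y in stop_cell k)
   (h y `^ s * npoweR (potential h y) (p * (s - 1))))).
  apply: lee_nneseries => // k _ _; apply: integral_ge0 => y _; exact: poweR_ge0.
rewrite nneseriesZl; last by move=> k _; exact: integral_ge0.
apply: lee_wpmul2l; first by rewrite lee_fin.
rewrite -ge0_integral_bigcup//; last 3 first.
- exact: measurable_stop_cell.
- exact: measurable_funTS.
- exact: trivIset_stop_cell.
apply: ge0_subset_integral => //.
- exact: measurable_stop_set.
- have := emeasurable_fun_c_infty measurableT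
    (measurable_funeM (2 `^ g)%:E mU) 1.
  by rewrite setTI.
- exact: measurable_funTS.
- by move=> y [k _ [j sj _]]; exact: selected_potential sj.
Qed.

Lemma potential_stopped x : 1 < potential h x ->
  1 < (6 `^ g)%:E * potential stopped x.
Proof.
move=> Ux.
(* With [J] the largest good scale, every stopping cell of side 2^j having a point
   within 2^j of [x] is good, so that j <= J: the kernel truncated at 2^J is
   comparable to a constant on each stopping cell. *)
pose good (j : int) := 1 < (3 `^ g)%:E * tpotential (2 ^ j) h x.
have g3 : (1 <= 3 `^ g :> R)%R.
  by rewrite -[leLHS](powRr0 3) ler_powR ?ler1n// ltW.
have [J gJ maxJ] : exists2 J, good J & forall i, (J < i)%R -> ~ good i.
  have [k Hk] := potential_gt_tpotential mh h0 Ux.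
  have kE : (2 ^ (- k%:Z) = 2^-1 ^+ k :> R)%R by rewrite -exprnN exprVn.
  have e0 : 0 < (3 `^ (- g))%:E :> \bar R by rewrite lte_fin powR_gt0.
  have [k' Hk'] := tpotential_cvg0 mh h0 (h_fin x) e0.
  apply: (@int_max good (- k%:Z)%R k').
    rewrite /good kE; apply: lt_le_trans Hk _.
    rewrite -[leLHS]mul1e; apply: lee_wpmul2r; first exact: tpotential_ge0.
    by rewrite lee_fin.
  move=> i ki; apply/negP; rewrite -leNgt.
  apply: (@le_trans _ _ ((3 `^ g)%:E * (3 `^ (- g))%:E)); last first.
    by rewrite -EFinM -powRD ?subrr ?powRr0// pnatr_eq0 implybT.
  apply: lee_wpmul2l; first by rewrite lee_fin powR_ge0.
  apply: le_trans (ltW Hk'); apply: tpotential_decr => //.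
  by rewrite exprnP ler_eXz2l ?ltr1n.
apply: (lt_le_trans gJ).
(* The factor 3^g comes from the definition of [good]; 2^g is the price of replacing h by its
   averages. *)
rewrite (_ : 6 = 3 * 2)%R; last by ring.
rewrite powRM// EFinM -muleA; apply: lee_wpmul2l; first by rewrite lee_fin powR_ge0.
have mKf : measurable_fun setT (fun y => kernel x y * stopped y).
  exact: measurable_kernelM.
have Kf0 y : 0 <= kernel x y * stopped y by rewrite mule_ge0 ?kernel_ge0.
have tk0 y : 0 <= (tkernel g (2 ^ J) x y)%:E * h y.
  by rewrite mule_ge0 ?lee_fin ?tkernel_ge0.
rewrite /tpotential /potential integral_stop//; last exact: measurable_tkernelM.
rewrite [in leRHS]integral_stop//.
rewrite ge0_muleDr; last 2 first.
- exact: integral_ge0.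
- by apply: nneseries_ge0 => k _ _; exact: integral_ge0.
have g2 : (1 <= 2 `^ g :> R)%R.
  by rewrite -[leLHS](powRr0 2) ler_powR ?ler1n// ltW.
apply: leeD.
  rewrite -[leLHS]mul1e; apply: lee_pmul => //.
  - exact: integral_ge0.
  - apply: le_integral_nonneg => y ny //.
    rewrite stopped_out//; apply: lee_wpmul2r => //.
    exact: tkernel_le_kernel.
rewrite -nneseriesZl; last by move=> k _; exact: integral_ge0.
apply: lee_nneseries => [k _ _|k _]; first exact: integral_ge0.
have [->|/set0P[x0 kx]] := eqVneq (stop_cell k) set0.
  by rewrite !integral_set0 mule0.
have [j sel kE] := stop_cellE kx.
set Int := \int[mu]_(y in stop_cell k) _.
have Int0 : 0 <= Int by exact: integral_ge0.
have mC := measurable_stop_cell k.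
(* Written as the integral over z of its mean, [Int] can be compared pointwise: for y and z in the
   same cell the truncated kernel at y is to be at most 2^g times the singular kernel at z. *)
have IntE : Int = \int[mu]_(z in stop_cell k) cst (((2 ^ j) `^ (- N))%:E * Int) z.
  rewrite [in RHS]kE integral_cst_cell.
  rewrite muleAC -EFinM -powRD ?addNr ?powRr0 ?mul1e//.
  by apply/implyP => _; rewrite gt_eqF.
rewrite -[leRHS]ge0_integralZl_EFin ?powR_ge0//; last exact: measurable_funTS.
rewrite {1}IntE.
apply: le_integral_nonneg => z kz.
  by rewrite mule_ge0// lee_fin powR_ge0.
rewrite (stopped_cell kz) (avgE sel kE) (muleCA (kernel x z)) [leRHS]muleCA.
rewrite [leLHS]/=; apply: lee_wpmul2l; first by rewrite lee_fin powR_ge0.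
rewrite muleA -ge0_integralZl//; last 3 first.
- by rewrite -[cell j x0]kE.
- exact: measurable_funTS.
- by rewrite mule_ge0 ?kernel_ge0// lee_fin powR_ge0.
rewrite /Int kE; apply: le_integral_nonneg => y /= yx0 //.
apply: lee_wpmul2r => //.
apply: kernel_lower => //; first exact: max_gt0.
have yz : code j y = code j z.
  by move: kz; rewrite kE /= => ->.
rewrite (le_trans (rho_tri x y z))// (_ : 2 = 1 + 1)%R// mulrDl mul1r lerD//.
  by rewrite le_max lexx orbT.
rewrite (le_trans (code_dist yz))// le_max.
have [//|xy] := leP (2 ^ j)%R (rho x y); first by rewrite orbT.
rewrite orbF.
suff gj : good j.
  have : (j <= J)%R by rewrite leNgt; apply/negP => /maxJ; apply.
  by rewrite ler_eXz2l// ltr1n.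
have [[z0 z0x0 Hz0] _] := sel.
(* The heavy point z0 is within 2^j of y, and y within 2^j of x; the distance 2 * 2^j from z0 to x
   is the origin of the constant 3. *)
apply: lt_le_trans Hz0 _; rewrite (_ : 3 = 2 + 1)%R; last by ring.
apply: tpotential_near => //.
rewrite (le_trans (rho_tri z0 y x))// mulrDl mul1r lerD//.
  by apply: code_dist; rewrite z0x0.
by rewrite rhoC ltW.
Qed.

Lemma capacity_test_function : exists f : T -> \bar R,
  [/\ measurable_fun setT f, forall y, 0 <= f y,
      forall x, 1 < potential h x -> 1 <= potential f x &
      \int[mu]_y (f y `^ s) <= (6 `^ (g * s) * (1 + C7))%:E *
       (\int[mu]_(y in [set y | potential h y <= 1]) (h y `^ s) +
        \int[mu]_(y in [set y | 1 <= (2 `^ g)%:E * potential h y])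
          (h y `^ s * npoweR (potential h y) (p * (s - 1))))].
Proof.
have ms := measurable_stopped.
exists (fun y => (6 `^ g)%:E * stopped y); split.
- exact: measurable_funeM.
- by move=> y; rewrite mule_ge0 ?lee_fin ?powR_ge0.
- move=> x /potential_stopped/ltW H; apply: (le_trans H).
  rewrite -ge0_integralZl_EFin ?powR_ge0//; last 2 first.
  + by move=> y _; rewrite mule_ge0 ?kernel_ge0.
  + exact: measurable_kernelM.
  by under eq_integral do rewrite muleCA.
- under eq_integral => y _ do rewrite poweRM ?lee_fin ?powR_ge0// poweR_EFin -powRrM.
  rewrite ge0_integralZl_EFin ?powR_ge0//; last 2 first.
  + by move=> y _; exact: poweR_ge0.
  + exact: measurable_fun_poweR.
  rewrite EFinM -muleA; apply: lee_wpmul2l; first by rewrite lee_fin powR_ge0.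
  apply: (le_trans integral_stopped).
  set I1 := integral _ _ _; set I2 := integral _ _ _.
  have I10 : 0 <= I1 by apply: integral_ge0 => y _; exact: poweR_ge0.
  have I20 : 0 <= I2 by exact: integral_ge0.
  have C70 : (0 <= C7)%R by exact: powR_ge0.
  rewrite EFinD ge0_muleDl ?lee_fin// mul1e leeD//.
    by rewrite leeDl.
  by apply: lee_wpmul2l; rewrite ?lee_fin// leeDr.
Qed.

End test_function.
End dyadic.

(** * Riesz capacity *)

Section riesz.
Variables (edist : T -> T -> R) (c M s : R) (o : T).
Hypothesis medist : measurable_fun setT (fun p : T * T => edist p.1 p.2).
Hypothesis rho_le_edist : forall x y, (rho x y <= edist x y)%R.
Hypothesis edist_le_rho : forall x y, (edist x y <= M * rho x y)%R.
Hypothesis M0 : (0 < M)%R.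
Hypothesis c0 : (0 < c)%R.
Hypothesis s1 : (1 < s)%R.
Hypothesis Ns : (N * (s - 1) < g * s)%R.

Let s0 : (0 < s)%R := lt_trans ltr01 s1.

Definition riesz (f : T -> \bar R) x : \bar R :=
  c%:E * \int[mu]_y (npoweR (edist x y)%:E g * f y).

Definition riesz_cap (E : set T) : \bar R :=
  ereal_inf [set Lnorm mu s%:E f `^ s | f in
    [set f : T -> \bar R | [/\ measurable_fun setT f, forall x, 0 <= f x &
                 forall x, E x -> 1 <= riesz f x]]].

Definition riesz_cap_integral (f : T -> \bar R) : \bar R :=
  \int[@lebesgue_measure R]_(t in `]0%R, +oo[) riesz_cap [set x | t%:E < f x].

Let ekernel (x y : T) : \bar R := npoweR (edist x y)%:E g.

Let mek x D : measurable_fun D (ekernel x).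
Proof.
apply: measurable_funTS; apply: measurable_fun_npoweR; apply/measurable_EFinP.
exact: (measurableT_comp medist (pair1_measurable x)).
Qed.

Let ekernel_ge0 x y : 0 <= ekernel x y. Proof. exact: npoweR_ge0. Qed.

Let mekf x f D : measurable_fun setT f -> measurable_fun D (fun y => ekernel x y * f y).
Proof.
by move=> mf; apply: emeasurable_funM; [exact: mek|exact: measurable_funTS].
Qed.

Lemma riesz_le_potential f x : (forall y, 0 <= f y) ->
  riesz f x <= c%:E * potential f x.
Proof.
move=> f0; apply: lee_wpmul2l; first by rewrite lee_fin ltW.
apply: le_integral_nonneg => y _; first by rewrite mule_ge0 ?npoweR_ge0.
apply: lee_wpmul2r => //; apply: npoweR_le; rewrite ?lee_fin//.
Qed.

Lemma potential_le_riesz f x : measurable_fun setT f ->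
  (forall y, 0 <= f y) -> c%:E * potential f x <= (M `^ g)%:E * riesz f x.
Proof.
move=> mf f0; rewrite /riesz muleCA; apply: lee_wpmul2l.
  by rewrite lee_fin ltW.
rewrite -ge0_integralZl_EFin ?powR_ge0//; last 2 first.
- by move=> y _; rewrite mule_ge0 ?npoweR_ge0.
- exact: mekf.
apply: le_integral_nonneg => y _; first by rewrite mule_ge0 ?npoweR_ge0.
rewrite muleA; apply: lee_wpmul2r => //.
apply: (@le_trans _ _ ((M `^ g)%:E * npoweR (M%:E * (rho x y)%:E) g)).
  rewrite npoweRM ?lee_fin// muleA -EFinM -powRD ?subrr ?powRr0 ?mul1e//.
  by apply/implyP => _; rewrite gt_eqF.
apply: lee_wpmul2l; first by rewrite lee_fin powR_ge0.
apply: npoweR_le => //; first by rewrite lee_fin (le_trans (rho_ge0 x y)).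
by rewrite -EFinM lee_fin edist_le_rho.
Qed.

Lemma riesz_ge0 f x : (forall y, 0 <= f y) -> 0 <= riesz f x.
Proof.
move=> f0; rewrite mule_ge0 ?lee_fin ?(ltW c0)// integral_ge0// => y _.
by rewrite mule_ge0 ?npoweR_ge0.
Qed.

Lemma riesz_le f h x : measurable_fun setT f -> measurable_fun setT h ->
  (forall y, 0 <= f y) -> (forall y, 0 <= h y) ->
  {ae mu, forall y, f y <= h y} -> riesz f x <= riesz h x.
Proof.
move=> mf mh f0 h0 fh; apply: lee_wpmul2l; first by rewrite lee_fin ltW.
apply: ae_ge0_le_integral => //.
- by move=> y _; rewrite mule_ge0 ?npoweR_ge0.
- exact: mekf.
- by move=> y _; rewrite mule_ge0 ?npoweR_ge0.
- exact: mekf.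
- by apply: filterS fh => y fhy _; apply: lee_wpmul2l => //; exact: npoweR_ge0.
Qed.

Lemma riesz_ae_eq f h x : measurable_fun setT f -> measurable_fun setT h ->
  {ae mu, forall y, f y = h y} -> riesz f x = riesz h x.
Proof.
move=> mf mh fh; congr (_ * _); apply: ae_eq_integral => //; try exact: mekf.
by apply: filterS fh => y -> _.
Qed.

Lemma measurable_riesz f : measurable_fun setT f ->
  (forall y, 0 <= f y) -> measurable_fun setT (riesz f).
Proof.
move=> mf f0; apply: measurable_funeM.
apply: (measurable_fun_fubini_tonelli_F (m2 := mu)
  (fun p => ekernel p.1 p.2 * f p.2)).
  apply: emeasurable_funM; last exact: measurable_comp_snd.
  by apply: measurable_fun_npoweR; apply/measurable_EFinP.
by move=> p; rewrite mule_ge0.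
Qed.

Lemma riesz_cap_ge0 E : 0 <= riesz_cap E.
Proof. by apply/le_ereal_inf_tmp => _ [f _ <-]; exact: poweR_ge0. Qed.

Lemma riesz_cap_le E f : measurable_fun setT f ->
  (forall y, 0 <= f y) -> (forall x, E x -> 1 <= riesz f x) ->
  riesz_cap E <= \int[mu]_y (f y `^ s).
Proof.
move=> mf f0 Ef; apply: ereal_inf_lbound; exists f => //.
rewrite poweR_Lnorm ?gt_eqF//; apply: eq_integral => y _.
by rewrite gee0_abs.
Qed.

Lemma riesz_cap_mono E F : E `<=` F -> riesz_cap E <= riesz_cap F.
Proof.
move=> EF; apply: ereal_inf_le_tmp => _ [f [mf f0 Ff] <-].
by exists f => //; split=> // x /EF; exact: Ff.
Qed.

Let b := (g / (s - 1))%R.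
Let m x := tkernel (g + b) 1 o x.
Let m0 x : (0 < m x)%R. Proof. by rewrite powR_gt0// max_gt0. Qed.

(** If f is admissible for E, then c f has potential at least 1 on E, and the weak-type estimate
    applies to c f. The summand 1 in the constant keeps the inverse positive. *)
Lemma riesz_cap_lower : exists2 C : R, (0 < C)%R & forall E,
  measurable E -> \int[mu]_(x in E) (C * m x)%:E <= riesz_cap E.
Proof.
have := potential_weak_type o s1 Ns.
rewrite -/b; set C4 := (_ `^ (s - 1) * _)%R => weak.
have C40 : (0 <= C4)%R.
  rewrite mulr_ge0 ?powR_ge0// mulr_ge0 ?powR_ge0//.
  by rewrite !addr_ge0 ?radialC_ge0 ?mulr_ge0 ?tkernel_const_ge0.
have K0 : (0 < C4 * c `^ s + 1)%R by rewrite ltr_wpDl// mulr_ge0 ?powR_ge0.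
exists (C4 * c `^ s + 1)^-1%R; first by rewrite invr_gt0.
move=> E mE; apply/le_ereal_inf_tmp => _ [f [mf f0 Ef] <-].
rewrite poweR_Lnorm ?gt_eqF//.
rewrite [leLHS](eq_integral (fun x => (C4 * c `^ s + 1)^-1%:E * (m x)%:E)); last first.
  by move=> x _; rewrite EFinM.
rewrite [leLHS]ge0_integralZl_EFin//; last 3 first.
- by move=> x _; rewrite lee_fin ltW.
- exact: measurable_tkernelE.
- by rewrite invr_ge0 ltW.
rewrite lee_pdivrMl//.
have mcf : measurable_fun setT (fun y => c%:E * f y) by exact: measurable_funeM.
have cf0 y : 0 <= c%:E * f y by rewrite mule_ge0// lee_fin ltW.
apply: (le_trans (weak (fun y => c%:E * f y) E mcf cf0 mE _)).
  move=> x /Ef /le_trans; apply.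
  apply: (le_trans (riesz_le_potential x f0)).
  rewrite /potential -ge0_integralZl_EFin ?(ltW c0)//; last 2 first.
  - by move=> y _; rewrite mule_ge0 ?npoweR_ge0.
  - exact: measurable_kernelM.
  by under eq_integral do rewrite muleCA.
have -> : \int[mu]_y (c%:E * f y) `^ s = (c `^ s)%:E * \int[mu]_y f y `^ s.
  rewrite -ge0_integralZl_EFin ?powR_ge0//; last 2 first.
  - by move=> y _; exact: poweR_ge0.
  - exact: measurable_fun_poweR.
  by apply: eq_integral => y _; rewrite poweRM ?lee_fin ?(ltW c0)// poweR_EFin.
have -> : \int[mu]_y `|f y| `^ s = \int[mu]_y f y `^ s.
  by apply: eq_integral => y _; rewrite gee0_abs.
rewrite muleA -EFinM.
apply: lee_wpmul2r; first by apply: integral_ge0 => y _; exact: poweR_ge0.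
by rewrite lee_fin lerDl.
Qed.

(** The density in the lower bound is positive everywhere. Thus a weight that is nonnegative
    quasi-everywhere is so almost everywhere. *)
Lemma riesz_cap_null (E : set T) : measurable E -> riesz_cap E = 0 -> mu E = 0.
Proof.
move=> mE E0; have [C C0 /(_ E mE)] := riesz_cap_lower; rewrite E0 => H.
have : \int[mu]_(x in E) `|(C * m x)%:E| = 0.
  apply/eqP; rewrite eq_le integral_ge0 ?andbT; last by move=> x _; exact: abse_ge0.
  under eq_integral do rewrite gee0_abs ?lee_fin ?mulr_ge0 ?(ltW C0) ?(ltW (m0 _))//.
  exact: H.
move/ae_eq_integral_abs => [//| |Z [mZ Z0 EZ]].
  by apply/measurable_EFinP; apply: measurable_funM => //; exact: measurable_tkernel.
apply: (subset_measure0 mE mZ _ Z0) => x Ex; apply: EZ => /= /(_ Ex) /eqP.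
by rewrite eqe mulf_eq0 !gt_eqF.
Qed.

(** The lower bound on capacity is applied to each superlevel set of |w|^q; the layer-cake formula
    then makes |w|^q integrable against the density m. *)
Lemma tpotential_lty_cap q w h : (1 <= q)%R -> (q < s)%R ->
  measurable_fun setT h -> (forall y, 0 <= h y) -> measurable_fun setT w ->
  riesz_cap [set x | ~ 0 <= w x] = 0 ->
  \int[@lebesgue_measure R]_(t in `]0%R, +oo[)
     riesz_cap [set x | t%:E < `|w x| `^ q] < +oo ->
  \int[mu]_(x in [set x | h x != 0]) (h x `^ s * npoweR (w x) (s - q)) < +oo ->
  tpotential 1 h o < +oo.
Proof.
move=> q1 qs mh h0 mw w0 wcap Hfin.
have [C C0 HC] := riesz_cap_lower.
have mW : measurable_fun setT (fun x => `|w x| `^ q).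
  by apply: measurable_fun_poweR; exact: measurableT_comp.
have mm : measurable_fun setT (fun x => (m x)%:E) by exact: measurable_tkernelE.
apply: (@tpotential_lty o s s1 Ns q w h q1 qs mh h0 mw) => //.
  exists [set x | ~ 0 <= w x]; split=> //.
    rewrite (_ : [set _ | _] = setT `&` [set x | w x < 0]).
      exact: emeasurable_fun_infty_o.
    by apply/seteqP; split=> x /=; rewrite ltNge; [move/negP|move=> [_ /negP]].
  apply: riesz_cap_null => //.
  rewrite (_ : [set _ | _] = setT `&` [set x | w x < 0]).
    exact: emeasurable_fun_infty_o.
  by apply/seteqP; split=> x /=; rewrite ltNge; [move/negP|move=> [_ /negP]].
have : \int[mu]_x ((C * m x)%:E * `|w x| `^ q) < +oo.
  apply: le_lt_trans wcap.
  rewrite (@layer_cake _ _ _ mu (fun x => (C * m x)%:E))//.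
  - apply: le_integral_nonneg => t _.
      by apply: integral_ge0 => x _; rewrite lee_fin mulr_ge0 ?(ltW C0)// ltW.
    apply: HC; have := emeasurable_fun_o_infty measurableT mW t%:E.
    by rewrite setTI.
  - by apply/measurable_EFinP; apply: measurable_funM => //; exact: measurable_tkernel.
  - by move=> x; rewrite lee_fin mulr_ge0 ?(ltW C0)// ltW.
  - by move=> x; exact: poweR_ge0.
under eq_integral do rewrite EFinM -muleA.
rewrite ge0_integralZl_EFin ?(ltW C0)//; last 2 first.
- by move=> x _; rewrite mule_ge0 ?poweR_ge0// lee_fin ltW.
- exact: emeasurable_funM.
move=> H; rewrite ltey; apply: contraTneq H => ->.
by rewrite gt0_muley ?lte_fin// ltxx.
Qed.

(** * Capacity of superlevel sets and integration in t *)

Section superlevel.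
Variables (I : countType) (code : int -> T -> I).
Hypothesis mcell : forall j c, measurable [set y | code j y = c].
Hypothesis cell_vol : forall j x,
  mu [set y | code j y = code j x] = ((2 ^ j) `^ N)%:E.
Hypothesis code_dist : forall j x y, code j x = code j y -> (rho x y <= 2 ^ j)%R.
Hypothesis code_succ : forall j x y, code j x = code j y ->
  code (j + 1)%R x = code (j + 1)%R y.
Variable q : R.
Hypotheses (q1 : (1 <= q)%R) (qs : (q < s)%R).

Let q0 : (0 < q)%R := lt_le_trans ltr01 q1.
Let s10 : (0 < s - 1)%R. Proof. by rewrite subr_gt0. Qed.
Let sq0 : (0 < s - q)%R. Proof. by rewrite subr_gt0. Qed.

(* Any exponent strictly between 1 and [N / g] would do. *)
Let p := ((1 + N / g) / 2)%R.
Let p1 : (1 < p)%R.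
Proof. by rewrite /p ltr_pdivlMr// mul1r ltrD2l ltr_pdivlMr// mul1r. Qed.
Let gpN : (g * p < N)%R.
Proof.
rewrite (_ : g * p = (g + N) / 2)%R; last by rewrite /p; field; rewrite gt_eqF.
by rewrite ltr_pdivrMr// mulr_natr mulr2n ltrD2r.
Qed.
Let a := (p * (s - 1))%R.
(** For q = 1 the strictness comes from p > 1 alone; equality would make the integral in t diverge
    logarithmically at 0. *)
Let a_sq : (s - q < a)%R.
Proof.
apply: (@le_lt_trans _ _ (s - 1)%R); first by rewrite lerD2l lerN2.
by rewrite /a ltr_pMl.
Qed.
Let a0 : (0 < a)%R := lt_trans sq0 a_sq.

Let C8 := (6 `^ (g * s) * (1 + (2 `^ p * 2 `^ (g * p) *
  (1 + radialC A N (g * p))) `^ (s - 1)))%R.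
Let C80 : (0 < C8)%R.
Proof. by rewrite mulr_gt0 ?powR_gt0// ltr_wpDr ?powR_ge0. Qed.

(** Since [riesz] is at least c M^(-g) times [potential], the test function has to be multiplied by
    M^g / c to be admissible. *)
Let D := ((M `^ g / c) `^ s * C8)%R.
Let D0 : (0 <= D)%R. Proof. by rewrite mulr_ge0 ?powR_ge0 ?ltW. Qed.

(** The two summands come from large and from small t in [integral_phi]. *)
Let C9 := (c `^ q * (radialC 2 1 (s / q) +
  2 `^ (g * (q - s + a)) * radialC 2 1 ((s - a) / q)))%R.
Let C90 : (0 < c `^ q)%R. Proof. exact: powR_gt0. Qed.

Let C9ge0 : (0 <= C9)%R.
Proof.
apply: mulr_ge0; first exact: ltW.
apply: addr_ge0; first exact: radialC_ge0.
by apply: mulr_ge0; [exact: powR_ge0|exact: radialC_ge0].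
Qed.
Let C91 : (0 < C9 + 1)%R. Proof. by rewrite ltr_wpDl. Qed.

Section one_potential.
Variable h : T -> \bar R.
Hypothesis mh : measurable_fun setT h.
Hypothesis h0 : forall y, 0 <= h y.
Hypothesis h_fin : forall x, tpotential 1 h x < +oo.

Let mU : measurable_fun setT (potential h). Proof. exact: measurable_potential. Qed.
Let U0 y : 0 <= potential h y. Proof. exact: potential_ge0. Qed.

(** The integrand in the bound of [capacity_test_function], for k h in place of h. *)
Let F (k : R) y : \bar R :=
  (if k%:E * potential h y <= 1 then (k%:E * h y) `^ s else 0) +
  (if 1 <= (2 `^ g)%:E * (k%:E * potential h y) then
     (k%:E * h y) `^ s * npoweR (k%:E * potential h y) a else 0).

Let F_ge0 k y : 0 <= F k y.
Proof.
by rewrite adde_ge0//; case: ifP => // _; rewrite ?mule_ge0 ?poweR_ge0 ?npoweR_ge0.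
Qed.

Let mF : measurable_fun setT (fun z : R * T => F z.1 z.2).
Proof.
have mk : measurable_fun setT (fun z : R * T => z.1%:E).
  by apply/measurable_EFinP; exact: measurable_fst.
have mkU : measurable_fun setT (fun z : R * T => z.1%:E * potential h z.2).
  exact: emeasurable_funM mk (measurable_comp_snd mU).
have mkh' : measurable_fun setT (fun z : R * T => z.1%:E * h z.2).
  exact: emeasurable_funM mk (measurable_comp_snd mh).
apply: emeasurable_funD.
  apply: measurable_fun_ifT => //; last exact: measurable_fun_poweR.
  by apply: measurable_fun_lee.
apply: measurable_fun_ifT => //.
  by apply: measurable_fun_lee => //; exact: measurable_funeM.
apply: emeasurable_funM; first exact: measurable_fun_poweR.
exact: measurable_fun_npoweR.
Qed.

(** Where [riesz h] exceeds t, the potential of (c / t) h exceeds 1, so the test function built for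
    (c / t) h serves after multiplication by M^g / c. *)
Lemma riesz_cap_superlevel (t : R) : (0 < t)%R ->
  riesz_cap [set x | t%:E < riesz h x] <= D%:E * \int[mu]_y F (c / t) y.
Proof.
move=> t0; set k := (c / t)%R; have k0 : (0 < k)%R by rewrite divr_gt0.
have mkh' : measurable_fun setT (fun y => k%:E * h y) by exact: measurable_funeM.
have kh0 y : 0 <= k%:E * h y by rewrite mule_ge0// lee_fin ltW.
have Uk : potential (fun y => k%:E * h y) = (fun x => k%:E * potential h x).
  apply/funext => x; rewrite /potential -ge0_integralZl_EFin ?(ltW k0)//.
  - by apply: eq_integral => y _; rewrite muleCA.
  - by move=> y _; rewrite mule_ge0 ?kernel_ge0.
  - exact: measurable_kernelM.
have kh_fin x : tpotential 1 (fun y => k%:E * h y) x < +oo.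
  rewrite /tpotential; under eq_integral do rewrite muleCA.
  rewrite ge0_integralZl_EFin ?(ltW k0)//; last 2 first.
  - by move=> y _; rewrite mule_ge0 ?lee_fin ?tkernel_ge0.
  - exact: measurable_tkernelM.
  apply: lte_mul_pinfty => //; first by rewrite lee_fin ltW.
  exact: h_fin.
have [f [mf f0 Uf If]] := capacity_test_function mcell cell_vol code_dist code_succ
  mkh' kh0 kh_fin p1 gpN s1.
rewrite Uk in Uf If; rewrite -/C8 -/a in If.
pose z := (M `^ g / c)%R; have z0 : (0 < z)%R by rewrite divr_gt0 ?powR_gt0.
have mzf : measurable_fun setT (fun y => z%:E * f y) by exact: measurable_funeM.
have zf0 y : 0 <= z%:E * f y by rewrite mule_ge0// lee_fin ltW.
apply: (le_trans (riesz_cap_le mzf zf0 _)) => [x /= tx|].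
  have : 1 <= potential f x.
    apply: Uf; have := lt_le_trans tx (riesz_le_potential x h0).
    have -> : k%:E * potential h x = t^-1%:E * (c%:E * potential h x).
      by rewrite muleA -EFinM (mulrC t^-1%R).
    by move=> tc; rewrite (lte_pdivlMl _ _ t0) (mule1 t%:E).
  move=> Uf1.
  have : c%:E <= (M `^ g)%:E * riesz f x.
    apply: le_trans (potential_le_riesz x mf f0).
    by rewrite -[leLHS]mule1; apply: lee_wpmul2l => //; rewrite lee_fin ltW.
  have -> : riesz (fun y => z%:E * f y) x = z%:E * riesz f x.
    rewrite /riesz [RHS]muleCA; congr (_ * _); rewrite -ge0_integralZl_EFin ?(ltW z0)//.
    - by apply: eq_integral => y _; rewrite muleCA.
    - by move=> y _; rewrite mule_ge0 ?npoweR_ge0.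
    - exact: mekf.
  have -> : z%:E * riesz f x = c^-1%:E * ((M `^ g)%:E * riesz f x).
    by rewrite [RHS]muleA -EFinM; congr (_%:E * _); rewrite /z mulrC.
  by move=> cf; rewrite (lee_pdivlMl _ _ c0) (mule1 c%:E).
have -> : \int[mu]_y (z%:E * f y) `^ s = (z `^ s)%:E * \int[mu]_y f y `^ s.
  rewrite -ge0_integralZl_EFin ?powR_ge0//; last 2 first.
  - by move=> y _; exact: poweR_ge0.
  - exact: measurable_fun_poweR.
  by apply: eq_integral => y _; rewrite poweRM ?lee_fin ?(ltW z0)// poweR_EFin.
rewrite /D EFinM -muleA; apply: lee_wpmul2l; first by rewrite lee_fin powR_ge0.
apply: (le_trans If); apply: lee_wpmul2l; first by rewrite lee_fin ltW.
have mkU : measurable_fun setT (fun y => k%:E * potential h y) by exact: measurable_funeM.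
rewrite ge0_integralD//; last 4 first.
- by move=> y _; case: ifP => // _; exact: poweR_ge0.
- apply: measurable_fun_ifT => //; last exact: measurable_fun_poweR.
  by apply: measurable_fun_lee.
- by move=> y _; case: ifP => // _; rewrite mule_ge0 ?poweR_ge0 ?npoweR_ge0.
- apply: measurable_fun_ifT => //.
    by apply: measurable_fun_lee => //; exact: measurable_funeM.
  apply: emeasurable_funM; first exact: measurable_fun_poweR.
  exact: measurable_fun_npoweR.
by rewrite !integral_if.
Qed.

Local Notation lam := (@lebesgue_measure R).
(** The integrals of radial powers are reused on the line, with rho(t) = |t|, A = 2 and N = 1. *)
Let vol1 (r : R) : (0 < r)%R -> lam [set t | (`|t| <= r)%R] <= (2 * r `^ 1)%:E.
Proof.
move=> r0; rewrite (_ : [set t | _] = `[(- r)%R, r%R]%classic); last first.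
  by apply/seteqP; split=> t; rewrite /= in_itv/= ler_norml.
have := lebesgue_measure_itv `[(- r)%R, r%R]; rewrite /= => ->.
rewrite lte_fin ifT; last by rewrite gtrN.
rewrite -EFinD opprK powRr1 ?(ltW r0)// lee_fin; lra.
Qed.

Let Z y : \bar R := if h y == 0 then 0 else h y `^ s * npoweR (potential h y) (s - q).

(** [F] without the factor h^s, at a point where U = u. The scaling is c / t^(1/q), because {riesz^q
    > t} is a superlevel set of [riesz] at t^(1/q). *)
Let phi (u t : R) : R :=
  ((if c / t `^ q^-1 * u <= 1 then (c / t `^ q^-1) `^ s else 0) +
   (if 1 <= 2 `^ g * (c / t `^ q^-1 * u) then
     (c / t `^ q^-1) `^ s * (c / t `^ q^-1 * u) `^ (- a) else 0))%R.

Let mk : measurable_fun setT (fun t : R => c / t `^ q^-1)%R.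
Proof.
rewrite (_ : (fun _ => _) = (fun t => c * t `^ (- q^-1))%R).
  by apply: measurable_funM => //; exact: measurable_powR.
by apply/funext => t; rewrite powRN.
Qed.

Let mphi u : measurable_fun setT (phi u).
Proof.
have mku : measurable_fun setT (fun t : R => c / t `^ q^-1 * u)%R.
  exact: measurable_funM.
apply: measurable_funD; apply: measurable_fun_ifT => //.
- exact: measurable_fun_ler.
- exact: (measurableT_comp (measurable_powR s) mk).
- by apply: measurable_fun_ler => //; exact: measurable_funM.
- apply: measurable_funM; first exact: (measurableT_comp (measurable_powR s) mk).
  exact: (measurableT_comp (measurable_powR (- a)%R) mku).
Qed.

(** The first term lives on t >= (c u)^q, where t^(-s/q) is integrable because s > q; the second on
    t <= (2^g c u)^q, where t^(-(s-a)/q) is integrable because a > s - q. Both integrals scale as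
    u^(q-s). *)
Let integral_phi u : (0 < u)%R ->
  \int[lam]_(t in `]0%R, +oo[) (phi u t)%:E <= (C9 * u `^ (q - s))%:E.
Proof.
move=> u0; have v0 : (0 < c * u)%R by rewrite mulr_gt0.
pose r1 := ((c * u) `^ q)%R; have r10 : (0 < r1)%R by exact: powR_gt0.
pose r2 := ((2 `^ g * (c * u)) `^ q)%R.
have w0 : (0 < 2 `^ g * (c * u))%R by rewrite mulr_gt0 ?powR_gt0.
have r20 : (0 < r2)%R by exact: powR_gt0.
pose f1 (t : R) : \bar R := if (r1 <= `|t|)%R then npoweR `|t|%:E (s / q) else 0.
pose f2 (t : R) : \bar R := if (`|t| <= r2)%R then npoweR `|t|%:E ((s - a) / q) else 0.
have mn : measurable_fun setT (fun t : R => `|t|%:E : \bar R).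
  by apply/measurable_EFinP.
have mf1 : measurable_fun setT f1.
  apply: measurable_fun_ifT => //; last exact: measurable_fun_npoweR.
  by apply: measurable_fun_ler.
have mf2 : measurable_fun setT f2.
  apply: measurable_fun_ifT => //; last exact: measurable_fun_npoweR.
  by apply: measurable_fun_ler.
have f10 t : 0 <= f1 t by rewrite /f1; case: ifP => // _; exact: npoweR_ge0.
have f20 t : 0 <= f2 t by rewrite /f2; case: ifP => // _; exact: npoweR_ge0.
have K10 : (0 <= c `^ s)%R by exact: powR_ge0.
have K20 : (0 <= c `^ (s - a) * u `^ (- a))%R by rewrite mulr_ge0 ?powR_ge0.
have qroot t x : (0 < t)%R -> (0 < x)%R -> (x <= t `^ q^-1)%R = (x `^ q <= t)%R.
  move=> t0 x0; apply/idP/idP => H.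
    rewrite (_ : t = t `^ q^-1 `^ q)%R; last first.
      by rewrite -powRrM mulVf ?gt_eqF// powRr1// ltW.
    by rewrite ge0_ler_powR ?nnegrE ?powR_ge0 ?(ltW q0) ?(ltW x0).
  rewrite (_ : x = x `^ q `^ q^-1)%R; last first.
    by rewrite -powRrM mulfV ?gt_eqF// powRr1// ltW.
  by rewrite ge0_ler_powR ?nnegrE ?powR_ge0 ?invr_ge0 ?(ltW q0) ?(ltW t0).
have qroot' t x : (0 < t)%R -> (0 < x)%R -> (t `^ q^-1 <= x)%R -> (t <= x `^ q)%R.
  move=> t0 x0 H.
  rewrite (_ : t = t `^ q^-1 `^ q)%R; last first.
    by rewrite -powRrM mulVf ?gt_eqF// powRr1// ltW.
  by rewrite ge0_ler_powR ?nnegrE ?powR_ge0 ?(ltW q0) ?(ltW x0).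
apply: (@le_trans _ _ (\int[lam]_(t in `]0%R, +oo[)
   ((c `^ s)%:E * f1 t + (c `^ (s - a) * u `^ (- a))%:E * f2 t))).
  apply: le_integral_nonneg => t; rewrite /= in_itv/= andbT => t0.
    by rewrite lee_fin addr_ge0//; case: ifP => // _; rewrite ?mulr_ge0 ?powR_ge0.
  have tq0 : (0 < t `^ q^-1)%R by exact: powR_gt0.
  have kt x : (0 < x)%R -> ((c / t `^ q^-1) `^ x = c `^ x * t `^ (- (x / q)))%R.
    move=> x0; rewrite powRM ?invr_ge0 ?(ltW c0) ?(ltW tq0)// -powRN -powRrM.
    by congr (_ * _ `^ _)%R; ring.
  rewrite /phi EFinD; apply: leeD.
    rewrite mulrAC ler_pdivrMr// mul1r qroot// -/r1 /f1 ger0_norm ?(ltW t0)//.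
    case: ifP => [r1t|_]; last by rewrite mule0.
    by rewrite npoweR_EFin// -EFinM lee_fin kt.
  have -> : (1 <= 2 `^ g * (c / t `^ q^-1 * u))%R = (t `^ q^-1 <= 2 `^ g * (c * u))%R.
    rewrite (_ : 2 `^ g * _ = 2 `^ g * (c * u) / t `^ q^-1)%R; last by ring.
    by rewrite ler_pdivlMr// mul1r.
  case: ifP => [H|_]; last by rewrite mule_ge0 ?lee_fin.
  rewrite /f2 ger0_norm ?(ltW t0)// (qroot' _ _ t0 w0 H).
  rewrite npoweR_EFin// -EFinM lee_fin kt// -(mulrA c) (mulrC _ u) mulrA.
  rewrite (@powRM _ (c * u)%R) ?invr_ge0 ?(ltW v0) ?(ltW tq0)// powRM ?(ltW c0) ?(ltW u0)//.
  rewrite -powRN -powRrM.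
  rewrite [leLHS](_ : _ = (c `^ s * c `^ (- a)) * u `^ (- a) *
     (t `^ (- (s / q)) * t `^ (- q^-1 * - a)))%R; last by ring.
  rewrite -!powRD; try by apply/implyP => _; rewrite gt_eqF.
  by rewrite le_eqVlt; apply/orP; left; apply/eqP; congr (_ * _ `^ _)%R; ring.
apply: (@le_trans _ _ (\int[lam]_t
   ((c `^ s)%:E * f1 t + (c `^ (s - a) * u `^ (- a))%:E * f2 t))).
  apply: ge0_subset_integral => //.
    by apply: emeasurable_funD; exact: measurable_funeM.
  by move=> t _; rewrite adde_ge0// mule_ge0// lee_fin.
rewrite ge0_integralD//; last 4 first.
- by move=> t _; rewrite mule_ge0// lee_fin.
- exact: measurable_funeM.
- by move=> t _; rewrite mule_ge0// lee_fin.
- exact: measurable_funeM.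
rewrite !ge0_integralZl_EFin//.
have I1 : \int[lam]_t f1 t <= (radialC 2 1 (s / q) * r1 `^ (1 - s / q))%:E.
  rewrite /f1 (integral_if lam (fun t => (r1 <= `|t|)%R)).
  by apply: integral_radial_far => //; rewrite ltr_pdivlMr// mul1r.
have I2 : \int[lam]_t f2 t <= (radialC 2 1 ((s - a) / q) * r2 `^ (1 - (s - a) / q))%:E.
  rewrite /f2 (integral_if lam (fun t => (`|t| <= r2)%R)).
  apply: integral_radial_near => //; rewrite ltr_pdivrMr// mul1r.
  by rewrite ltrBlDr -ltrBlDl.
apply: (le_trans (leeD (lee_wpmul2l _ I1) (lee_wpmul2l _ I2))); rewrite ?lee_fin//.
rewrite /C9 /r1 /r2 -!powRrM.
rewrite (_ : q * (1 - s / q) = q - s)%R; last by field; rewrite gt_eqF.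
rewrite (_ : q * (1 - (s - a) / q) = q - s + a)%R; last by field; rewrite gt_eqF.
rewrite (powRM _ (powR_ge0 2 g) (ltW v0)) !(powRM _ (ltW c0) (ltW u0)) -powRrM.
have E1 : (c `^ s * c `^ (q - s) = c `^ q)%R.
  by rewrite -powRD ?(gt_eqF c0) ?implybT//; congr (_ `^ _)%R; ring.
have E2 : (c `^ (s - a) * c `^ (q - s + a) = c `^ q)%R.
  by rewrite -powRD ?(gt_eqF c0) ?implybT//; congr (_ `^ _)%R; ring.
have E3 : (u `^ (- a) * u `^ (q - s + a) = u `^ (q - s))%R.
  by rewrite -powRD ?(gt_eqF u0) ?implybT//; congr (_ `^ _)%R; ring.
rewrite le_eqVlt; apply/orP; left; apply/eqP.
transitivity ((c `^ s * c `^ (q - s)) * radialC 2 1 (s / q) * u `^ (q - s) +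
  (c `^ (s - a) * c `^ (q - s + a)) *
  (2 `^ (g * (q - s + a)) * radialC 2 1 ((s - a) / q)) *
  (u `^ (- a) * u `^ (q - s + a)))%R; first by ring.
by rewrite E1 E2 E3; ring.
Qed.

Let integral_F y :
  \int[lam]_(t in `]0%R, +oo[) F (c / t `^ q^-1) y <= (C9 + 1)%:E * Z y.
Proof.
have k0 t : `]0%R, +oo[%classic t -> (0 < c / t `^ q^-1)%R.
  by rewrite /= in_itv/= andbT => t0; rewrite divr_gt0 ?powR_gt0.
rewrite /Z; have [hy0|hn0] := eqVneq (h y) 0.
  rewrite mule0 integral0_eq// => t _; rewrite /F hy0 mule0 poweR0r ?gt_eqF// mul0e.
  by case: ifP; case: ifP; rewrite adde0.
have hpos : 0 < h y by rewrite lt0e hn0 h0.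
have hs0 : 0 < h y `^ s by exact: poweR_gt0.
(* Where U is infinite both sides vanish: the condition of the first term fails, and the negative
   power in the second is 0. *)
have := U0 y; rewrite /F; case: (potential h y) => [u| |]//; last first.
  move=> _; rewrite npoweRy ?gt_eqF// !mule0 integral0_eq// => t /k0 kt.
  by rewrite gt0_muley ?lte_fin// leye_eq /= npoweRy ?gt_eqF// mule0 add0e; case: ifP.
(* Where U = 0 and h > 0, [Z] is infinite and the bound is trivial, as C9 + 1 is positive. *)
rewrite lee_fin le_eqVlt => /predU1P[<-|u0].
  by rewrite npoweR0 ?gt_eqF// (gt0_muley hs0) gt0_muley ?lte_fin// leey.
apply: (@le_trans _ _ (\int[lam]_(t in `]0%R, +oo[) (h y `^ s * (phi u t)%:E))).
  apply: le_integral_nonneg => t /k0 kt.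
    by rewrite adde_ge0//; case: ifP => // _; rewrite ?mule_ge0 ?poweR_ge0 ?npoweR_ge0.
  rewrite -!EFinM !lee_fin npoweR_EFin ?(mulr_gt0 kt u0)//.
  rewrite poweRM ?lee_fin ?(ltW kt)// poweR_EFin /phi.
  rewrite EFinD ge0_muleDr ?lee_fin; last 2 first.
  - by case: ifP => // _; exact: powR_ge0.
  - by case: ifP => // _; rewrite mulr_ge0 ?powR_ge0.
  apply: leeD; case: ifP => _; rewrite ?mule0// ?(muleC (h y `^ s))//.
  by rewrite EFinM muleAC.
rewrite ge0_integralZl ?poweR_ge0//; last 2 first.
- apply/measurable_EFinP; apply: measurable_funTS; exact: mphi.
- by move=> t _; rewrite lee_fin addr_ge0//; case: ifP => // _; rewrite ?mulr_ge0 ?powR_ge0.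
rewrite npoweR_EFin// muleCA opprB.
apply: lee_wpmul2l; first exact: poweR_ge0.
apply: (le_trans (integral_phi u0)); rewrite -EFinM lee_fin ler_wpM2r ?powR_ge0//.
by rewrite lerDl.
Qed.

Lemma riesz_cap_integral_potential :
  riesz_cap_integral (fun x => riesz h x `^ q) <=
  (D * (C9 + 1))%:E * \int[mu]_y Z y.
Proof.
have mF' : measurable_fun setT (fun z : R * T => F (c / z.1 `^ q^-1)%R z.2).
  have mz : measurable_fun setT (fun z : R * T => (c / z.1 `^ q^-1, z.2)%R).
    by apply: measurable_fun_pair; [exact: (measurable_comp_fst mk)|exact: measurable_snd].
  exact: (measurableT_comp mF mz).
pose H (t : R) := \int[mu]_y F (c / t `^ q^-1) y.
have mH : measurable_fun setT H.
  exact: (measurable_fun_fubini_tonelli_F (m2 := mu) (fun z : R * T => F (c / z.1 `^ q^-1)%R z.2)).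
have H0 t : 0 <= H t by exact: integral_ge0.
apply: (@le_trans _ _ (\int[lam]_(t in `]0%R, +oo[) (D%:E * H t))).
  apply: le_integral_nonneg => t; first by move=> _; exact: riesz_cap_ge0.
  rewrite /= in_itv/= andbT => t0.
  apply: le_trans (riesz_cap_superlevel (powR_gt0 q^-1 t0)).
  apply: riesz_cap_mono => x /= tx.
  rewrite ltNge; apply/negP => xt; move: tx; rewrite ltNge => /negP; apply.
  apply: (@le_trans _ _ ((t `^ q^-1)%:E `^ q)).
    apply: gt0_ler_poweR; rewrite ?in_itv/= ?leey ?andbT ?(ltW q0)//.
    - exact: riesz_ge0.
    - by rewrite lee_fin powR_ge0.
  by rewrite poweR_EFin -powRrM (mulVf (lt0r_neq0 q0)) (powRr1 (ltW t0)).
rewrite ge0_integralZl_EFin//; last exact: measurable_funTS.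
rewrite [leRHS](_ : _ = D%:E * ((C9 + 1)%:E * \int[mu]_y Z y)); last by rewrite muleA -EFinM.
apply: lee_wpmul2l; first by rewrite lee_fin.
have mZ : measurable_fun setT Z.
  apply: measurable_fun_ifT => //; first by apply: measurable_fun_eqe.
  by apply: emeasurable_funM; [exact: measurable_fun_poweR|exact: measurable_fun_npoweR].
have Z0 y : 0 <= Z y.
  by rewrite /Z; case: ifP => // _; rewrite mule_ge0 ?poweR_ge0 ?npoweR_ge0.
rewrite -ge0_integralZl_EFin ?(ltW C91)//.
(* The restriction to t > 0 is moved into the integrand to apply Tonelli's theorem on the whole
   product; what remains is the integral in t at fixed y. *)
pose F' (z : R * T) := if (0 < z.1)%R then F (c / z.1 `^ q^-1) z.2 else 0.
have mF'' : measurable_fun setT F'.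
  apply: measurable_fun_ifT => //.
  by apply: measurable_fun_ltr => //; exact: measurable_fst.
have F'0 z : 0 <= F' z by rewrite /F'; case: ifP.
apply: (@le_trans _ _ (\int[lam]_t \int[mu]_y F' (t, y))).
  rewrite integral_mkcond; apply: le_integral_nonneg => t _.
    by apply: erestrict_ge0.
  rewrite patchE; case: ifPn => [|_]; last exact: integral_ge0.
  by rewrite inE /= in_itv/= andbT /F' /= => ->.
rewrite (fubini_tonelli (m1 := lam) (m2 := mu) F')//.
apply: le_integral_nonneg => y _; first exact: integral_ge0.
apply: le_trans (integral_F y).
rewrite /F' /= (integral_if lam (fun t => (0 < t)%R) (fun t => F (c / t `^ q^-1) y)).
rewrite (_ : [set t | (0 < t)%R] = `]0%R, +oo[%classic)//.
by apply/seteqP; split=> t; rewrite /= in_itv/= andbT.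
Qed.

(** The power is decreasing, so the upper bound of [riesz] by c times [potential] is the right one
    here. *)
Lemma npoweR_potential_le y :
  npoweR (potential h y) (s - q) <=
  (c `^ (s - q))%:E * npoweR (riesz h y) (s - q).
Proof.
apply: (@le_trans _ _ ((c `^ (s - q))%:E * npoweR (c%:E * potential h y) (s - q))).
  rewrite npoweRM// muleA -EFinM -powRD ?(gt_eqF c0) ?implybT// subrr powRr0 mul1e.
  exact: lexx.
apply: lee_wpmul2l; first by rewrite lee_fin powR_ge0.
by apply: npoweR_le; [exact: sq0|exact: riesz_ge0|exact: riesz_le_potential].
Qed.

Lemma riesz_cap_integral_riesz :
  riesz_cap_integral (fun x => riesz h x `^ q) <=
  (D * (C9 + 1) * c `^ (s - q))%:E *
  \int[mu]_y (if h y == 0 then 0 else h y `^ s * npoweR (riesz h y) (s - q)).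
Proof.
apply: (le_trans riesz_cap_integral_potential).
rewrite (EFinM (D * (C9 + 1))) -muleA.
apply: lee_wpmul2l; first by rewrite lee_fin mulr_ge0// ltW.
rewrite -ge0_integralZl_EFin ?powR_ge0//; last 2 first.
- by move=> y _; case: ifP => // _; rewrite mule_ge0 ?poweR_ge0 ?npoweR_ge0.
- apply: measurable_fun_ifT => //; first by apply: measurable_fun_eqe.
  apply: emeasurable_funM; first exact: measurable_fun_poweR.
  by apply: measurable_fun_npoweR; exact: measurable_riesz.
apply: le_integral_nonneg => y _; rewrite /Z; case: ifP => _.
- exact: lexx.
- by rewrite mule_ge0 ?poweR_ge0 ?npoweR_ge0.
- by rewrite mule0.
- rewrite muleCA; apply: lee_wpmul2l; first exact: poweR_ge0.
  exact: npoweR_potential_le.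
Qed.
End one_potential.

(** The weight makes the truncated potential of h finite at o, hence everywhere; monotonicity then
    replaces |f| by h. Only the finiteness of the two integrals involving w enters, so B does not
    depend on w. *)
Let riesz_capacitary_inequality_ge0 : exists2 B : R, (0 < B)%R & forall f h w,
  measurable_fun setT f -> measurable_fun setT h -> measurable_fun setT w ->
  (forall y, 0 <= h y) -> {ae mu, forall y, `|f y| <= h y} ->
  riesz_cap [set x | ~ 0 <= w x] = 0 ->
  riesz_cap_integral (fun x => `|w x| `^ q) < +oo ->
  \int[mu]_(x in [set x | h x != 0]) (h x `^ s * npoweR (w x) (s - q)) < +oo ->
  riesz_cap_integral (fun x => riesz (fun y => `|f y|) x `^ q) <=
  B%:E * \int[mu]_y (if h y == 0 then 0 else h y `^ s * npoweR (riesz h y) (s - q)).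
Proof.
exists (D * (C9 + 1) * c `^ (s - q) + 1)%R.
  by rewrite ltr_wpDl// mulr_ge0 ?powR_ge0// mulr_ge0// ltW.
move=> f h w mf mh mw h0 fh w0 wq hw.
have ho : tpotential 1 h o < +oo by exact: (@tpotential_lty_cap q w h).
have h_fin x : tpotential 1 h x < +oo by exact: (@tpotential_lty_all o).
have mf' : measurable_fun setT (fun y => `|f y|) by exact: measurableT_comp.
apply: (@le_trans _ _ (riesz_cap_integral (fun x => riesz h x `^ q))).
  apply: le_integral_nonneg => t _; first exact: riesz_cap_ge0.
  apply: riesz_cap_mono => x /= /lt_le_trans; apply.
  have f0 y : 0 <= `|f y| by exact: abse_ge0.
  apply: gt0_ler_poweR; rewrite ?in_itv/= ?leey ?andbT ?(ltW q0)//.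
  - exact: (riesz_ge0 _ f0).
  - exact: riesz_ge0.
  - exact: riesz_le.
apply: (le_trans (riesz_cap_integral_riesz mh h0 h_fin)).
apply: lee_wpmul2r.
  apply: integral_ge0 => y _; case: ifP => // _.
  by rewrite mule_ge0 ?poweR_ge0 ?npoweR_ge0.
by rewrite lee_fin lerDl.
Qed.

(** The bound |f| <= h makes h nonnegative only almost everywhere. Passing to |h| changes neither
    its potential at any point nor the integrals. *)
Lemma riesz_capacitary_inequality : exists2 B : R, (0 < B)%R & forall f h w,
  measurable_fun setT f -> measurable_fun setT h -> measurable_fun setT w ->
  {ae mu, forall y, `|f y| <= h y} ->
  riesz_cap [set x | ~ 0 <= w x] = 0 ->
  riesz_cap_integral (fun x => `|w x| `^ q) < +oo ->
  \int[mu]_(x in [set x | h x != 0]) (`|h x| `^ s * npoweR (w x) (s - q)) < +oo ->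
  riesz_cap_integral (fun x => riesz (fun y => `|f y|) x `^ q) <=
  B%:E * \int[mu]_y (if h y == 0 then 0 else h y `^ s * npoweR (riesz h y) (s - q)).
Proof.
have [B B0 HB] := riesz_capacitary_inequality_ge0; exists B => // f h w mf mh mw fh w0 wq hw.
have mh' : measurable_fun setT (fun y => `|h y|) by exact: measurableT_comp.
have h'0 y : 0 <= `|h y| by exact: abse_ge0.
have hh' : {ae mu, forall y, `|h y| = h y}.
  by apply: filterS fh => y fhy; rewrite gee0_abs// (le_trans _ fhy).
have Rh x : riesz (fun y => `|h y|) x = riesz h x by exact: riesz_ae_eq.
apply: (le_trans (HB f _ w mf mh' mw h'0 _ w0 wq _)).
- by apply: filterS2 fh hh' => y fhy ->.
- rewrite (_ : [set x | _] = [set x | h x != 0])//.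
  by apply/seteqP; split=> x /=; rewrite abse_eq0.
rewrite le_eqVlt; apply/orP; left; apply/eqP; congr (_ * _).
have mR : measurable_fun setT (riesz h).
  by rewrite -(funext Rh); exact: measurable_riesz.
have mZ k : measurable_fun setT k -> measurable_fun setT
    (fun y => if k y == 0 then 0 else k y `^ s * npoweR (riesz h y) (s - q)).
  move=> mk'; apply: measurable_fun_ifT => //; first by apply: measurable_fun_eqe.
  by apply: emeasurable_funM; [exact: measurable_fun_poweR|exact: measurable_fun_npoweR].
have Z0 k y : 0 <= (if k y == 0 then 0 else k y `^ s * npoweR (riesz h y) (s - q)) :> \bar R.
  by case: ifP => // _; rewrite mule_ge0 ?poweR_ge0 ?npoweR_ge0.
under eq_integral do rewrite Rh.
apply: ge0_ae_eq_integral; [by []|exact: mZ|exact: mZ| | |].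
- by move=> y _; exact: (Z0 (fun y => `|h y|) y).
- by move=> y _; exact: (Z0 h y).
- by apply: filterS hh' => y hy _; rewrite hy.
Qed.

End superlevel.
End riesz.
End kernel.

(** * Lebesgue measure on R^n *)

Section lebesgue_Rn.
Context {R : realType}.
Local Notation RM := (measurableTypeR R).

Definition box n (J : 'I_n -> set RM) : set (n.-tuple RM) :=
  [set t | forall i, J i (tnth t i)].

Lemma measurable_box n (J : 'I_n -> set RM) :
  (forall i, measurable (J i)) -> measurable (box J).
Proof.
move=> mJ; rewrite (_ : box J =
    \bigcap_(i in [set: 'I_n]) ((fun t : n.-tuple RM => tnth t i) @^-1` J i)).
  apply: fin_bigcap_measurable => // i _; rewrite -[X in measurable X]setTI.
  exact: measurable_tnth.
by apply/seteqP; split=> t /=; [move=> tJ i _; exact: tJ|move=> tJ i; exact: tJ].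
Qed.

Lemma borel_lebesgue_box n (J : 'I_n -> set RM) (c : R) :
  (forall i, measurable (J i)) ->
  (forall i, lebesgue_measure (J i) = c%:E) ->
  borel_lebesgue R n (box J) = (c ^+ n)%:E.
Proof.
elim: n J => [|n IH] J mJ Jc.
  rewrite /borel_lebesgue /= diracE expr0 mem_set//.
  by move=> [].
rewrite /= /borel_step /pushforward.
rewrite (_ : cons_pair (n:=n) @^-1` _ = J ord0 `*` box (fun i => J (lift ord0 i))).
  rewrite product_measure1E//; last exact: measurable_box.
  rewrite (IH (fun i => J (lift ord0 i)))// exprS EFinM.
  by congr (_ * _)%E; exact: Jc.
apply/seteqP; split=> -[a t] /=.
  move=> Jat; split=> [|i]; first by have := Jat ord0; rewrite tnth0.
  by have := Jat (lift ord0 i); rewrite tnthS.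
move=> [Ja Jt] i; have [j ->|->] := unliftP ord0 i; last by rewrite tnth0.
by rewrite tnthS; exact: Jt.
Qed.

Lemma measurable_Rn n (A : set (n.-tuple RM)) :
  measurable A -> measurable (A : set (Rn R n)).
Proof. by move=> mA; apply: sub_caratheodory; exact: sub_sigma_algebra. Qed.

Lemma leb_box n (J : 'I_n -> set RM) (c : R) :
  (forall i, measurable (J i)) ->
  (forall i, lebesgue_measure (J i) = c%:E) ->
  @leb R n (box J) = (c ^+ n)%:E.
Proof.
move=> mJ Jc; rewrite -(borel_lebesgue_box mJ Jc) /leb.
by rewrite /completed_measure_extension /= measurable_mu_extE//; exact: measurable_box.
Qed.

Lemma measurable_coord n (i : 'I_n) :
  measurable_fun [set: Rn R n] (fun x : Rn R n => tnth x i : R).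
Proof.
move=> _ Y mY; rewrite setTI; apply: measurable_Rn.
by rewrite -[X in measurable X]setTI; exact: measurable_tnth.
Qed.

(** In this distance balls are boxes of explicit measure, and a dyadic cube of side 2^j has diameter
    at most 2^j, as the abstract cells require. *)
Definition sup_dist n (x y : Rn R n) : R :=
  \big[Order.max/0]_(i < n) `|(tnth x i : R) - (tnth y i : R)|.

Lemma sup_dist_le n (x y : Rn R n) r : 0 <= r ->
  (sup_dist x y <= r) <-> (forall i, `|(tnth x i : R) - tnth y i| <= r).
Proof.
move=> r0; split=> [xyr i|xyr]; last by apply: bigmax_le.
by apply: le_trans xyr; exact: le_bigmax.
Qed.

Lemma sup_dist_ge0 n (x y : Rn R n) : 0 <= sup_dist x y.
Proof. exact: bigmax_ge_id. Qed.

Lemma sup_distC n (x y : Rn R n) : sup_dist x y = sup_dist y x.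
Proof. by apply: eq_bigr => i _; rewrite distrC. Qed.

Lemma sup_dist_triangle n (x y z : Rn R n) :
  sup_dist x z <= sup_dist x y + sup_dist y z.
Proof.
apply/sup_dist_le => [|i]; first by rewrite addr_ge0 ?sup_dist_ge0.
rewrite (le_trans (ler_distD (tnth y i : R) _ _))// lerD//.
  by move: i; apply/sup_dist_le => //; exact: sup_dist_ge0.
by move: i; apply/sup_dist_le => //; exact: sup_dist_ge0.
Qed.

Lemma measurable_sup_dist n : measurable_fun [set: Rn R n * Rn R n]
  (fun p => sup_dist p.1 p.2).
Proof.
rewrite /sup_dist; elim: (index_enum _) => [|i s IH].
  by under eq_fun do rewrite big_nil; exact: measurable_cst.
under eq_fun do rewrite big_cons.
apply: measurable_maxr => //; apply: measurableT_comp => //.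
apply: measurable_funB.
  exact: (measurableT_comp (measurable_coord i) measurable_fst).
exact: (measurableT_comp (measurable_coord i) measurable_snd).
Qed.

Lemma leb_ball n (x : Rn R n) r : 0 < r ->
  @leb R n [set y | sup_dist x y <= r] = ((2 * r) ^+ n)%:E.
Proof.
move=> r0; pose J (i : 'I_n) : set RM := `[tnth x i - r, tnth x i + r]%classic.
rewrite (_ : [set y | _] = box J).
  apply: leb_box => i; first exact: measurable_itv.
  rewrite lebesgue_measure_itv/= lte_fin ifT; last by lra.
  by rewrite -EFinB; congr EFin; lra.
apply/seteqP; split=> y /=.
  move/sup_dist_le => /(_ (ltW r0)) H i; have := H i.
  by rewrite /J/= in_itv/= ler_distlC.
move=> H; apply/sup_dist_le; first exact: ltW.
by move=> i; have := H i; rewrite /J/= in_itv/= ler_distlC.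
Qed.

Definition dyadic_code n (j : int) (x : Rn R n) : {ffun 'I_n -> int} :=
  [ffun i => Num.floor ((tnth x i : R) / 2 ^ j)].

Let J n (j : int) (c : {ffun 'I_n -> int}) i : set RM :=
  `[(c i)%:~R * 2 ^ j, ((c i)%:~R + 1) * 2 ^ j[%classic.

Let cell_box n j (c : {ffun 'I_n -> int}) :
  [set y | dyadic_code j y = c] = box (J j c).
Proof.
have j0 : (0 : R) < 2 ^ j by rewrite exprz_gt0.
apply/seteqP; split=> y /=.
  move=> <- i; rewrite /J/= in_itv/= ffunE -ler_pdivlMr// -ltr_pdivrMr//.
  by have := floorD1_gt ((tnth y i : R) / 2 ^ j); rewrite intrD floor_le.
move=> H; apply/ffunP => i; rewrite ffunE; apply: floor_def.
have := H i; rewrite /J/= in_itv/= -ler_pdivlMr// -ltr_pdivrMr//.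
by rewrite intrD.
Qed.

Lemma measurable_dyadic_cell n j (c : {ffun 'I_n -> int}) :
  measurable [set y : Rn R n | dyadic_code j y = c].
Proof.
rewrite cell_box; apply: measurable_Rn; apply: measurable_box => i.
exact: measurable_itv.
Qed.

Lemma leb_dyadic_cell n j (c : {ffun 'I_n -> int}) :
  @leb R n [set y | dyadic_code j y = c] = ((2 ^ j) ^+ n)%:E.
Proof.
have j0 : (0 : R) < 2 ^ j by rewrite exprz_gt0.
rewrite cell_box; apply: leb_box => i; first exact: measurable_itv.
rewrite lebesgue_measure_itv/= lte_fin ifT; last by rewrite ltr_pM2r// ltrDl.
by rewrite -EFinB; congr EFin; rewrite -mulrBl addrAC subrr add0r mul1r.
Qed.

Lemma dyadic_code_dist n j (x y : Rn R n) :
  dyadic_code j x = dyadic_code j y -> sup_dist x y <= 2 ^ j.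
Proof.
have j0 : (0 : R) < 2 ^ j by rewrite exprz_gt0.
move=> xy; apply/sup_dist_le => [|i]; first exact: ltW.
have : (dyadic_code j x) i = (dyadic_code j y) i by rewrite xy.
rewrite !ffunE => H.
have := floor_le ((tnth x i : R) / 2 ^ j).
have := floorD1_gt ((tnth x i : R) / 2 ^ j).
have := floor_le ((tnth y i : R) / 2 ^ j).
have := floorD1_gt ((tnth y i : R) / 2 ^ j).
rewrite H intrD !ler_pdivlMr// !ltr_pdivrMr//.
set m := _%:~R => a1 a2 a3 a4; rewrite ler_distl; lra.
Qed.

Lemma dyadic_code_succ n j (x y : Rn R n) :
  dyadic_code j x = dyadic_code j y -> dyadic_code (j + 1) x = dyadic_code (j + 1) y.
Proof.
move=> xy; apply/ffunP => i.
have : (dyadic_code j x) i = (dyadic_code j y) i by rewrite xy.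
rewrite !ffunE => H.
have j0 : (0 : R) < 2 ^ j by rewrite exprz_gt0.
(* An integer m is at most the floor at scale j + 1 exactly when 2m is at most the floor at scale j;
   the latter floor therefore determines the former. *)
have half (a : R) (m : int) :
    (m <= Num.floor (a / 2 ^ (j + 1)))%R = (m * 2 <= Num.floor (a / 2 ^ j))%R.
  rewrite !floor_ge_int exprzDr ?unitfE// expr1z !ler_pdivlMr ?mulr_gt0//.
  by rewrite rmorphM/= -mulrA (mulrC (2 ^ j)).
by apply/eqP; rewrite eq_le !half -H -half lexx H -half lexx.
Qed.

Lemma sup_dist_le_eucl n (x y : Rn R n) : sup_dist x y <= eucl_dist x y.
Proof.
apply/sup_dist_le => [|i]; first exact: sqrtr_ge0.
rewrite -sqrtr_sqr ler_wsqrtr// (bigD1 i)//= lerDl sumr_ge0// => k _.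
exact: sqr_ge0.
Qed.

Lemma eucl_le_sup_dist n (x y : Rn R n) : eucl_dist x y <= n%:R * sup_dist x y.
Proof.
have d0 := sup_dist_ge0 x y.
rewrite -[leRHS]ger0_norm ?mulr_ge0// -sqrtr_sqr ler_wsqrtr//.
apply: (@le_trans _ _ (\sum_(i < n) (sup_dist x y) ^+ 2)).
  apply: ler_sum => i _; rewrite -[leLHS]ger0_norm ?sqr_ge0// normrX.
  rewrite lerXn2r ?nnegrE//.
  by move: i; apply/sup_dist_le.
rewrite sumr_const card_ord -[leLHS]mulr_natl exprMn.
apply: ler_wpM2r; first exact: sqr_ge0.
by rewrite -natrX ler_nat; case: n {x y d0} => // n; rewrite expnS expn1 leq_pmulr.
Qed.

End lebesgue_Rn.

(** * The capacitary inequality on R^n *)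

Section riesz_capacity.
Context {R : realType} (n : nat) (alpha s q : R).
Hypotheses (halpha : 0 < alpha < n%:R) (hs : 0 < s < n%:R / alpha) (hq : 1 <= q < s).

Lemma measurable_eucl_dist :
  measurable_fun [set: Rn R n * Rn R n] (fun p => eucl_dist p.1 p.2).
Proof.
rewrite (_ : (fun _ => _) = fun p : Rn R n * Rn R n =>
  (\sum_(i < n) ((tnth p.1 i : R) - tnth p.2 i) ^+ 2) `^ 2^-1).
  apply: (measurableT_comp (measurable_powR _)).
  apply: measurable_sum => i; apply: measurable_funX; apply: measurable_funB.
    exact: (measurable_comp_fst (measurable_coord i)).
  exact: (measurable_comp_snd (measurable_coord i)).
by apply/funext => p; rewrite powR12_sqrt// sumr_ge0// => i _; exact: sqr_ge0.
Qed.

Lemma Gamma_ge0 (x : R) : 0 <= Gamma x.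
Proof. by apply: Rintegral_ge0 => t _; rewrite mulr_ge0 ?powR_ge0 ?expR_ge0. Qed.

Lemma gamma_na_ge0 : 0 <= gamma_na n alpha.
Proof. by rewrite divr_ge0 ?mulr_ge0 ?Gamma_ge0 ?powR_ge0. Qed.

Local Open Scope ereal_scope.

Lemma Riesz_capacitary_inequality : (0 < gamma_na n alpha)%R ->
  exists2 B : R, (0 < B)%R & forall f h w : Rn R n -> \bar R,
  measurable_fun setT f -> measurable_fun setT h -> measurable_fun setT w ->
  {ae @leb R n, forall y, `|f y| <= h y} ->
  cap alpha s [set x | ~ 0 <= w x] = 0 ->
  cap_integral alpha s (fun x => `|w x| `^ q) < +oo ->
  \int[@leb R n]_(x in [set x | h x != 0]) (`|h x| `^ s * npoweR (w x) (s - q)) < +oo ->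
  cap_integral alpha s (fun x => Riesz alpha (fun y => `|f y|) x `^ q) <=
  B%:E * \int[@leb R n]_y
    (if h y == 0 then 0 else h y `^ s * npoweR (Riesz alpha h y) (s - q)).
Proof.
move=> gam0; have /andP[al0 aln] := halpha.
have /andP[s0 sna] := hs; have /andP[q1 qs] := hq.
have n0 : (0 < n%:R :> R)%R by exact: lt_trans aln.
have s1 : (1 < s)%R by exact: le_lt_trans qs.
have vol (x : Rn R n) (r : R) : (0 < r)%R ->
    @leb R n [set y | (sup_dist x y <= r)%R] <= (2 ^+ n * r `^ n%:R)%:E.
  by move=> r0; rewrite leb_ball// exprMn powR_mulrn// ltW.
have cell_vol (j : int) (x : Rn R n) :
    @leb R n [set y | dyadic_code j y = dyadic_code j x] = ((2 ^ j) `^ n%:R)%:E.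
  by rewrite leb_dyadic_cell powR_mulrn// exprz_ge0.
have g0 : (0 < n%:R - alpha)%R by rewrite subr_gt0.
have gN : (n%:R - alpha < n%:R)%R by rewrite ltrBlDr ltrDl.
(* A rearrangement of alpha s < n. *)
have Ns : (n%:R * (s - 1) < (n%:R - alpha) * s)%R.
  by move: sna; rewrite ltr_pdivlMr// => sna; lra.
have A0 : (0 <= 2 ^+ n :> R)%R by rewrite exprn_ge0.
(* Here N = n, g = n - alpha, A = 2^n since a ball of radius r has volume (2r)^n, and M = n compares
   the two distances; [point] is an arbitrary centre for the weight. *)
refine (@riesz_capacitary_inequality _ (Rn R n) R (@leb R n) (@sup_dist R n)
  (2 ^+ n)%R n%:R (n%:R - alpha)%R (@sup_dist_ge0 R n) (@sup_distC R n)
  (@sup_dist_triangle R n) (@measurable_sup_dist R n) A0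
  vol g0 gN (@eucl_dist R n) (gamma_na n alpha) n%:R s point
  measurable_eucl_dist (@sup_dist_le_eucl R n) (@eucl_le_sup_dist R n) n0 gam0 s1
  Ns _ (@dyadic_code R n) (@measurable_dyadic_cell R n) cell_vol
  (@dyadic_code_dist R n) (@dyadic_code_succ R n) q q1 qs).
Qed.

Lemma cap_ge0 (E : set (Rn R n)) : 0 <= cap alpha s E.
Proof. by apply/le_ereal_inf_tmp => _ [h _ <-]; exact: poweR_ge0. Qed.

Lemma cap_set0_le0 : cap alpha s (set0 : set (Rn R n)) <= 0.
Proof.
have /andP[s0 _] := hs.
apply: ereal_inf_lbound; exists (cst 0) => //=.
by rewrite Lnorm0 ?poweR0r ?gt_eqF// eqe gt_eqF.
Qed.

Lemma cap_integral_degenerate (f : Rn R n -> \bar R) : gamma_na n alpha = 0%R ->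
  cap_integral alpha s (fun x => Riesz alpha f x `^ q) <= 0.
Proof.
move=> gam0; have /andP[q1 _] := hq.
have -> : cap_integral alpha s (fun x => Riesz alpha f x `^ q) = 
   \int[@lebesgue_measure R]_(t in `]0%R, +oo[) 0; last by rewrite integral0.
apply: eq_integral => t; rewrite inE/= in_itv/= andbT => t0.
rewrite (_ : [set x | _] = set0).
  by apply/eqP; rewrite eq_le cap_set0_le0 cap_ge0.
apply/seteqP; split=> // x /=.
rewrite /Riesz gam0 mul0e poweR0r ?gt_eqF ?(lt_le_trans _ q1)// lte_fin.
by rewrite ltNge (ltW t0).
Qed.

End riesz_capacity.

Local Open Scope ereal_scope.

(** A finite infimum [Onorm] supplies one weight w with a finite capacitary integral of |w|^q and a
    finite weighted integral of |h|^s. These values do not enter B, which is uniform in f and h. *)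
Lemma KV_capacitary_bound {R : realType} (n : nat) (alpha s q : R) :
  (0 < alpha < n%:R)%R -> (0 < s < n%:R / alpha)%R -> (1 <= q < s)%R ->
  (0 < gamma_na n alpha)%R ->
  exists2 B : R, (0 < B)%R & forall f h : Rn R n -> \bar R,
  measurable_fun setT f -> Ospace alpha s q h ->
  {ae @leb R n, forall y, `|f y| <= h y} ->
  cap_integral alpha s (fun x => Riesz alpha (fun y => `|f y|) x `^ q) <=
  B%:E * \int[@leb R n]_y
    (if h y == 0 then 0 else h y `^ s * npoweR (Riesz alpha h y) (s - q)).
Proof.
move=> halpha hs hq gam0; have /andP[q1 qs] := hq.
have q0 : (0 < q)%R := lt_le_trans ltr01 q1.
have s0 : (0 < s)%R := lt_trans q0 qs.
have [B B0 HB] := Riesz_capacitary_inequality halpha hs hq gam0.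
exists B => // f h mf [mh /ereal_inf_lt[_ [w [[w0 mw _] w1] <-] hw]] fh.
apply: (HB f h w) => //.
- apply: (@lty_poweRy _ _ q^-1); first by rewrite invr_neq0 ?gt_eqF.
  by apply: le_lt_trans w1 _; exact: ltry.
- by apply: (@lty_poweRy _ _ s^-1) => //; rewrite invr_neq0 ?gt_eqF.
Qed.

Local Close Scope ereal_scope.

Theorem theorem1p3 (R : realType) (n : nat) (alpha s q : R)
  (hn : (1 <= n)%N) (halpha : 0 < alpha < n%:R) (hs : 0 < s < n%:R / alpha)
  (hq : 1 <= q < s) :
  exists2 B : R, 0 < B &
    forall f : Rn R n -> \bar R, KVspace alpha s q f ->
      (cap_integral alpha s (fun x => Riesz alpha (fun y => `|f y|) x `^ q)
        <= B%:E * KVnorm alpha s q f `^ q)%E.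
Proof.
have /andP[q1 qs] := hq.
have q0 : 0 < q := lt_le_trans ltr01 q1.
(* If the normalising constant vanished, so would all potentials; this spares a
   proof that Gamma is positive. *)
have := gamma_na_ge0 n alpha; rewrite le_eqVlt => /predU1P[/esym gam0|gam0].
  exists 1 => // f _; apply: (le_trans (cap_integral_degenerate hs hq _ gam0)).
  by rewrite mul1e poweR_ge0.
have [B B0 HB] := KV_capacitary_bound halpha hs hq gam0.
exists B => // f [mf _].
set L := cap_integral _ _ _.
have L0 : (0 <= L)%E by apply: integral_ge0 => t _; exact: cap_ge0.
have BL0 : (0 <= B^-1%:E * L)%E by rewrite mule_ge0// lee_fin invr_ge0 ltW.
(* [KVnorm] is an infimum of q-th roots, so the bound for each h is first solved for the root; the
   q-th power is restored after the infimum has been taken. *)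
have HL : ((B^-1%:E * L) `^ q^-1 <= KVnorm alpha s q f)%E.
  apply/le_ereal_inf_tmp => _ [h [Oh fh] <-].
  apply: gt0_ler_poweR; rewrite ?in_itv/= ?leey ?andbT ?invr_ge0 ?(ltW q0)//.
    apply: integral_ge0 => y _; case: ifP => // _.
    by rewrite mule_ge0 ?poweR_ge0 ?npoweR_ge0.
  by rewrite (lee_pdivrMl _ _ B0); exact: HB.
rewrite -(lee_pdivrMl _ _ B0) -[leLHS]poweRe1// -(mulVf (lt0r_neq0 q0)) poweRrM.
by apply: gt0_ler_poweR; rewrite ?in_itv/= ?leey ?andbT ?(ltW q0) ?poweR_ge0//;
  apply: le_trans HL; exact: poweR_ge0.
Qed.
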